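(* Let $b>0$, $\eta>0$ and $\Delta\ge3$. Suppose $G=(V,E)$ is an $n$-vertex graph of maximum degree $\Delta$. Let $\mu$ be a Gibbs distribution of a totally-connected spin system on $G$. Let $\mathcal B:=\{B_1,\dots,B_K\}$ be any collection of blocks (subsets of $V$) such that $V=\bigcup_{i=1}^KB_i$, and let $\alpha$ be a distribution over $\mathcal B$. If $\mu$ is $\eta$-spectrally independent and $b$-marginally bounded, then there exists a universal constant $C>0$ such that the mixing time of the block dynamics $P_{\mathcal B,\alpha}$ satisfies $$T_{mix}(P_{\mathcal B,\alpha})=O\left(\alpha_{min}^{-1}\cdot\Big(\frac{C(\eta+1)^5\Delta\log n}{b^6}\Big)^{3+\lceil\frac{2\eta}{b}\rceil}\right),$$ where $\alpha_{min}=\min_{v\in V}\sum_{B\in\mathcal B:\,v\in B}\alpha_B$.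
   Context: Spin systems: $G=(V,E)$ is a finite graph, $\mathcal S=\{1,\dots,q\}$. A spin system is given by a symmetric $K:\mathcal S\times\mathcal S\to\mathbb R\cup\{-\infty\}$ and $U:\mathcal S\to\mathbb R$, possibly together with a boundary condition: $G$ may be an induced subgraph of a larger graph, and $\tau:(\partial V)_\tau\to\mathcal S$ is an assignment of spins to a (possibly empty) subset $(\partial V)_\tau$ of the vertices outside $V$ adjacent to $V$. The Hamiltonian is $H(\sigma)=-\sum_{\{u,v\}\in E}K(\sigma_u,\sigma_v)-\sum_{\{u,v\}:u\in V,v\in(\partial V)_\tau}K(\sigma_u,\tau_v)-\sum_{v\in V}U(\sigma_v)$ (the second sum over edges of the larger graph), and the Gibbs distribution is $\mu(\sigma)=e^{-H(\sigma)}/Z$, with $e^{-\infty}=0$ and $Z>0$. $\Omega\subseteq\mathcal S^V$ denotes its support. Pinnings: for $\Lambda\subseteq V$, $\Omega_\Lambda=\{\tau\in\mathcal S^\Lambda:\mu(\sigma_\Lambda=\tau)>0\}$; for $\tau\in\Omega_\Lambda$ and $W\subseteq V\setminus\Lambda$, $\Omega_W^\tau=\{\xi\in\mathcal S^W:\mu(\sigma_W=\xi\mid\sigma_\Lambda=\tau)>0\}$; $\mathcal P^\tau=\{(u,s):u\in V\setminus\Lambda,s\in\Omega_{\{u\}}^\tau\}$. Totally-connected: for every $\Lambda\subseteq V$ and $\tau\in\Omega_\Lambda$, the graph on $\Omega^\tau_{V\setminus\Lambda}$ whose edges join configurations differing at exactly one vertex is connected. $\eta$-spectrally independent: for every $\Lambda\subseteq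 V$ (with $V\setminus\Lambda\ne\emptyset$) and $\tau\in\Omega_\Lambda$, the largest eigenvalue of $\Psi^\tau_\mu\in\mathbb R^{\mathcal P^\tau\times\mathcal P^\tau}$ is at most $\eta$, where $\Psi^\tau_\mu((u,a),(v,b'))=\mu(\sigma_v=b'\mid\sigma_u=a,\sigma_\Lambda=\tau)-\mu(\sigma_v=b'\mid\sigma_\Lambda=\tau)$ for $u\ne v$ and $0$ if $u=v$. $b$-marginally bounded: for every $\Lambda\subseteq V$, $\tau\in\Omega_\Lambda$ and $(v,s)\in\mathcal P^\tau$, $\mu(\sigma_v=s\mid\sigma_\Lambda=\tau)\ge b$. Block dynamics $P_{\mathcal B,\alpha}$: from $\sigma_t\in\Omega$, choose $B_i\in\mathcal B$ according to $\alpha$ and resample the configuration on $B_i$ from $\mu(\cdot\mid\sigma_t(V\setminus B_i))$, the conditional distribution on $B_i$ given the spins of $\sigma_t$ on $V\setminus B_i$. Mixing time: $T_{mix}(P)=\min\{t>0:\max_{x\in\Omega}\|P^t(x,\cdot)-\mu\|_{TV}\le1/4\}$. The constant $C$ and the constant implied by $O(\cdot)$ do not depend on $n,\Delta,\eta,b,G,\mu,\mathcal B,\alpha$. *)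

(* Defs.v *)
From HB Require Import structures.
From mathcomp Require Import all_boot all_order all_algebra.
From mathcomp Require Import all_classical all_reals all_analysis.

Set Implicit Arguments.
Unset Strict Implicit.
Unset Printing Implicit Defensive.

Import Order.TTheory GRing.Theory Num.Theory.
Local Open Scope ring_scope.

Record sgraph (T : finType) := SGraph {
  adj :> rel T;
  adj_sym : symmetric adj;
  adj_irr : irreflexive adj }.

Definition max_degree (V : finType) (G : sgraph V) : nat :=
  \max_(v : V) #|[set w | G v w]|.

(* The larger graph [ambient] has vertex set V + outer, and G is its induced
   subgraph on V. A boundary condition is a partial assignment of spins to the
   outer vertices, supported on vertices adjacent to V. Only the assigned outer
   vertices enter the Hamiltonian, so a finite [outer] loses no generality;
   [bdry] constantly None is the case without boundary condition.
   The q spins are 0, ..., q - 1. *)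
Record spin_system (R : realType) (V : finType) (G : sgraph V) (q : nat) :=
  SpinSystem {
    pot : 'I_q -> 'I_q -> \bar R;
    pot_sym : forall s t, pot s t = pot t s;
    pot_lty : forall s t, (pot s t < +oo)%E;
    self_pot : 'I_q -> R;
    outer : finType;
    ambient : sgraph (V + outer)%type;
    ambient_induced : forall u v, ambient (inl u) (inl v) = G u v;
    bdry : outer -> option 'I_q;
    bdry_adj : forall w, bdry w != None -> exists v, ambient (inl v) (inr w) }.

Section Gibbs.
Variables (R : realType) (V : finType) (G : sgraph V) (q : nat).
Variable S : spin_system R G q.

Definition conf := {ffun V -> 'I_q}.

(* Each edge {u, v} of G is counted once, through the orientation in which u
   comes before v in the enumeration of V; [pot] is symmetric. *)
Definition hamiltonian (sigma : conf) : \bar R :=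
  (- (\sum_(u : V) \sum_(v : V | G u v && (enum_rank u < enum_rank v)%N)
        pot S (sigma u) (sigma v))
   - (\sum_(u : V) \sum_(w : outer S | ambient S (inl u) (inr w))
        (if bdry w is Some s then pot S (sigma u) s else 0))
   - \sum_(u : V) (self_pot S (sigma u))%:E)%E.

(* The Hamiltonian is never -oo, so its Boltzmann factor is finite. *)
Definition weight (sigma : conf) : R := fine (expeR (- hamiltonian sigma)%E).

Definition partition_function : R := \sum_(sigma : conf) weight sigma.

Definition gibbs (sigma : conf) : R := weight sigma / partition_function.

Definition prob (A : {set conf}) : R := \sum_(sigma in A) gibbs sigma.

Definition cprob (A B : {set conf}) : R := prob (A :&: B) / prob B.

Definition Omega : {set conf} := [set sigma : conf | 0 < gibbs sigma].

Definition pconf (L : {set V}) := {ffun {v : V | v \in L} -> 'I_q}.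

Definition restr_conf (L : {set V}) (sigma : conf) : pconf L :=
  [ffun v : {v : V | v \in L} => sigma (val v)].

Definition agree (L : {set V}) (tau : pconf L) : {set conf} :=
  [set sigma : conf | restr_conf L sigma == tau].

Definition spin_at (v : V) (s : 'I_q) : {set conf} :=
  [set sigma : conf | sigma v == s].

Definition Omega_pin (L : {set V}) : {set pconf L} :=
  [set tau | 0 < prob (agree tau)].

Definition Omega_cond (L : {set V}) (tau : pconf L) (W : {set V}) :
    {set pconf W} :=
  [set xi | 0 < cprob (agree xi) (agree tau)].

Definition pairs (L : {set V}) (tau : pconf L) : {set V * 'I_q} :=
  [set us | (us.1 \notin L) && (0 < cprob (spin_at us.1 us.2) (agree tau))].

Definition one_site_adj (W : {set V}) (A : {set pconf W}) : rel (pconf W) :=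
  [rel xi zeta | [&& xi \in A, zeta \in A &
                     #|[set v | xi v != zeta v]| == 1%N]].

Definition totally_connected : Prop :=
  forall (L : {set V}) (tau : pconf L), tau \in Omega_pin L ->
  forall xi zeta : pconf (~: L),
    xi \in Omega_cond tau (~: L) -> zeta \in Omega_cond tau (~: L) ->
    connect (one_site_adj (Omega_cond tau (~: L))) xi zeta.

Definition influence (L : {set V}) (tau : pconf L) (ua vb : V * 'I_q) : R :=
  if ua.1 == vb.1 then 0
  else cprob (spin_at vb.1 vb.2) (spin_at ua.1 ua.2 :&: agree tau)
       - cprob (spin_at vb.1 vb.2) (agree tau).

Definition influence_mx (L : {set V}) (tau : pconf L) : 'M[R]_#|pairs tau| :=
  \matrix_(i, j) influence tau (enum_val i) (enum_val j).

(* The influence matrix is self-adjoint for the inner product weighted by the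
   conditional marginals, hence all its eigenvalues are real. *)
Definition spectrally_independent (eta : R) : Prop :=
  forall (L : {set V}) (tau : pconf L), ~: L != finset.set0 ->
    tau \in Omega_pin L ->
    forall a : R, eigenvalue (influence_mx tau) a -> a <= eta.

Definition marginally_bounded (b : R) : Prop :=
  forall (L : {set V}) (tau : pconf L), tau \in Omega_pin L ->
    forall vs, vs \in pairs tau -> b <= cprob (spin_at vs.1 vs.2) (agree tau).

Definition state := {sigma : conf | sigma \in Omega}.

(* For a block B, the probability of moving from x to y is that of y given
   the spins of x outside B. *)
Definition block_dynamics (Bs : {set {set V}}) (alpha : {set V} -> R)
    (x y : state) : R :=
  \sum_(B in Bs)
    alpha B * cprob [set val y] (agree (restr_conf (~: B) (val x))).

Fixpoint kernel_pow (P : state -> state -> R) (t : nat) (x y : state) : R :=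
  if t is t'.+1 then \sum_(z : state) P x z * kernel_pow P t' z y
  else (x == y)%:R.

Definition tv_gibbs (p : state -> R) : R :=
  2^-1 * \sum_(y : state) `|p y - gibbs (val y)|.

Definition max_tv (P : state -> state -> R) (t : nat) : R :=
  \big[Num.max/0]_(x : state) tv_gibbs (kernel_pow P t x).

(* The infimum is a minimum when the set is nonempty, and +oo otherwise. *)
Definition mixing_time (P : state -> state -> R) : \bar R :=
  ereal_inf [set (t%:R)%:E | t in
    [set t : nat | (0 < t)%N /\ max_tv P t <= 4^-1]%classic]%classic.

End Gibbs.

Definition is_distr (R : realType) (V : finType) (Bs : {set {set V}})
    (alpha : {set V} -> R) : Prop :=
  (forall B, B \in Bs -> 0 <= alpha B) /\ \sum_(B in Bs) alpha B = 1.

(* The sums are at most 1 when alpha is a distribution over Bs, so starting the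
   minimum at 1 is harmless for nonempty V. *)
Definition alpha_min (R : realType) (V : finType) (Bs : {set {set V}})
    (alpha : {set V} -> R) : R :=
  \big[Num.min/1]_(v : V) \sum_(B in Bs | v \in B) alpha B.

(* Main.v *)
Require Import Defs.
From HB Require Import structures.
From mathcomp Require Import all_boot all_order all_algebra.
From mathcomp Require Import all_classical all_reals all_analysis.
From mathcomp Require Import ring lra zify.

(** Write mu for the Gibbs measure and, for a nonnegative f, f_A for the
    conditional expectation of f given the spins on A.  Put
    h(A) = E[f_A ln f_A] and, for a set S of sites, gap f S = h(V) - h(V - S):
    the expected entropy of f under a resampling of S.  If f is the density of
    the law of the chain, one step replaces f by the average of the f_(V - B)
    with weights alpha_B, so by convexity the entropy drops by at least the sum
    of alpha_B gap f B.  Everything therefore rests on a block factorization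
      alpha_min * gap f V <= Gamma * sum_B alpha_B gap f B          [BF]
    for all f >= 0: it makes the entropy decay by 1 - alpha_min / Gamma per
    step, from at most n ln (1/b), until Hellinger's inequality gives total
    variation distance 1/4.  This costs the factor (ln n) / b on top of Gamma.

    The structural properties of gap come from one inequality, ent_submod_ge.
    It compares h(A u B) + h(Z) with h(A) + h(B), for Z inside A
    and B, up to the chi-square-like error
    E[(f_A - f_Z) (f_B - f_Z) / f_Z].
    - If the two parts are conditionally independent, the error vanishes and h
      is supermodular (gap_supermod).
    - If A and B add one site each to Z, spectral independence bounds the sum of
      the errors over all pairs of sites; since f_A <= f_Z / b, the chi-square
      terms are at most 2 / b times entropies.  This gives gap_local, whose
      constant 2 eta / b is where the exponent of the theorem comes from.

    Let r be the ceiling of 2 eta / b.  A downward induction turns gap_local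
    into (|S| - 1 - r) gap f S <= sum_(u in S) gap f (S - u), hence, averaging
    over the sets T of size l (uniform_block_factorization),
      gap f V <= C(n, r+1) / C(l, r+1) * average of gap f T.
    For l about n / (16 Delta) the ratio is at most (64 Delta)^(r+1), and a
    random T splits into components of size O((r+1) ln n), except with a
    probability so small that the exceptional T are absorbed in the left-hand
    side (few_big_components); this rests on counting connected sets, of which
    at most 2 (4 Delta)^k have size k and contain a given vertex.  On a component
    W, the same inequality with l = r+1 costs only C(|W|, r+1), a power of ln n,
    and leaves sets of r+1 sites.  These are handled by gap_crude: total
    connectivity allows a path argument, whose cost b^(-4(r+1)) is
    affordable for so few sites, and it reduces everything to single sites,
    each covered by blocks of total weight at least alpha_min.  Finally the
    components of T are conditionally independent, so their contributions
    add up by supermodularity (gap_le_components).  Altogether Gamma is at most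
    r + 1 times a power (C Delta ln n / b^4)^(r+1), which proves [BF]. *)

Set Implicit Arguments.
Unset Strict Implicit.
Unset Printing Implicit Defensive.

Import Order.TTheory GRing.Theory Num.Theory.
Local Open Scope ring_scope.

(** * Inequalities for x ln x *)

Section EntropyInequalities.
Import numFieldNormedType.Exports.
Variable R : realType.
Implicit Types b x y : R.

Lemma ln_ge_1BV x : 0 < x -> 1 - x^-1 <= ln x.
Proof.
move=> x0; have := @le_ln1Dx R (x^-1 - 1).
rewrite [1 + _]addrC subrK lnV ?posrE// => H.
by rewrite lerNl opprB in H; apply: H; rewrite ltrBDr addNr invr_gt0.
Qed.

Lemma ln_le_xB1 x : 0 < x -> ln x <= x - 1.
Proof.
move=> x0; have := @le_ln1Dx R (x - 1).
by rewrite [1 + _]addrC subrK; apply; rewrite ltrBDr addNr.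
Qed.

(** Convexity of x ln x in Bregman form; the hypothesis at 0 is absolute
    continuity, as ln 0 = 0 here. *)
Lemma xlnx_tangent x y : 0 <= x -> 0 <= y -> (y = 0 -> x = 0) ->
  x - y <= x * ln x - x * ln y.
Proof.
move=> x0 y0 yx; have [y_eq0|y_neq0] := eqVneq y 0.
  by rewrite (yx y_eq0) y_eq0; lra.
have [->|x_neq0] := eqVneq x 0; first by lra.
have xp : 0 < x by rewrite lt0r x_neq0.
have yp : 0 < y by rewrite lt0r y_neq0.
have := ln_ge_1BV (divr_gt0 xp yp).
rewrite ln_div ?posrE// invf_div -(ler_pM2l xp) mulrBr mulr1 mulrCA divff//.
by rewrite mulr1 mulrBr.
Qed.

Lemma xlnx_chi2 x y : 0 <= x -> 0 < y ->
  x * ln x - x * ln y - x + y <= (x - y) ^+ 2 / y.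
Proof.
move=> x0 yp; have [->|x_neq0] := eqVneq x 0.
  have -> : (0 - y) ^+ 2 / y = y by field; rewrite gt_eqF.
  lra.
have xp : 0 < x by rewrite lt0r x_neq0.
have := ln_le_xB1 (divr_gt0 xp yp).
rewrite ln_div ?posrE// -(ler_pM2l xp) mulrBr => H.
have -> : (x - y) ^+ 2 / y = x * (x / y - 1) - x + y by field; rewrite gt_eqF.
lra.
Qed.

(** Relative entropy dominates the squared Hellinger distance once the terms x
    - y, which integrate to 0, are removed: apply ln u >= 1 - 1/u to the
    square root of x / y. *)
Lemma xlnx_hellinger x y : 0 <= x -> 0 <= y -> (y = 0 -> x = 0) ->
  2 * (x - Num.sqrt x * Num.sqrt y) <= x * ln x - x * ln y.
Proof.
move=> x0 y0 yx; have [y_eq0|y_neq0] := eqVneq y 0.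
  by rewrite (yx y_eq0) y_eq0 sqrtr0; lra.
have [->|x_neq0] := eqVneq x 0; first by rewrite sqrtr0; lra.
have xp : 0 < x by rewrite lt0r x_neq0.
have yp : 0 < y by rewrite lt0r y_neq0.
have sx : 0 < Num.sqrt x by rewrite sqrtr_gt0.
have sy : 0 < Num.sqrt y by rewrite sqrtr_gt0.
have := ln_ge_1BV (divr_gt0 sx sy).
have ex : x = Num.sqrt x ^+ 2 by rewrite sqr_sqrtr.
have ey : y = Num.sqrt y ^+ 2 by rewrite sqr_sqrtr.
have lx : ln x = ln (Num.sqrt x) *+ 2 by rewrite {1}ex lnXn.
have ly : ln y = ln (Num.sqrt y) *+ 2 by rewrite {1}ey lnXn.
rewrite lx ly ln_div ?posrE// invf_div -(ler_pM2l xp) mulrBr mulr1 mulrBr.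
have -> : x * (Num.sqrt y / Num.sqrt x) = Num.sqrt x * Num.sqrt y.
  by rewrite {1}ex; field; rewrite gt_eqF.
by rewrite !mulrnAr !mulr2n => H; lra.
Qed.

(** Both sides vanish at 1 to second order, and the derivative ln u - b (u -
    1) of the difference has the sign of u - 1 on (0, 1/b]: for u <= 1 because
    b <= 1, for u >= 1 because ln u >= (u - 1) / u. *)
Lemma xlnx_quadratic1 b x : 0 < b -> b <= 1 -> 0 <= x -> b * x <= 1 ->
  b / 2 * (x - 1) ^+ 2 <= x * ln x - x + 1.
Proof.
move=> b0 b1 x0 bx; have [->|x_neq0] := eqVneq x 0.
  have -> : (0 - 1 : R) ^+ 2 = 1 by ring.
  by rewrite mul0r; lra.
have xp : 0 < x by rewrite lt0r x_neq0.
pose F (u : R) := u * ln u - u + 1 - b / 2 * (u - 1) ^+ 2.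
pose F' (u : R) := ln u - b * (u - 1).
have dF (u : R) : 0 < u -> is_derive u 1 F (F' u).
  move=> u0; have dln := is_derive1_ln u0.
  rewrite /F /F'; apply: is_derive_eq.
  rewrite /GRing.scale/=; field.
  by rewrite gt_eqF.
have cF (u v : R) : 0 < u -> {within `[u, v], continuous F}%classic.
  move=> u0; apply: derivable_within_continuous => w; rewrite in_itv/= => /andP[uw _].
  by have [] := dF w (lt_le_trans u0 uw).
have F1 : F 1 = 0 by rewrite /F ln1; ring.
suff : 0 <= F x by rewrite /F; lra.
case: (leP x 1) => x1.
  have [|c cx] := @MVT_segment R F F' x 1 x1 _ (cF x 1 xp).
    by move=> u; rewrite in_itv/= => /andP[xu _]; apply: dF; apply: lt_trans xu.
  rewrite F1 => H; move: cx; rewrite in_itv/= => /andP[xc c1].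
  have c0 := lt_le_trans xp xc.
  have lc := ln_le_xB1 c0; rewrite /F' in H.
  have : (ln c - b * (c - 1)) * (1 - x) <= 0.
    apply: mulr_le0_ge0; last by rewrite subr_ge0.
    have : (1 - b) * (c - 1) <= 0 by rewrite mulr_ge0_le0 ?subr_ge0 ?subr_le0.
    lra.
  lra.
have [|c cx] := @MVT_segment R F F' 1 x (ltW x1) _ (cF 1 x ltr01).
  by move=> u; rewrite in_itv/= => /andP[xu _]; apply: dF; apply: lt_trans xu.
rewrite F1 => H; move: cx; rewrite in_itv/= => /andP[c1 cx].
have c0 := lt_le_trans ltr01 c1.
have lc := ln_ge_1BV c0; rewrite /F' in H.
have bc : b <= c^-1.
  by rewrite -[c^-1]mul1r ler_pdivlMr// (le_trans _ bx)// ler_pM2l.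
have cV : c^-1 * c = 1 by rewrite mulVf// gt_eqF.
have H2 : b * (c - 1) <= 1 - c^-1.
  have : b * (c - 1) <= c^-1 * (c - 1) by rewrite ler_wpM2r// subr_ge0.
  by rewrite [c^-1 * _]mulrBr cV mulr1.
have : 0 <= (ln c - b * (c - 1)) * (x - 1) by apply: mulr_ge0; lra.
lra.
Qed.

(** The converse of the chi-square bound, at the price 2 / b when the density
    ratio x / y is at most 1 / b. *)
Lemma xlnx_quadratic b x y : 0 < b -> b <= 1 -> 0 <= x -> 0 < y -> b * x <= y ->
  b / 2 * ((x - y) ^+ 2 / y) <= x * ln x - x * ln y - x + y.
Proof.
move=> b0 b1 x0 yp bx; have [->|x_neq0] := eqVneq x 0.
  have -> : (0 - y) ^+ 2 / y = y by field; rewrite gt_eqF.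
  nra.
have xp : 0 < x by rewrite lt0r x_neq0.
have H : b / 2 * (x / y - 1) ^+ 2 <= x / y * ln (x / y) - x / y + 1.
  apply: xlnx_quadratic1 => //; first by rewrite divr_ge0// ltW.
  by rewrite mulrA ler_pdivrMr// mul1r.
rewrite ln_div ?posrE// -(ler_pM2l yp) in H.
have e1 : y * (b / 2 * (x / y - 1) ^+ 2) = b / 2 * ((x - y) ^+ 2 / y).
  by field; rewrite gt_eqF.
have e2 : y * (x / y * (ln x - ln y) - x / y + 1)
   = x * ln x - x * ln y - x + y by field; rewrite gt_eqF.
by rewrite e1 e2 in H.
Qed.

End EntropyInequalities.

(** * Conditional expectation given the spins on a set *)

Section ConditionalExpectation.
Import fintype boot.finset.
Variables (R : realType) (V Q : finType).
Notation config := {ffun V -> Q}.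
Variable mu : config -> R.
Hypothesis mu_ge0 : forall s, 0 <= mu s.
Implicit Types (A B S T U W Z : {set V}) (s t : config) (f g : config -> R).

Definition eqon A s t := [forall v in A, s v == t v].

Lemma eqonP A s t : reflect {in A, s =1 t} (eqon A s t).
Proof.
apply: (iffP forall_inP) => H v vA; first exact/eqP/H.
by apply/eqP/H.
Qed.

Lemma eqon_refl A s : eqon A s s. Proof. exact/eqonP. Qed.

Lemma eqon_sym A s t : eqon A s t = eqon A t s.
Proof. by apply/eq_forallb => v; rewrite eq_sym. Qed.

Lemma eqon_trans A s t u : eqon A s t -> eqon A t u -> eqon A s u.
Proof. by move=> /eqonP H /eqonP K; apply/eqonP => v vA; rewrite H// K. Qed.

Lemma eqon_congr A s s' t : eqon A s s' -> eqon A s t = eqon A s' t.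
Proof.
move=> H; apply/idP/idP; last exact: eqon_trans.
by apply: eqon_trans; rewrite eqon_sym.
Qed.

Lemma sub_eqon A B s t : A \subset B -> eqon B s t -> eqon A s t.
Proof. by move=> /subsetP AB /eqonP H; apply/eqonP => v /AB/H. Qed.

Lemma eqonU A B s t : eqon (A :|: B) s t = eqon A s t && eqon B s t.
Proof.
apply/eqonP/andP => [H|[/eqonP HA /eqonP HB] v].
  by split; apply/eqonP => v vA; apply: H; rewrite inE vA ?orbT.
by rewrite inE => /orP[/HA|/HB].
Qed.

Lemma eqonT s t : eqon [set: V] s t = (s == t).
Proof.
apply/eqonP/eqP => [H|->//]; apply/ffunP => v; exact: H.
Qed.

Lemma eqon0 s t : eqon finset.set0 s t.
Proof. by apply/eqonP => v; rewrite inE. Qed.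

Definition depends_on A g := forall s t, eqon A s t -> g s = g t.

Definition mass A s := \sum_(t | eqon A s t) mu t.

(** E[f | spins on A], evaluated at s. Off the support the mass vanishes and
    the quotient is 0. *)
Definition cexp A f s := (\sum_(t | eqon A s t) mu t * f t) / mass A s.

Lemma mass_ge0 A s : 0 <= mass A s.
Proof. by apply: sumr_ge0. Qed.

Lemma mass_gt0 A s : 0 < mu s -> 0 < mass A s.
Proof.
move=> ms; rewrite /mass (bigD1 s) ?eqon_refl//=.
by rewrite ltr_wpDr// sumr_ge0.
Qed.

Lemma mass_depends A : depends_on A (mass A).
Proof. by move=> s t H; apply: eq_bigl => u; apply: eqon_congr. Qed.

Lemma cexp_depends A f : depends_on A (cexp A f).
Proof.
move=> s t H; rewrite /cexp (mass_depends H); congr (_ / _).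
by apply: eq_bigl => u; apply: eqon_congr.
Qed.

Lemma sub_depends A B g : A \subset B -> depends_on A g -> depends_on B g.
Proof. by move=> AB H s t /(sub_eqon AB)/H. Qed.

Lemma mass_eq0 A s t : mass A s = 0 -> eqon A s t -> mu t = 0.
Proof. by move=> /eqP; rewrite psumr_eq0// => /allP H st; have := H t (mem_index_enum _);
  rewrite st => /eqP. Qed.

Lemma mass_cexp A f s : mass A s * cexp A f s = \sum_(t | eqon A s t) mu t * f t.
Proof.
rewrite /cexp; have [m0|m0] := eqVneq (mass A s) 0; last by rewrite mulrC divfK.
rewrite m0 mul0r big1// => t st; by rewrite (mass_eq0 m0 st) mul0r.
Qed.

(** The defining property of conditional expectation; the other rules below
    follow from it. *)
Lemma sum_cexp A g f : depends_on A g ->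
  \sum_s mu s * (g s * cexp A f s) = \sum_s mu s * (g s * f s).
Proof.
move=> gA.
transitivity (\sum_s \sum_(t | eqon A s t) mu s * (g s * (mu t * f t / mass A s))).
  apply: eq_bigr => s _; rewrite /cexp mulr_suml !mulr_sumr.
  by apply: eq_bigr => t _.
rewrite (exchange_big_dep predT)//=; apply: eq_bigr => t _.
transitivity (\sum_(s | eqon A t s) mu s * (g t * (mu t * f t / mass A t))).
  by apply: eq_big => [s|s]; rewrite eqon_sym// => st; rewrite (gA _ _ st) (mass_depends st).
rewrite -mulr_suml -/(mass A t).
have [m0|m0] := eqVneq (mass A t) 0; last by field.
by rewrite m0 (mass_eq0 m0 (eqon_refl _ _)) !mul0r.
Qed.

(** The indicator of a class of a coarser Z depends on A, so the rule
    localises to that class. *)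
Lemma sum_cexp_class Z A g f s0 : Z \subset A -> depends_on A g ->
  \sum_(s | eqon Z s0 s) mu s * (g s * cexp A f s) =
  \sum_(s | eqon Z s0 s) mu s * (g s * f s).
Proof.
move=> ZA gA; rewrite big_mkcond [RHS]big_mkcond/=.
pose g' s := (eqon Z s0 s)%:R * g s.
have g'A : depends_on A g'.
  move=> s t st; rewrite /g' (gA _ _ st); congr (_%:R * _).
  by rewrite ![eqon Z s0 _]eqon_sym (eqon_congr _ (sub_eqon ZA st)).
transitivity (\sum_s mu s * (g' s * cexp A f s)).
  by apply: eq_bigr => s _; rewrite /g'; case: eqon; rewrite ?mul1r// !mul0r mulr0.
rewrite (sum_cexp f g'A); apply: eq_bigr => s _.
by rewrite /g'; case: eqon; rewrite ?mul1r// !mul0r mulr0.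
Qed.

Lemma cexp_cexp Z A f s : Z \subset A -> cexp Z (cexp A f) s = cexp Z f s.
Proof.
move=> ZA; rewrite /cexp; congr (_ / _).
have /(_ (fun _ _ _ => erefl)) := @sum_cexp_class Z A (fun=> 1) f s ZA.
by under eq_bigr do rewrite mul1r; under [RHS]eq_bigr do rewrite mul1r.
Qed.

Lemma cexp_pull A g f s : depends_on A g ->
  cexp A (fun t => g t * f t) s = g s * cexp A f s.
Proof.
move=> gA; rewrite /cexp mulrA mulr_sumr; congr (_ / _).
by apply: eq_bigr => t st; rewrite -(gA _ _ st) mulrCA.
Qed.

Lemma eq_cexp A f g s : (forall t, 0 < mu t -> f t = g t) ->
  cexp A f s = cexp A g s.
Proof.
move=> H; rewrite /cexp; congr (_ / _); apply: eq_bigr => t _.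
by have := mu_ge0 t; rewrite le_eqVlt => /predU1P[<-|/H->//]; rewrite !mul0r.
Qed.

Lemma cexpT f s : 0 < mu s -> cexp [set: V] f s = f s.
Proof.
move=> ms; rewrite /cexp /mass (eq_bigl (pred1 s)); last first.
  by move=> t; rewrite eqonT eq_sym.
rewrite big_pred1_eq (eq_bigl (pred1 s)); last first.
  by move=> t; rewrite eqonT eq_sym.
by rewrite big_pred1_eq mulrC mulKf// gt_eqF.
Qed.

Lemma cexp_ge0 A f s : (forall t, 0 <= f t) -> 0 <= cexp A f s.
Proof.
move=> f0; rewrite divr_ge0 ?mass_ge0// sumr_ge0// => t _.
by rewrite mulr_ge0.
Qed.

Lemma cexp_le_sub Z A f s : (forall t, 0 <= f t) -> Z \subset A ->
  mass A s * cexp A f s <= mass Z s * cexp Z f s.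
Proof.
move=> f0 ZA; rewrite !mass_cexp [leLHS]big_mkcond [leRHS]big_mkcond/=.
apply: ler_sum => t _; have := mulr_ge0 (mu_ge0 t) (f0 t).
case: ifP => [st|_]; first by rewrite (sub_eqon ZA st).
by case: ifP.
Qed.

Lemma cexp_eq0_sub Z A f s : (forall t, 0 <= f t) -> Z \subset A -> 0 < mu s ->
  cexp Z f s = 0 -> cexp A f s = 0.
Proof.
move=> f0 ZA ms e0; have := cexp_le_sub s f0 ZA; rewrite e0 mulr0.
rewrite pmulr_rle0 ?mass_gt0// => H; apply/eqP.
by rewrite eq_le H cexp_ge0.
Qed.

Lemma sum_cexp1 A f : \sum_s mu s * cexp A f s = \sum_s mu s * f s.
Proof.
have /(_ (fun _ _ _ => erefl)) := @sum_cexp A (fun=> 1) f.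
by under eq_bigr do rewrite mul1r; under [RHS]eq_bigr do rewrite mul1r.
Qed.

End ConditionalExpectation.

(** * The entropy of a marginal as a set function *)

Section EntropySetFunction.
Import fintype boot.finset.
Variables (R : realType) (V Q : finType).
Notation config := {ffun V -> Q}.
Variable mu : config -> R.
Hypothesis mu_ge0 : forall s, 0 <= mu s.
Implicit Types (A B C S T U W Z X : {set V}) (s t : config) (f g : config -> R).

Definition ent f A := \sum_s mu s * (cexp mu A f s * ln (cexp mu A f s)).

(** The expected entropy of f when S is resampled given the rest. *)
Definition gap f S := ent f [set: V] - ent f (~: S).

Lemma ler_sum_mu f g : (forall s, 0 < mu s -> f s <= g s) ->
  \sum_s mu s * f s <= \sum_s mu s * g s.
Proof.
move=> H; apply: ler_sum => s _; have := mu_ge0 s.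
rewrite le_eqVlt => /predU1P[<-|ms]; first by rewrite !mul0r.
by rewrite ler_pM2l// H.
Qed.

Lemma eq_sum_mu f g : (forall s, 0 < mu s -> f s = g s) ->
  \sum_s mu s * f s = \sum_s mu s * g s.
Proof. by move=> H; apply/eqP; rewrite eq_le !ler_sum_mu// => s /H ->. Qed.

(** ln f_A depends on A, so the factor f_A in front of it may be replaced by
    any finer f_C. *)
Lemma ent_sub f A C : A \subset C ->
  ent f A = \sum_s mu s * (cexp mu C f s * ln (cexp mu A f s)).
Proof.
move=> AC; rewrite /ent.
have dep : depends_on A (fun s => ln (cexp mu A f s)).
  by move=> s t st; rewrite (cexp_depends mu f st).
rewrite (eq_bigr (fun s => mu s * (ln (cexp mu A f s) * cexp mu A (cexp mu C f) s)));
  last first.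
  by move=> s _; rewrite cexp_cexp// [ln _ * _]mulrC.
rewrite (sum_cexp mu_ge0 _ dep); apply: eq_bigr => s _.
by rewrite [ln _ * _]mulrC.
Qed.

Section Nonneg.
Variable f : config -> R.
Hypothesis f_ge0 : forall s, 0 <= f s.

(** After ent_sub all four entropies are integrals against f_(A u B), and the
    tangent inequality compares f_(A u B) with f_A f_B / f_Z. *)
Lemma ent_submod_ge A B Z : Z \subset A -> Z \subset B ->
  \sum_s mu s * cexp mu Z f s
    - \sum_s mu s * (cexp mu A f s * cexp mu B f s / cexp mu Z f s)
  <= ent f (A :|: B) - ent f A - ent f B + ent f Z.
Proof.
move=> ZA ZB; set C := A :|: B.
have AC : A \subset C := subsetUl _ _.
have BC : B \subset C := subsetUr _ _.
have ZC := subset_trans ZA AC.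
rewrite (ent_sub f (subxx C)) (ent_sub f AC) (ent_sub f BC) (ent_sub f ZC).
have -> : \sum_s mu s * cexp mu Z f s = \sum_s mu s * cexp mu C f s.
  by rewrite !sum_cexp1.
rewrite -!sumrB -big_split/= -subr_ge0 -sumrB; apply: sumr_ge0 => s _.
have := mu_ge0 s; rewrite le_eqVlt => /predU1P[<-|ms].
  by rewrite !mul0r !subrr add0r subrr.
suff : 0 <= cexp mu C f s * ln (cexp mu C f s) - cexp mu C f s * ln (cexp mu A f s)
     - cexp mu C f s * ln (cexp mu B f s) + cexp mu C f s * ln (cexp mu Z f s)
     - (cexp mu C f s - cexp mu A f s * cexp mu B f s / cexp mu Z f s).
  move=> /(mulr_ge0 (ltW ms)); rewrite mulrBr !mulrBr mulrDr !mulrBr; lra.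
have c0 := cexp_ge0 mu_ge0 C s f_ge0; have a0 := cexp_ge0 mu_ge0 A s f_ge0.
have b0 := cexp_ge0 mu_ge0 B s f_ge0; have z0 := cexp_ge0 mu_ge0 Z s f_ge0.
have [cE|cN] := eqVneq (cexp mu C f s) 0.
  rewrite cE !mul0r; have := divr_ge0 (mulr_ge0 a0 b0) z0; lra.
have pos (Y : {set V}) : Y \subset C -> 0 < cexp mu Y f s.
  move=> YC; rewrite lt0r (cexp_ge0 mu_ge0 _ _ f_ge0) andbT.
  by apply: contraNN cN => /eqP/(cexp_eq0_sub mu_ge0 f_ge0 YC ms) ->.
have := pos _ AC; have := pos _ BC; have := pos _ ZC; have := pos _ (subxx C).
move: (cexp mu A f s) (cexp mu B f s) (cexp mu C f s) (cexp mu Z f s).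
move=> a b c z cp zp bp ap.
have abz : 0 < a * b / z by rewrite divr_gt0// mulr_gt0.
have := @xlnx_tangent R c (a * b / z) (ltW cp) (ltW abz).
rewrite ln_div ?posrE ?mulr_gt0// lnM ?posrE// => H.
suff : c - a * b / z <= c * ln c - c * (ln a + ln b - ln z).
  by rewrite mulrBr mulrDr; lra.
by apply: H => e0; move: abz; rewrite e0 ltxx.
Qed.

Lemma ent_mono A B : A \subset B -> ent f A <= ent f B.
Proof.
move=> AB; rewrite -subr_ge0 (ent_sub f AB) (ent_sub f (subxx B)).
have e : \sum_s mu s * cexp mu B f s - \sum_s mu s * cexp mu A f s = 0.
  by rewrite !sum_cexp1// subrr.
rewrite -[leLHS]e -!sumrB.
rewrite (eq_bigr (fun s => mu s * (cexp mu B f s - cexp mu A f s))); last first.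
  by move=> s _; rewrite mulrBr.
rewrite [leRHS](eq_bigr (fun s => mu s * (cexp mu B f s * ln (cexp mu B f s)
    - cexp mu B f s * ln (cexp mu A f s)))); last by move=> s _; rewrite mulrBr.
apply: ler_sum_mu => s ms; apply: xlnx_tangent; rewrite ?cexp_ge0//.
exact: cexp_eq0_sub.
Qed.

Lemma gap_ge0 S : 0 <= gap f S.
Proof. by rewrite subr_ge0 ent_mono// subsetT. Qed.

Lemma gap_mono S T : S \subset T -> gap f S <= gap f T.
Proof. by move=> ST; apply: lerB => //; apply: ent_mono; rewrite setCS. Qed.

End Nonneg.

Definition swap_on U s t : config := [ffun v => if v \in U then t v else s v].

Lemma swap_onK U s t : swap_on U (swap_on U s t) (swap_on U t s) = s.
Proof. by apply/ffunP => v; rewrite !ffunE; case: (v \in U). Qed.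

(** Conditional independence of U and W given the rest, stated without
    quotients: two configurations that agree off U and W can trade their spins
    on W. *)
Definition exchangeable U W := forall s t, eqon (~: (U :|: W)) s t ->
  mu s * mu t = mu (swap_on W s t) * mu (swap_on W t s).

Section Exchange.
Variables U W : {set V}.
Hypothesis UW : [disjoint U & W].
Hypothesis exUW : exchangeable U W.
Local Notation Z := (~: (U :|: W)).

(** Both sides are sums over pairs of configurations, and trading the spins on
    W is an involution of these pairs that turns one sum into the other. *)
Lemma cexp_indep_prod f g s : depends_on (~: W) f -> depends_on (~: U) g ->
  0 < mu s ->
  cexp mu Z (fun t => f t * g t) s = cexp mu Z f s * cexp mu Z g s.
Proof.
move=> fW gU ms; have m0 : mass mu Z s != 0 by rewrite gt_eqF// mass_gt0.
rewrite /cexp; apply: (mulIf m0); rewrite divfK//.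
rewrite -[RHS]mulrA divfK//; apply: (mulIf m0).
rewrite [RHS]mulrAC divfK// {1}/mass.
rewrite mulr_suml; under eq_bigr do rewrite mulr_sumr.
rewrite [RHS]mulr_suml; under [RHS]eq_bigr do rewrite mulr_sumr.
rewrite !pair_big/=.
pose h (p : config * config) := (swap_on W p.1 p.2, swap_on W p.2 p.1).
have hK : involutive h by case=> x y; rewrite /h/= !swap_onK.
rewrite [RHS](reindex_inj (inv_inj hK))/=.
apply: eq_big => [[x y]|[x y]]/=; last first.
  case/andP => sx sy; have xy : eqon Z x y by rewrite -(eqon_congr _ sx).
  have -> : f (swap_on W x y) = f x.
    by apply: fW; apply/eqonP => v; rewrite inE => /negbTE vW; rewrite ffunE vW.
  have -> : g (swap_on W y x) = g x.
    apply: gU; apply/eqonP => v; rewrite inE => /negbTE vU; rewrite ffunE.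
    by case: ifP => // vW; apply/esym/(eqonP _ _ _ xy); rewrite !inE vU vW.
  transitivity ((mu x * mu y) * (f x * g x)); first by ring.
  by rewrite (exUW xy); ring.
have key a c : eqon Z s a -> eqon Z s c -> eqon Z s (swap_on W a c).
  move=> /eqonP H1 /eqonP H2; apply/eqonP => v vZ; rewrite ffunE.
  by case: ifP => _; [apply: H2|apply: H1].
apply/andP/andP => [[] H1 H2|[] /= H1 H2]; first by split; apply: key.
split; first by rewrite -(swap_onK W x y); apply: key.
by rewrite -(swap_onK W y x); apply: key.
Qed.

(** In ent_submod_ge the error term vanishes: f_A and f_B are conditionally
    uncorrelated given Z. *)
Lemma gap_supermod f T : (forall s, 0 <= f s) -> T \subset W ->
  gap f T + gap f (U :|: W) <= gap f W + gap f (T :|: U).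
Proof.
move=> f0 TW; have TU : [disjoint T & U].
  by rewrite disjoint_sym (disjointWr TW).
have sub1 : Z \subset ~: W by rewrite setCS subsetUr.
have sub2 : Z \subset ~: (T :|: U) by rewrite setCS [T :|: U]setUC setUS.
have := ent_submod_ge f0 sub1 sub2.
have -> : ~: W :|: ~: (T :|: U) = ~: T.
  rewrite -setCI; congr (~: _); rewrite setIUr (setIidPr TW) setIC.
  by rewrite (disjoint_setI0 UW) setU0.
set a := \sum_s _; set c := \sum_s _.
suff -> : c = a by rewrite /gap; lra.
rewrite /a /c.
have dep : depends_on Z (fun s => (cexp mu Z f s)^-1).
  by move=> s t st; rewrite (cexp_depends mu f st).
pose p s := cexp mu (~: W) f s * cexp mu (~: (T :|: U)) f s.
rewrite (eq_bigr (fun s => mu s * ((cexp mu Z f s)^-1 * p s))); last first.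
  by move=> s _; rewrite /p [_^-1 * _]mulrC.
rewrite -(sum_cexp mu_ge0 _ dep); apply: eq_sum_mu => s ms.
rewrite /p cexp_indep_prod//; last 2 first.
- exact: cexp_depends.
- apply: (sub_depends _ (@cexp_depends _ _ _ mu (~: (T :|: U)) f)).
  by rewrite setCS subsetUr.
rewrite !cexp_cexp//.
have [->|z0] := eqVneq (cexp mu Z f s) 0; first by rewrite !mulr0.
by rewrite mulKf.
Qed.

(** Given Z, the spins on U do not depend on those on W: apply the product
    rule to the indicator of the spins of s on W. *)
Lemma cexp_indep f s : 0 < mu s ->
  cexp mu (~: U) (cexp mu (~: W) f) s = cexp mu Z f s.
Proof.
move=> ms; have sub1 : Z \subset ~: W by rewrite setCS subsetUr.
rewrite -[RHS](cexp_cexp mu_ge0 f s sub1).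
have gW := @cexp_depends _ _ _ mu (~: W) f.
set g := cexp mu (~: W) f in gW *.
pose i t := (eqon W s t)%:R : R.
have iU : depends_on (~: U) i.
  move=> t t' tt; rewrite /i; congr (_%:R); rewrite ![eqon W s _]eqon_sym.
  congr nat_of_bool.
  apply: eqon_congr; apply: sub_eqon tt; rewrite -disjoints_subset disjoint_sym//.
have key h : \sum_(t | eqon Z s t) mu t * (h t * i t)
    = \sum_(t | eqon (~: U) s t) mu t * h t.
  rewrite [LHS]big_mkcond [RHS]big_mkcond; apply: eq_bigr => t _.
  have -> : ~: U = Z :|: W.
    apply/setP => v; rewrite !inE negb_or.
    case: (boolP (v \in W)) => vW; rewrite ?orbT ?orbF ?andbT//.
    by rewrite (disjointFl UW vW).
  rewrite eqonU /i; case: (eqon Z s t) => //=.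
  by case: (eqon W s t); rewrite ?mulr1 ?mulr0.
have := cexp_indep_prod gW iU ms.
rewrite {1 3}/cexp key.
have := key (fun=> 1).
under eq_bigr do rewrite mul1r; under [RHS]eq_bigr do rewrite mulr1.
rewrite -/(mass mu (~: U) s) => ->.
have m0 : mass mu Z s != 0 by rewrite gt_eqF// mass_gt0.
have m1 : mass mu (~: U) s != 0 by rewrite gt_eqF// mass_gt0.
move=> H; rewrite {1}/cexp; apply: (mulIf m1); rewrite divfK//.
by apply: (mulIf (invr_neq0 m0)); rewrite H mulrA.
Qed.

End Exchange.

(** Resampling W first and X afterwards resamples their union. This chain rule
    is what allows the components of a random set to be treated one after
    another, each with a new density. *)
Lemma gap_cexp f X W : [disjoint X & W] -> exchangeable X W ->
  gap (cexp mu (~: W) f) X = gap f (X :|: W) - gap f W.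
Proof.
move=> XW ex; rewrite /gap.
have -> : ent (cexp mu (~: W) f) [set: V] = ent f (~: W).
  by apply: eq_sum_mu => s ms; rewrite cexpT.
have -> : ent (cexp mu (~: W) f) (~: X) = ent f (~: (X :|: W)).
  by apply: eq_sum_mu => s ms; rewrite cexp_indep.
lra.
Qed.

End EntropySetFunction.

(** * The local entropy inequality *)

Section LocalInequality.
Import fintype boot.finset.
Variables (R : realType) (V Q : finType).
Notation config := {ffun V -> Q}.
Variable mu : config -> R.
Hypothesis mu_ge0 : forall s, 0 <= mu s.
Implicit Types (A B C S T U W Z X L : {set V}) (s t : config).

(** Spectral independence as it is used: under every pinning, a sum of centred
    one-site functions has off-diagonal covariances at most eta times its
    diagonal. *)
Definition covariance_bound (eta : R) := forall L s0, 0 < mu s0 ->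
  forall x : V -> Q -> R,
    (forall u, u \notin L -> \sum_(s | eqon L s0 s) mu s * x u (s u) = 0) ->
    \sum_(u in ~: L) \sum_(v in ~: L :\ u)
      \sum_(s | eqon L s0 s) mu s * (x u (s u) * x v (s v))
    <= eta * \sum_(u in ~: L) \sum_(s | eqon L s0 s) mu s * x u (s u) ^+ 2.

Definition marginal_bound (b : R) := forall s, 0 < mu s -> forall L v,
  v \notin L -> b * mass mu L s <= mass mu (v |: L) s.

Definition update s u a : config := [ffun w => if w == u then a else s w].

Variables (eta b : R) (f : config -> R).
Hypotheses (eta_ge0 : 0 <= eta) (b_gt0 : 0 < b) (b_le1 : b <= 1).
Hypothesis cov : covariance_bound eta.
Hypothesis marg : marginal_bound b.
Hypothesis f_ge0 : forall s, 0 <= f s.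

Lemma cexp_covariance L s : 0 < mu s ->
  cexp mu L (fun t => \sum_(u in ~: L) \sum_(v in ~: L :\ u)
     (cexp mu (u |: L) f t - cexp mu L f t) *
     (cexp mu (v |: L) f t - cexp mu L f t)) s
  <= eta * cexp mu L (fun t => \sum_(u in ~: L)
       (cexp mu (u |: L) f t - cexp mu L f t) ^+ 2) s.
Proof.
move=> ms; pose x u a := cexp mu (u |: L) f (update s u a) - cexp mu L f s.
have xE u t : u \notin L -> eqon L s t ->
    cexp mu (u |: L) f t - cexp mu L f t = x u (t u).
  move=> uL st; rewrite /x (cexp_depends mu f st); congr (_ - _).
  apply: cexp_depends; rewrite eqonU; apply/andP; split.
    by apply/eqonP => v; rewrite inE ffunE => /eqP ->; rewrite eqxx.
  apply/eqonP => v vL; rewrite ffunE; case: eqP => [vu|_].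
    by rewrite -vu vL in uL.
  by rewrite (eqonP _ _ _ st).
have x0 u : u \notin L -> \sum_(t | eqon L s t) mu t * x u (t u) = 0.
  move=> uL; rewrite (eq_bigr (fun t => mu t * cexp mu (u |: L) f t - mu t * cexp mu L f t)).
    by rewrite sumrB -!mass_cexp// !cexp_cexp// ?subrr// subsetUr.
  by move=> t st; rewrite -xE// mulrBr.
rewrite /cexp mulrA ler_wpM2r ?invr_ge0 ?mass_ge0//.
have := cov ms x0; rewrite -/(cexp _ _ _).
congr (_ <= eta * _).
  under eq_bigr do rewrite exchange_big/=.
  rewrite exchange_big/=; apply: eq_bigr => t st.
  rewrite mulr_sumr; apply: eq_bigr => u; rewrite inE => uL.
  rewrite mulr_sumr; apply: eq_bigr => v; rewrite !inE => /andP[_ vL].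
  by rewrite -!xE.
rewrite exchange_big/=; apply: eq_bigr => t st.
rewrite mulr_sumr; apply: eq_bigr => u; rewrite inE => uL.
by rewrite -xE.
Qed.

(** Sum ent_submod_ge over the ordered pairs of sites outside L. The errors
    are conditional covariances of the functions f_(L + u) - f_L, divided by
    f_L; they are bounded by eta times the diagonal, which xlnx_quadratic
    turns back into entropy, as f_(L + u) <= f_L / b by the marginal bound. *)
Lemma ent_local L :
  - (2 * eta / b) * \sum_(u in ~: L) (ent mu f (u |: L) - ent mu f L) <=
  \sum_(u in ~: L) \sum_(v in ~: L :\ u)
    (ent mu f (u |: (v |: L)) - ent mu f (u |: L) - ent mu f (v |: L) + ent mu f L).
Proof.
pose d u t := cexp mu (u |: L) f t - cexp mu L f t.
have subL u : L \subset u |: L by apply: subsetUr.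
have e0 L' s : 0 <= cexp mu L' f s := cexp_ge0 mu_ge0 L' s f_ge0.
have depV : depends_on L (fun s => (cexp mu L f s)^-1).
  by move=> s t st; rewrite (cexp_depends mu f st).
have meanK : \sum_s mu s * ((cexp mu L f s)^-1 * (cexp mu L f s ^+ 2)) =
    \sum_s mu s * cexp mu L f s.
  apply: eq_bigr => s _; have [->|n0] := eqVneq (cexp mu L f s) 0.
    by rewrite expr0n/= !mulr0.
  by rewrite expr2 mulKf.
have meanM u : \sum_s mu s * ((cexp mu L f s)^-1 * (cexp mu (u |: L) f s * cexp mu L f s)) =
    \sum_s mu s * cexp mu L f s.
  rewrite -meanK -(sum_cexp mu_ge0 (fun s => cexp mu (u |: L) f s * cexp mu L f s) depV).
  apply: eq_bigr => s _; congr (_ * (_ * _)).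
  rewrite (@eq_cexp _ _ _ _ mu_ge0 L _ (fun t => cexp mu L f t * cexp mu (u |: L) f t)).
    rewrite cexp_pull; last exact: cexp_depends.
    by rewrite cexp_cexp.
  by move=> t _; rewrite mulrC.
have pair u v : - \sum_s mu s * ((cexp mu L f s)^-1 * (d u s * d v s)) <=
    ent mu f (u |: (v |: L)) - ent mu f (u |: L) - ent mu f (v |: L) + ent mu f L.
  have := ent_submod_ge mu_ge0 f_ge0 (subL u) (subL v).
  have -> : (u |: L) :|: (v |: L) = u |: (v |: L).
    by rewrite setUACA setUid -setUA.
  apply: le_trans; rewrite /d.
  rewrite (eq_bigr (fun s => mu s * ((cexp mu L f s)^-1 * (cexp mu (u |: L) f s * cexp mu
    (v |: L) f s))
    - mu s * ((cexp mu L f s)^-1 * (cexp mu (u |: L) f s * cexp mu L f s))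
    - mu s * ((cexp mu L f s)^-1 * (cexp mu (v |: L) f s * cexp mu L f s))
    + mu s * ((cexp mu L f s)^-1 * (cexp mu L f s ^+ 2)))); last by move=> s _; ring.
  rewrite big_split/= !sumrB !meanM meanK.
  rewrite [X in _ <= _ - X](eq_bigr (fun s => mu s * ((cexp mu L f s)^-1 * (cexp mu (u |:
    L) f s * cexp mu (v |: L) f s)))); last by move=> s _; ring.
  lra.
apply: (@le_trans _ _ (- \sum_(u in ~: L) \sum_(v in ~: L :\ u)
    \sum_s mu s * ((cexp mu L f s)^-1 * (d u s * d v s)))); last first.
  rewrite -sumrN; apply: ler_sum => u _; rewrite -sumrN.
  by apply: ler_sum => v _; apply: pair.
rewrite mulNr lerN2.
have -> : \sum_(u in ~: L) \sum_(v in ~: L :\ u) \sum_s mu s * ((cexp mu L f s)^-1 * (d u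
  s * d v s))
   = \sum_s mu s * ((cexp mu L f s)^-1 * \sum_(u in ~: L) \sum_(v in ~: L :\ u) (d u s *
     d v s)).
  under eq_bigr do rewrite exchange_big/=.
  rewrite exchange_big/=; apply: eq_bigr => t st.
  rewrite !mulr_sumr; apply: eq_bigr => u _.
  by rewrite !mulr_sumr.
rewrite -(sum_cexp mu_ge0 _ depV).
apply: (@le_trans _ _ (eta * \sum_s mu s * ((cexp mu L f s)^-1 * \sum_(u in ~: L) d u s ^+ 2))).
  rewrite -(sum_cexp mu_ge0 (fun s => \sum_(u in ~: L) d u s ^+ 2) depV) mulr_sumr.
  rewrite [leRHS](eq_bigr (fun s => mu s * (eta * ((cexp mu L f s)^-1 * cexp mu L (fun t
    => \sum_(u in ~: L) d u t ^+ 2) s)))); last by move=> s _; ring.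
  apply: ler_sum_mu => // s ms.
  by rewrite [leRHS]mulrCA ler_wpM2l ?invr_ge0// cexp_covariance.
have -> : 2 * eta / b = eta * (2 / b) by ring.
rewrite -mulrA ler_wpM2l// -ler_pdivrMl ?divr_gt0// invf_div mulr_sumr.
have -> : \sum_s b / 2 * (mu s * ((cexp mu L f s)^-1 * \sum_(u in ~: L) d u s ^+ 2))
  = \sum_(u in ~: L) \sum_s mu s * (b / 2 * (d u s ^+ 2 / cexp mu L f s)).
  rewrite exchange_big/=; apply: eq_bigr => s _; rewrite !mulr_sumr.
  by apply: eq_bigr => u _; ring.
apply: ler_sum => u; rewrite inE => uL.
rewrite (ent_sub mu_ge0 f (subL u)) (ent_sub mu_ge0 f (subxx (u |: L))).
apply: (@le_trans _ _ (\sum_s mu s * (cexp mu (u |: L) f s * ln (cexp mu (u |: L) f s)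
   - cexp mu (u |: L) f s * ln (cexp mu L f s) - cexp mu (u |: L) f s + cexp mu L f s))).
  apply: ler_sum_mu => // s ms; rewrite /d.
  have [z0|z0] := eqVneq (cexp mu L f s) 0.
    by rewrite (cexp_eq0_sub mu_ge0 f_ge0 (subL u) ms z0) z0; lra.
  apply: xlnx_quadratic => //; first by rewrite lt0r z0 e0.
  have m0 := mass_gt0 mu_ge0 L ms.
  rewrite -(ler_pM2l m0); apply: le_trans (cexp_le_sub mu_ge0 s f_ge0 (subL u)).
  by rewrite mulrA ler_wpM2r// mulrC marg.
under eq_bigr do rewrite mulrDr !mulrBr.
rewrite big_split/= !sumrB !sum_cexp1//; lra.
Qed.

Lemma gap_local S :
  \sum_(u in S) \sum_(v in S :\ u)
    (gap mu f S + gap mu f (S :\ u :\ v) - gap mu f (S :\ u) - gap mu f (S :\ v))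
  <= 2 * eta / b * \sum_(u in S) (gap mu f S - gap mu f (S :\ u)).
Proof.
have := ent_local (~: S); rewrite setCK.
have setC1 (T : {set V}) u : ~: (T :\ u) = u |: ~: T by rewrite setDE setCI setCK setUC.
have -> : \sum_(u in S) (ent mu f (u |: ~: S) - ent mu f (~: S)) = \sum_(u in S) (gap mu
  f S - gap mu f (S :\ u)).
  by apply: eq_bigr => u _; rewrite /gap setC1; ring.
have -> : \sum_(u in S) \sum_(v in S :\ u)
    (ent mu f (u |: (v |: ~: S)) - ent mu f (u |: ~: S) - ent mu f (v |: ~: S) + ent mu f
      (~: S))
  = - \sum_(u in S) \sum_(v in S :\ u)
    (gap mu f S + gap mu f (S :\ u :\ v) - gap mu f (S :\ u) - gap mu f (S :\ v)).
  rewrite -[RHS]sumrN; apply: eq_bigr => u _; rewrite -[RHS]sumrN; apply: eq_bigr => v _.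
  by rewrite /gap !setC1 setUCA; ring.
by rewrite mulNr lerN2.
Qed.

End LocalInequality.

(** * A crude factorization from connectivity *)

Section CrudeFactorization.
Import fintype boot.finset.

(** A path without repetition inside A has at most as many steps as A has
    elements. *)
Lemma connect_lipschitz (R : realDomainType) (T : finType) (e : rel T)
    (A : {set T}) (F : T -> R) (K : R) x y :
  0 <= K -> (forall z w, z \in A -> e z w -> w \in A) ->
  (forall z w, z \in A -> e z w -> `|F z - F w| <= K) ->
  x \in A -> connect e x y -> `|F x - F y| <= K *+ #|A|.
Proof.
move=> K0 eA eF xA /connectP[p0 + ->]; case/shortenP => p ep up _.
have sub : {subset x :: p <= A}.
  elim: p x xA ep {up} => [|w p IH] x xA /=; first by move=> _ z /[!inE] /eqP ->.
  case/andP => exw ep z; rewrite inE => /predU1P[->//|].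
  exact: (IH w (eA _ _ xA exw) ep).
have le : (size p <= #|A|)%N.
  apply: (leq_trans (leqnSn _)); rewrite -[(size p).+1]/(size (x :: p)).
  rewrite -(card_uniqP up); apply: subset_leq_card; apply/subsetP => z; exact: sub.
apply: (@le_trans _ _ (K *+ size p)); last exact: ler_wpMn2l.
elim: p x xA ep {up sub le} => /= [|w p IH] x xA; first by rewrite subrr normr0 mulr0n.
case/andP => exw /(IH _ (eA _ _ xA exw)) H; rewrite mulrS.
apply: le_trans (lerD (eF _ _ xA exw) H).
by have := ler_normD (F x - F w) (F w - F (last w p)); rewrite subrKA.
Qed.

Variables (R : realType) (V Q : finType).
Notation config := {ffun V -> Q}.
Variable mu : config -> R.
Hypothesis mu_ge0 : forall s, 0 <= mu s.
Implicit Types (A B C S T U W Z X L : {set V}) (s t : config).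

Definition flip_rel S : rel config :=
  [rel s t | [&& 0 < mu s, 0 < mu t, eqon (~: S) s t &
                 #|[set v | s v != t v]| == 1%N]].

Definition flip_connected := forall S s t, 0 < mu s -> 0 < mu t ->
  eqon (~: S) s t -> connect (flip_rel S) s t.

(** Used for a single site in gap_crude, and for all sites to pass from
    entropy to total variation distance. *)
Lemma gap_ge_hellinger f S : (forall s, 0 <= f s) ->
  \sum_s mu s * (Num.sqrt (f s) - Num.sqrt (cexp mu (~: S) f s)) ^+ 2 <= gap mu f S.
Proof.
move=> f0; rewrite /gap (ent_sub mu_ge0 f (subsetT (~: S))) /ent -sumrB.
have e0 s : 0 <= cexp mu (~: S) f s by apply: cexp_ge0.
rewrite (eq_bigr (fun s => mu s * (2 * (f s - Num.sqrt (f s) * Num.sqrt (cexp mu (~: S) f s)))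
   + (mu s * cexp mu (~: S) f s - mu s * f s))); last first.
  move=> s _; rewrite sqrrB !sqr_sqrtr// mulr2n; ring.
rewrite big_split/= sumrB sum_cexp1// subrr addr0.
rewrite [leRHS](eq_bigr (fun s => mu s * (cexp mu [set: V] f s * ln (cexp mu [set: V] f
  s) - cexp mu [set: V] f s * ln (cexp mu (~: S) f s)))); last by move=> s _; ring.
apply: ler_sum_mu => // s ms; rewrite cexpT//; apply: xlnx_hellinger => // e1.
by rewrite -(cexpT f ms); apply: (cexp_eq0_sub mu_ge0 f0 _ ms e1).
Qed.

Variable b : R.
Hypotheses (b_gt0 : 0 < b) (b_le1 : b <= 1).
Hypothesis marg : marginal_bound mu b.

Lemma mass_ge_pow S s : 0 < mu s -> b ^+ #|S| * mass mu (~: S) s <= mu s.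
Proof.
move=> ms; move en : #|S| => n; elim: n S en => [|n IH] S cS.
  move/eqP: cS; rewrite cards_eq0 => /eqP ->; rewrite setC0 expr0 mul1r.
  rewrite /mass (eq_bigl (pred1 s)) ?big_pred1_eq// => t.
  by rewrite eqonT eq_sym.
have [v vS] : exists v, v \in S by apply/card_gt0P; rewrite cS.
have cS' : #|S :\ v| = n by move: cS; rewrite (cardsD1 v S) vS add1n => -[].
apply: le_trans (IH _ cS').
have -> : ~: (S :\ v) = v |: ~: S by rewrite setDE setCI setCK setUC.
rewrite exprSr -mulrA; apply: ler_wpM2l; first by rewrite exprn_ge0// ltW.
by apply: marg => //; rewrite inE vS.
Qed.

(** Given the rest, every configuration on S in the support has conditional
    probability at least b^|S|. *)
Lemma point_le_cexp f S s : (forall t, 0 <= f t) -> 0 < mu s ->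
  f s <= b ^- #|S| * cexp mu (~: S) f s.
Proof.
move=> f0 ms; have bm : 0 < b ^+ #|S| by rewrite exprn_gt0.
rewrite ler_pdivlMl// -(ler_pM2l ms).
have m0 := mass_gt0 mu_ge0 (~: S) ms.
have := cexp_le_sub mu_ge0 s f0 (subsetT (~: S)); rewrite cexpT//.
have -> : mass mu [set: V] s = mu s.
  rewrite /mass (eq_bigl (pred1 s)) ?big_pred1_eq// => t.
  by rewrite eqonT eq_sym.
move=> H; rewrite mulrCA; apply: (@le_trans _ _ (b ^+ #|S| * (mass mu (~: S) s * cexp mu
  (~: S) f s))).
  by rewrite ler_pM2l.
by rewrite mulrA ler_wpM2r ?cexp_ge0 ?mass_ge_pow.
Qed.

Hypothesis conn : flip_connected.
Variable f : config -> R.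
Hypothesis f_ge0 : forall s, 0 <= f s.

Lemma card_class_le S s : 0 < mu s ->
  (#|[set t | (0 < mu t) && eqon (~: S) s t]|)%:R <= b ^- #|S|.
Proof.
move=> ms; have m0 := mass_gt0 mu_ge0 (~: S) ms.
have bm : 0 < b ^+ #|S| by rewrite exprn_gt0.
rewrite -[leRHS]mul1r ler_pdivlMr// -(ler_pM2r m0) mul1r -mulrA mulr_natl.
rewrite -sumr_const [leRHS]/mass [leRHS]big_mkcond [leLHS]big_mkcond/=.
apply: ler_sum => t _; rewrite inE; case: (eqon (~: S) s t) / boolP => st;
  rewrite ?andbT ?andbF//.
case: ifP => // mt; rewrite (mass_depends mu st); exact: mass_ge_pow.
Qed.

(** Any two configurations of S are joined by a path of one-site flips with at
    most b^(-|S|) steps. A flip at v changes the square root of f by at most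
    the deviations of its two ends from the mean over v, and each of these is
    at most q / b^|S| when squared, where q is the sum of the mean squared
    deviations on the right. *)
Lemma sqrt_deviation S s : 0 < mu s ->
  (Num.sqrt (f s) - Num.sqrt (cexp mu (~: S) f s)) ^+ 2 <=
  4 * (b ^- #|S|) ^+ 3 * cexp mu (~: S) (fun t => \sum_(v in S)
     (Num.sqrt (f t) - Num.sqrt (cexp mu (~: [set v]) f t)) ^+ 2) s.
Proof.
move=> ms; set q := fun t => \sum_(v in S) _.
have q0 t : 0 <= q t by apply: sumr_ge0 => v _; apply: sqr_ge0.
set N := b ^- #|S|; have N0 : 0 <= N by rewrite invr_ge0 exprn_ge0 ?ltW.
set c := cexp mu (~: S) q s; have c0 : 0 <= c by apply: cexp_ge0.
pose K := 2 * Num.sqrt (N * c).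
have K0 : 0 <= K by rewrite mulr_ge0// sqrtr_ge0.
pose A := [set t | (0 < mu t) && eqon (~: S) s t].
have step z w : z \in A -> flip_rel S z w -> `|Num.sqrt (f z) - Num.sqrt (f w)| <= K.
  rewrite inE => /andP[mz sz] /and4P[_ mw zw /cards1P[v vE]].
  have sw : eqon (~: S) s w by rewrite (eqon_congr _ sz).
  have zwv : eqon (~: [set v]) z w.
    by apply/eqonP => u; rewrite -vE !inE negbK => /eqP.
  have vS : v \in S.
    apply: contraT => vS; have := set11 v; rewrite -vE inE.
    by rewrite (eqonP _ _ _ zw) ?inE// eqxx.
  have qle t : 0 < mu t -> eqon (~: S) s t ->
      (Num.sqrt (f t) - Num.sqrt (cexp mu (~: [set v]) f t)) ^+ 2 <= N * c.
    move=> mt st; rewrite /c (cexp_depends mu q st).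
    apply: le_trans (point_le_cexp S q0 mt).
    rewrite /q (bigD1 v)//= lerDl; apply: sumr_ge0 => u _; exact: sqr_ge0.
  have := qle _ mz sz; have := qle _ mw sw.
  rewrite -(cexp_depends mu f zwv); set k := Num.sqrt (cexp _ _ _ _).
  have sqle (x : R) : x ^+ 2 <= N * c -> `|x| <= Num.sqrt (N * c).
    by move=> H; rewrite -sqrtr_sqr ler_wsqrtr.
  move=> /sqle H1 /sqle H2.
  have := ler_normB (Num.sqrt (f z) - k) (Num.sqrt (f w) - k).
  by rewrite opprB addrA subrK /K => H3; lra.
have lip t : 0 < mu t -> eqon (~: S) s t ->
    (Num.sqrt (f s) - Num.sqrt (f t)) ^+ 2 <= 4 * N ^+ 3 * c.
  move=> mt st.
  have sA : s \in A by rewrite inE ms eqon_refl.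
  have := connect_lipschitz K0 _ step sA (conn ms mt st).
  have AA z w : z \in A -> flip_rel S z w -> w \in A.
    rewrite !inE => /andP[mz sz] /and4P[_ mw zw _].
    by rewrite mw (eqon_congr _ sz).
  move=> /(_ AA) H; rewrite -real_normK ?num_real//.
  have H2 : `|Num.sqrt (f s) - Num.sqrt (f t)| <= K * N.
    by apply: le_trans H _; rewrite -mulr_natr ler_wpM2l// card_class_le.
  apply: (@le_trans _ _ ((K * N) ^+ 2)).
    by rewrite lerXn2r// nnegrE mulr_ge0.
  rewrite /K !exprMn sqr_sqrtr; last exact: mulr_ge0 N0 c0.
  rewrite le_eqVlt; apply/orP; left; apply/eqP; ring.
have [k0|k0] := eqVneq (cexp mu (~: S) f s) 0.
  have -> : f s = 0.
    by rewrite -(cexpT f ms); apply: (cexp_eq0_sub mu_ge0 f_ge0 (subsetT _) ms k0).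
  by rewrite k0 subrr expr0n/= mulr_ge0// mulr_ge0// exprn_ge0.
set k := Num.sqrt (cexp mu (~: S) f s).
have kp : 0 < k by rewrite sqrtr_gt0 lt0r k0 cexp_ge0.
have k2 : k ^+ 2 = cexp mu (~: S) f s by rewrite sqr_sqrtr// cexp_ge0.
have m0 := mass_gt0 mu_ge0 (~: S) ms.
set x := Num.sqrt (f s); have x0 : 0 <= x by apply: sqrtr_ge0.
rewrite -(ler_pM2l m0).
apply: (@le_trans _ _ (\sum_(t | eqon (~: S) s t) mu t * (x - Num.sqrt (f t)) ^+ 2));
  last first.
  rewrite [leRHS]mulrC /mass mulr_sumr; apply: ler_sum => t st.
  have := mu_ge0 t; rewrite le_eqVlt => /predU1P[<-|mt]; first by rewrite mul0r mulr0.
  rewrite [leRHS]mulrC ler_pM2l//; exact: lip.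
set G := \sum_(t | eqon (~: S) s t) mu t * Num.sqrt (f t).
have E2 : \sum_(t | eqon (~: S) s t) mu t * f t = mass mu (~: S) s * k ^+ 2.
  by rewrite k2 mass_cexp.
have expand (y : R) : \sum_(t | eqon (~: S) s t) mu t * (y - Num.sqrt (f t)) ^+ 2
    = mass mu (~: S) s * (y ^+ 2 + k ^+ 2) - 2 * y * G.
  rewrite (eq_bigr (fun t => mu t * y ^+ 2 - 2 * y * (mu t * Num.sqrt (f t)) + mu t * f t)).
    by rewrite big_split/= sumrB E2 -mulr_suml -mulr_sumr -/(mass mu (~: S) s) -/G; ring.
  by move=> t _; rewrite sqrrB sqr_sqrtr// mulr2n; ring.
have Gk : G <= mass mu (~: S) s * k.
  have : 0 <= \sum_(t | eqon (~: S) s t) mu t * (k - Num.sqrt (f t)) ^+ 2.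
    by apply: sumr_ge0 => t _; rewrite mulr_ge0// sqr_ge0.
  rewrite expand => H; rewrite -(ler_pM2l kp).
  by move: H; rewrite expr2; lra.
rewrite expand.
have : 2 * x * G <= 2 * x * (mass mu (~: S) s * k) by rewrite ler_wpM2l// mulr_ge0.
rewrite sqrrB mulr2n; lra.
Qed.

(** The chi-square bound with (f - e)^2 = (sqrt f - sqrt e)^2 (sqrt f + sqrt
    e)^2, whose last factor is at most 4 e / b^|S|. *)
Lemma gap_le_sqrt S :
  gap mu f S <= 4 * b ^- #|S| *
    \sum_s mu s * (Num.sqrt (f s) - Num.sqrt (cexp mu (~: S) f s)) ^+ 2.
Proof.
rewrite /gap (ent_sub mu_ge0 f (subsetT (~: S))) /ent -sumrB.
have e0 s : 0 <= cexp mu (~: S) f s by apply: cexp_ge0.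
have N1 : 1 <= b ^- #|S| by rewrite invf_ge1 ?exprn_gt0// exprn_ile1// ltW.
set N := b ^- #|S| in N1 *.
rewrite (eq_bigr (fun s => mu s * (cexp mu [set: V] f s * ln (cexp mu [set: V] f s)
    - cexp mu [set: V] f s * ln (cexp mu (~: S) f s) - cexp mu [set: V] f s
    + cexp mu (~: S) f s)
   + (mu s * cexp mu [set: V] f s - mu s * cexp mu (~: S) f s))); last by move=> s _; ring.
rewrite big_split/= sumrB !sum_cexp1// subrr addr0 mulr_sumr.
rewrite [leRHS](eq_bigr (fun s => mu s * (4 * N *
  (Num.sqrt (f s) - Num.sqrt (cexp mu (~: S) f s)) ^+ 2))); last by move=> s _; ring.
apply: ler_sum_mu => // s ms; rewrite cexpT//.
have [k0|k0] := eqVneq (cexp mu (~: S) f s) 0.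
  have -> : f s = 0.
    by rewrite -(cexpT f ms); apply: (cexp_eq0_sub mu_ge0 f_ge0 (subsetT _) ms k0).
  by rewrite k0 !subrr add0r expr0n/= mulr0.
have ep : 0 < cexp mu (~: S) f s by rewrite lt0r k0 e0.
apply: le_trans (xlnx_chi2 (f_ge0 s) ep) _.
have := point_le_cexp S f_ge0 ms; rewrite -/N => fe.
have gE : f s = Num.sqrt (f s) ^+ 2 by rewrite sqr_sqrtr.
have kE : cexp mu (~: S) f s = Num.sqrt (cexp mu (~: S) f s) ^+ 2 by rewrite sqr_sqrtr.
rewrite ler_pdivrMr//.
have -> : (f s - cexp mu (~: S) f s) ^+ 2 =
   (Num.sqrt (f s) - Num.sqrt (cexp mu (~: S) f s)) ^+ 2 *
   (Num.sqrt (f s) + Num.sqrt (cexp mu (~: S) f s)) ^+ 2.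
  by rewrite -exprMn -subr_sqr !sqr_sqrtr.
rewrite [leRHS]mulrAC [leLHS]mulrC; apply: ler_wpM2r; first exact: sqr_ge0.
have := sqr_ge0 (Num.sqrt (f s) - Num.sqrt (cexp mu (~: S) f s)).
rewrite sqrrB sqrrD !sqr_sqrtr// !mulr2n.
have : cexp mu (~: S) f s <= N * cexp mu (~: S) f s by rewrite ler_peMl.
rewrite -mulrA; lra.
Qed.

(** The comparison is made for squared deviations of the square root of f, for
    which path arguments work, and the two preceding inequalities translate it
    into entropies. *)
Lemma gap_crude S :
  gap mu f S <= 16 * (b ^- #|S|) ^+ 4 * \sum_(v in S) gap mu f [set v].
Proof.
apply: le_trans (gap_le_sqrt S) _.
set N := b ^- #|S|; have N0 : 0 <= N by rewrite invr_ge0 exprn_ge0 ?ltW.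
apply: (@le_trans _ _ (4 * N * (4 * N ^+ 3 * \sum_(v in S) gap mu f [set v]))); last first.
  by rewrite le_eqVlt; apply/orP; left; apply/eqP; ring.
apply: ler_wpM2l; first by rewrite mulr_ge0.
apply: (@le_trans _ _ (4 * N ^+ 3 * \sum_s mu s * \sum_(v in S)
     (Num.sqrt (f s) - Num.sqrt (cexp mu (~: [set v]) f s)) ^+ 2)).
  rewrite -(sum_cexp1 mu_ge0 (~: S) (fun s => \sum_(v in S)
     (Num.sqrt (f s) - Num.sqrt (cexp mu (~: [set v]) f s)) ^+ 2)) mulr_sumr.
  rewrite [leRHS](eq_bigr (fun s => mu s * (4 * N ^+ 3 * cexp mu (~: S) (fun t => \sum_(v in S)
     (Num.sqrt (f t) - Num.sqrt (cexp mu (~: [set v]) f t)) ^+ 2) s))); last first.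
    by move=> s _; ring.
  by apply: ler_sum_mu => // s ms; apply: sqrt_deviation.
apply: ler_wpM2l; first by rewrite mulr_ge0// exprn_ge0.
under eq_bigr do rewrite mulr_sumr.
rewrite exchange_big/=; apply: ler_sum => v _; exact: gap_ge_hellinger.
Qed.

End CrudeFactorization.

(** * From the local inequality to uniform blocks *)

Section DownwardInduction.
Import fintype boot.finset.
Variables (R : realFieldType) (V : finType) (D : {set V} -> R) (c : R) (r : nat).
Implicit Types S T : {set V}.
Hypothesis D_ge0 : forall S, 0 <= D S.
Hypothesis D_mono : forall S T, S \subset T -> D S <= D T.
Hypothesis D_local : forall S,
  \sum_(u in S) \sum_(v in S :\ u)
    (D S + D (S :\ u :\ v) - D (S :\ u) - D (S :\ v))
  <= c * \sum_(u in S) (D S - D (S :\ u)).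
Hypothesis c_le : c <= r%:R.

(** With X = D S, Y = sum D (S - u) and Z = sum D (S - u - v), the induction
    hypothesis for the sets S - u reads (n - 1 - r) Y <= Z for |S| = n + 1,
    and inserting it in the local inequality leaves exactly (n - r) X <= Y. *)
Lemma sum_D1_ge S :
  (#|S|%:R - 1 - r%:R) * D S <= \sum_(u in S) D (S :\ u).
Proof.
move en : #|S| => n; elim: n S en => [|n IH] S cS.
  rewrite big1; last first.
    by move=> u uS; move: cS => /eqP; rewrite cards_eq0 => /eqP SE; rewrite SE inE in uS.
  by rewrite mulr_le0_ge0// sub0r -opprD oppr_le0 addr_ge0.
have cS1 u : u \in S -> #|S :\ u| = n.
  by move=> uS; move: cS; rewrite (cardsD1 u S) uS add1n => -[].
set Y := \sum_(u in S) D (S :\ u).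
set Z := \sum_(u in S) \sum_(v in S :\ u) D (S :\ u :\ v).
have ZY : (n%:R - 1 - r%:R) * Y <= Z.
  by rewrite mulr_sumr; apply: ler_sum => u uS; apply: IH; apply: cS1.
have sumc (x : R) : \sum_(u in S) x = n.+1%:R * x by rewrite sumr_const cS mulr_natl.
have sumc1 u (x : R) : u \in S -> \sum_(v in S :\ u) x = n%:R * x.
  by move=> uS; rewrite sumr_const cS1// mulr_natl.
have E1 : \sum_(u in S) \sum_(v in S :\ u) D S = n.+1%:R * (n%:R * D S).
  by rewrite -sumc; apply: eq_bigr => u uS; rewrite (sumc1 u).
have E2 : \sum_(u in S) \sum_(v in S :\ u) D (S :\ u) = n%:R * Y.
  by rewrite mulr_sumr; apply: eq_bigr => u uS; rewrite (sumc1 u).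
have E3 : \sum_(u in S) \sum_(v in S :\ u) D (S :\ v) = n%:R * Y.
  rewrite (exchange_big_dep (fun v => v \in S))/=; last by move=> u v _ /setD1P[].
  rewrite mulr_sumr; apply: eq_bigr => v vS; rewrite -(sumc1 v)//.
  by apply: eq_bigl => u; rewrite !inE vS andbT eq_sym andbC.
have := D_local S.
rewrite [leLHS](eq_bigr (fun u => \sum_(v in S :\ u) D S + \sum_(v in S :\ u) D (S :\ u :\ v)
   - \sum_(v in S :\ u) D (S :\ u) - \sum_(v in S :\ u) D (S :\ v))); last first.
  by move=> u _; rewrite -big_split/= -!sumrB.
rewrite !sumrB big_split/= E1 E2 E3 -/Z sumc -/Y => H.
have J0 : 0 <= n.+1%:R * D S - Y.
  rewrite -sumc -sumrB; apply: sumr_ge0 => u uS; rewrite subr_ge0.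
  by apply: D_mono; apply: subsetDl.
have H2 : c * (n.+1%:R * D S - Y) <= r%:R * (n.+1%:R * D S - Y) by rewrite ler_wpM2r.
have n0 : 0 < n.+1%:R :> R by rewrite ltr0n.
rewrite -(ler_pM2l n0); rewrite -natr1 in H H2 n0 *.
move: H H2 ZY; move: (D S) (n%:R : R) (r%:R : R) => X N r' H H2 ZY.
have : (N + 1) * (N * X) + (N - 1 - r') * Y - N * Y - N * Y <= r' * ((N + 1) * X - Y) by lra.
lra.
Qed.

Lemma sum_subsets_D1 (S : {set V}) l (F : {set V} -> R) :
  \sum_(u in S) \sum_(T : {set V} | (T \subset S :\ u) && (#|T| == l)) F T
  = (#|S| - l)%:R * \sum_(T : {set V} | (T \subset S) && (#|T| == l)) F T.
Proof.
rewrite (exchange_big_dep (fun T : {set V} => (T \subset S) && (#|T| == l)))/=; last first.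
  move=> u T uS /andP[TS ->]; rewrite andbT; apply: subset_trans TS _; apply: subsetDl.
rewrite mulr_sumr; apply: eq_bigr => T /andP[TS /eqP cT].
rewrite (eq_bigl (fun u => u \in S :\: T)).
  by rewrite sumr_const cardsD (setIidPr TS) cT mulr_natl.
by move=> u; rewrite subsetD1 TS cT eqxx/= andbT inE andbC.
Qed.

(** Iterate sum_D1_ge from S down to size l; the factors j / (j - 1 - r)
    telescope to a ratio of binomial coefficients. *)
Lemma uniform_block_factorization S l : (r < l)%N -> (l <= #|S|)%N ->
  ('C(l, r.+1) * 'C(#|S|, l))%:R * D S <=
  'C(#|S|, r.+1)%:R * \sum_(T : {set V} | (T \subset S) && (#|T| == l)) D T.
Proof.
move=> rl; move en : #|S| => n; elim: n S en => [|n IH] S cS.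
  by rewrite leqn0 => /eqP l0; rewrite l0 in rl.
rewrite leq_eqVlt => /predU1P[lE|ln].
  rewrite lE binn muln1 (bigD1 S) ?subxx ?cS ?eqxx//=.
  by rewrite ler_wpM2l// lerDl sumr_ge0.
rewrite ltnS in ln.
have rn : (r < n)%N by apply: leq_trans ln.
have := sum_D1_ge S; rewrite cS => H1.
have H2 : ('C(l, r.+1) * 'C(n, l))%:R * \sum_(u in S) D (S :\ u) <=
   'C(n, r.+1)%:R * ((n.+1 - l)%:R * \sum_(T : {set V} | (T \subset S) && (#|T| == l)) D T).
  have := sum_subsets_D1 S l D; rewrite cS => <-.
  rewrite !mulr_sumr; apply: ler_sum => u uS; apply: IH => //.
  by move: cS; rewrite (cardsD1 u S) uS add1n => -[].
have e1 : (n.+1%:R : R) * 'C(n, l)%:R = (n.+1 - l)%:R * 'C(n.+1, l)%:R.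
  by rewrite -!natrM mul_bin_down.
have e2 : (n.+1%:R : R) * 'C(n, r.+1)%:R = (n - r)%:R * 'C(n.+1, r.+1)%:R.
  by rewrite -!natrM mul_bin_down subSS.
have a0 : 0 < (n.+1 - l)%:R :> R by rewrite ltr0n subn_gt0 ltnS.
have b0 : 0 < (n - r)%:R :> R by rewrite ltr0n subn_gt0.
have nn0 : 0 < n.+1%:R :> R by rewrite ltr0n.
have H3 : (n - r)%:R * D S <= \sum_(u in S) D (S :\ u).
  by rewrite natrB ?(ltnW rn)//; apply: le_trans H1; rewrite -natr1 addrK.
move: H2 H3 e1 e2; rewrite !natrM.
set Y := \sum_(u in S) _; set Z := \sum_(T | _) _.
move: ('C(l, r.+1)%:R : R) (ler0n R 'C(l, r.+1)) => k k0.
move: ('C(n, l)%:R : R) (ler0n R 'C(n, l)) => p p0.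
move: ('C(n, r.+1)%:R : R) ('C(n.+1, r.+1)%:R : R) ('C(n.+1, l)%:R : R) => q q' p'.
move: ((n.+1 - l)%:R : R) ((n - r)%:R : R) (n.+1%:R : R) a0 b0 nn0 => a b m a0 b0 m0.
move=> H2 H3 e1 e2.
rewrite -(ler_pM2l (mulr_gt0 a0 b0)).
have -> : a * b * (k * p' * D S) = k * m * p * (b * D S).
  by transitivity (k * b * D S * (a * p')); [ring|rewrite -e1; ring].
have -> : a * b * (q' * Z) = m * (q * (a * Z)).
  by transitivity (a * Z * (b * q')); [ring|rewrite -e2; ring].
apply: (@le_trans _ _ (k * m * p * Y)).
  by rewrite ler_wpM2l// !mulr_ge0// ltW.
have -> : k * m * p * Y = m * (k * p * Y) by ring.
by rewrite ler_pM2l.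
Qed.

End DownwardInduction.

(** * Counting connected sets *)

Section LatticeAnimals.
Import fintype boot.finset.
Variables (V : finType) (e : rel V).
Implicit Types S T L X : {set V}.

Definition inner_edge T : rel V := [rel x y | [&& e x y, x \in T & y \in T]].

Lemma sub_inner_connect S T : S \subset T -> subrel (connect (inner_edge S)) (connect
  (inner_edge T)).
Proof.
move=> /subsetP ST; apply: connect_sub => x y /and3P[xy xS yS].
by apply: connect1; rewrite /inner_edge/= xy !ST.
Qed.

Lemma inner_connect_in T x y : x \in T -> connect (inner_edge T) x y -> y \in T.
Proof.
move=> xT /connectP[p + ->]; elim: p x xT => //= z p IH x xT /andP[/and3P[_ _ zT]].
exact: IH.
Qed.

(** The unexplored part T of a connected set, at a stage when X has been
    visited and the vertices of L are waiting. *)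
Definition anchored L X T := [disjoint T & X] &&
  [forall t in T, exists l in L :&: T, connect (inner_edge T) l t].

Lemma anchored_skip L X T v : v \notin T -> anchored L X T ->
  anchored (L :\ v) (v |: X) T.
Proof.
move=> vT /andP[TX /forall_inP aT]; apply/andP; split.
  by rewrite disjoints_subset setCU subsetI -!disjoints_subset TX andbT disjoint_sym disjoints1.
apply/forall_inP => t /aT/existsP[l /andP[]]; rewrite inE => /andP[lL lT] lt.
apply/existsP; exists l; rewrite !inE lL lT lt !andbT.
by apply: contraNneq vT => <-.
Qed.

Lemma anchored_take L X T v : v \in T -> anchored L X T ->
  anchored ((L :\ v :|: [set w | e v w]) :\: (v |: X)) (v |: X) (T :\ v).
Proof.
move=> vT /andP[TX /forall_inP aT]; apply/andP; split.
  rewrite disjoints_subset setCU subsetI; apply/andP; split.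
    by apply/subsetP => x; rewrite !inE => /andP[].
  by apply: subset_trans (subsetDl _ _) _; rewrite -disjoints_subset.
apply/forall_inP => t tTv; have /setD1P[tv tT] := tTv.
have /existsP[l /andP[/setIP[lL lT] /connectP[p]]] := aT _ tT.
suff claim : forall x, x \in T -> path (inner_edge T) x p -> t = last x p ->
    (x != v /\ connect (inner_edge (T :\ v)) x t) \/
    (exists y, [/\ e v y, y \in T :\ v & connect (inner_edge (T :\ v)) y t]).
  move=> pp tE; have nX x : x \in T -> x \notin X by move=> xT; rewrite (disjointFr TX xT).
  case: (claim l lT pp tE) => [[lv lt]|[y [vy yT yt]]].
    by apply/existsP; exists l; rewrite !inE (negbTE lv) lL lT lt (negbTE (nX _ lT)).
  apply/existsP; exists y; move: (yT); rewrite !inE => /andP[yv yT'].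
  by rewrite (negbTE yv) yT' vy yt orbT (negbTE (nX _ yT')).
elim: p {l lL lT} => [|z p IH] x xT /=.
  by move=> _ <-; left; split.
case/andP => /and3P[xz _ zT] pp tE.
case: (IH z zT pp tE) => [[zv zt]|]; last by right.
have [xv|xv] := eqVneq x v.
  by right; exists z; split; [rewrite -xv|rewrite !inE zv zT|].
left; split=> //; apply: connect_trans zt; apply: connect1.
by rewrite /inner_edge/= xz !inE xv zv xT zT.
Qed.

Lemma anchored0 X T : anchored set0 X T -> T = set0.
Proof.
move=> /andP[_ /forall_inP aT]; apply/eqP; rewrite -subset0; apply/subsetP => t /aT.
by case/existsP => l; rewrite !inE.
Qed.

Variables (R : realFieldType) (Delta : nat) (x y : R).
Hypothesis deg : forall v, (#|[set w | e v w]| <= Delta)%N.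
Hypotheses (x_ge1 : 1 <= x) (y_gt0 : 0 < y) (xy : 1 + x ^+ Delta / y <= x).

Lemma card_anchored0 X k :
  (#|[set T : {set V} | (#|T| == k) && anchored set0 X T]|)%:R <= y ^+ k.
Proof.
case: k => [|k].
  rewrite expr0 -[leRHS]/(1%:R) ler_nat.
  rewrite -[leqRHS](cards1 (set0 : {set V})); apply: subset_leq_card.
  by apply/subsetP => T; rewrite !inE cards_eq0 => /andP[].
rewrite (_ : [set T : {set V} | _] = set0) ?cards0 ?exprn_ge0 ?ltW//.
apply/setP => T; rewrite !inE; apply/negbTE/negP => /andP[/eqP cT /anchored0 T0].
by rewrite T0 cards0 in cT.
Qed.

(** Explore a waiting vertex v. Either v is not in T, and L loses a vertex; or
    it is, and L gains at most Delta neighbours while the size to be found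
    drops by one. The bound is preserved because 1 + x^Delta / y <= x. *)
Lemma card_anchored L X k : [disjoint L & X] ->
  (#|[set T : {set V} | (#|T| == k) && anchored L X T]|)%:R <= x ^+ #|L| * y ^+ k.
Proof.
have x0 : 0 < x by apply: lt_le_trans x_ge1.
move em : #|~: X| => m; elim: m X em L k => [|m IH] X cX L k LX.
all: have [->|[v vL]] := set_0Vmem L.
1,3: by rewrite cards0 expr0 mul1r; apply: card_anchored0.
  have : v \in ~: X by rewrite inE (disjointFr LX vL).
  by move/eqP: cX; rewrite cards_eq0 => /eqP ->; rewrite inE.
have vX : v \notin X by rewrite (disjointFr LX vL).
have cX' : #|~: (v |: X)| = m.
  have -> : ~: (v |: X) = ~: X :\ v by rewrite setCU setDE setIC.
  by move: cX; rewrite (cardsD1 v (~: X)) inE vX add1n => -[].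
have cL : #|L| = #|L :\ v|.+1 by rewrite (cardsD1 v L) vL add1n.
have skipX : [disjoint L :\ v & v |: X].
  rewrite disjoints_subset; apply/subsetP => w; rewrite !inE negb_or => /andP[-> wL].
  by rewrite (disjointFr LX wL).
set F := [set T : {set V} | _].
have IHs := IH _ cX' (L :\ v) k skipX.
set F1 := [set T : {set V} | _] in IHs.
have leF : (#|F| <= #|F1| + #|[set T in F | v \in T]|)%N.
  rewrite -(cardsID [set T : {set V} | v \in T] F) addnC; apply: leq_add.
    apply: subset_leq_card; apply/subsetP => T; rewrite !inE => /and3P[vT -> aT].
    exact: anchored_skip.
  by apply: subset_leq_card; apply/subsetP => T /setIP[TF vT]; rewrite inE TF;
    rewrite inE in vT.
apply: (@le_trans _ _ (#|F1|%:R + #|[set T in F | v \in T]|%:R)).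
  by rewrite -natrD ler_nat.
case: k @F @F1 IHs {leF} => [|k] F F1 IHs.
  rewrite (_ : [set T in F | v \in T] = set0); last first.
    apply/setP => T; rewrite !inE; apply/negbTE/negP => /andP[/andP[/eqP T0 _] vT].
    by move/eqP: T0; rewrite cards_eq0 => /eqP T0; rewrite T0 inE in vT.
  rewrite cards0 addr0; apply: le_trans IHs _.
  by rewrite expr0 !mulr1 cL exprS ler_peMl// exprn_ge0// ltW.
pose L' := (L :\ v :|: [set w | e v w]) :\: (v |: X).
have L'X : [disjoint L' & v |: X].
  by rewrite disjoints_subset; apply/subsetP => w /setDP[_]; rewrite in_setC.
have IHt := IH _ cX' L' k L'X.
set F2 := [set T : {set V} | _] in IHt.
have leF2 : (#|[set T in F | v \in T]| <= #|F2|)%N.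
  have inj : {in [set T in F | v \in T] &, injective (fun T => T :\ v)}.
    move=> T T'; rewrite !inE => /andP[_ vT] /andP[_ vT'] E.
    by rewrite -(setD1K vT) -(setD1K vT') E.
  rewrite -(card_in_imset inj); apply: subset_leq_card; apply/subsetP => T' /imsetP[T].
  rewrite !inE => /andP[/andP[/eqP cT aT] vT] ->; apply/andP; split.
    by move: cT; rewrite (cardsD1 v T) vT add1n => -[->].
  exact: anchored_take.
have cL' : (#|L'| <= #|L :\ v| + Delta)%N.
  apply: (leq_trans (subset_leq_card (subsetDl _ _))).
  by apply: (leq_trans (leq_card_setU _ _)); rewrite leq_add2l.
apply: (@le_trans _ _ (x ^+ #|L :\ v| * y ^+ k.+1 + x ^+ (#|L :\ v| + Delta) * y ^+ k)).
  apply: lerD => //; apply: (@le_trans _ _ #|F2|%:R); first by rewrite ler_nat.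
  apply: le_trans IHt _; apply: ler_wpM2r; first by rewrite exprn_ge0// ltW.
  exact: ler_weXn2l.
have -> : x ^+ #|L :\ v| * y ^+ k.+1 + x ^+ (#|L :\ v| + Delta) * y ^+ k
   = x ^+ #|L :\ v| * y ^+ k.+1 * (1 + x ^+ Delta / y).
  by rewrite exprS exprD; field; rewrite gt_eqF.
rewrite cL [x ^+ _.+1]exprSr [leRHS]mulrAC ler_wpM2l//.
by rewrite mulr_ge0// exprn_ge0// ltW.
Qed.

Lemma leq_card_bigcup (I T : finType) (P : {pred I}) (F : I -> {set T}) :
  (#|\bigcup_(i in P) F i| <= \sum_(i in P) #|F i|)%N.
Proof.
elim/big_rec2: _ => [|i n A _ le]; first by rewrite cards0.
by apply: (leq_trans (leq_card_setU _ _)); rewrite leq_add2l.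
Qed.

Definition component S v := [set w | connect (inner_edge S) v w].

Lemma path_leaves (T : {set V}) (f : rel V) a p :
  a \in T -> path f a p -> last a p \notin T ->
  exists z w, [/\ z \in T, w \notin T & f z w] .
Proof.
elim: p a => [|w p IH] a aT /=; first by rewrite aT.
case/andP => aw pp; have [wT|wT] := boolP (w \in T); first exact: IH.
by exists a, w.
Qed.

Lemma anchored1 v T : v \in T -> {in T, forall t, connect (inner_edge T) v t} ->
  anchored [set v] set0 T.
Proof.
move=> vT H; apply/andP; split; first by rewrite disjoints_subset setC0 subsetT.
by apply/forall_inP => t /H vt; apply/existsP; exists v; rewrite !inE eqxx vT.
Qed.

(** Grow from v, along an edge that leaves the current set, until the size is
    k. *)
Lemma sub_anchored S v k : v \in S -> (0 < k <= #|component S v|)%N ->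
  exists T : {set V}, [/\ T \subset S, #|T| = k, v \in T & {in T, forall t, connect
    (inner_edge T) v t}].
Proof.
move=> vS; elim: k => // k IH /andP[_ kc]; have [k0|k0] := posnP k.
  exists [set v]; rewrite sub1set vS cards1 set11 k0; split=> // t.
  by rewrite inE => /eqP ->.
have [|T [TS cT vT Tv]] := IH; first by rewrite k0 ltnW.
have [t tc tT] : exists2 t, t \in component S v & t \notin T.
  apply/subsetPn; apply: contraL kc => /subset_leq_card; by rewrite cT -leqNgt.
have : connect (inner_edge S) v t by rewrite inE in tc.
case/connectP => p pp tE; rewrite tE in tT.
have [z [w [zT wT /and3P[zw _ wS]]]] := path_leaves vT pp tT.
exists (w |: T); split.
- by rewrite subUset sub1set wS.
- by rewrite cardsU1 wT cT.
- by rewrite inE vT orbT.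
have sub := sub_inner_connect (subsetUr [set w] T).
move=> a /setU1P[->|aT]; last exact/sub/Tv.
apply: connect_trans (sub _ _ (Tv _ zT)) _; apply: connect1.
by rewrite /inner_edge/= zw !inE zT eqxx orbT.
Qed.

Lemma binom_ratio n l k : (l <= n)%N ->
  (n ^ k * 'C(n - k, l - k) * (k <= l) <= l ^ k * 'C(n, l))%N.
Proof.
move=> ln; elim: k => [|k IH]; first by rewrite !subn0 !expn0 !mul1n muln1.
case: (ltnP k l) => kl; last by rewrite muln0.
rewrite (ltnW kl) muln1 in IH; rewrite muln1.
have nk : (0 < n - k)%N by rewrite subn_gt0 (leq_trans kl).
have E : ((n - k) * 'C(n - k.+1, l - k.+1) = (l - k) * 'C(n - k, l - k))%N.
  have -> : (n - k.+1 = (n - k).-1)%N by rewrite subnS.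
  by rewrite subnS mul_bin_diag prednK// subn_gt0.
rewrite -(leq_pmul2l nk).
have -> : ((n - k) * (n ^ k.+1 * 'C(n - k.+1, l - k.+1)) = n ^ k.+1 * ((l - k) * 'C(n -
  k, l - k)))%N.
  by rewrite -E mulnCA.
have H : (n * (l - k) <= l * (n - k))%N.
  by rewrite !mulnBr [(l * n)%N]mulnC leq_sub2l// leq_mul2r ln orbT.
apply: (@leq_trans (l * (n - k) * (n ^ k * 'C(n - k, l - k)))%N).
  rewrite expnS.
  have -> : (n * n ^ k * ((l - k) * 'C(n - k, l - k)) = n * (l - k) * (n ^ k * 'C(n - k,
    l - k)))%N by lia.
  by rewrite leq_mul2r H orbT.
apply: (@leq_trans (l * (n - k) * (l ^ k * 'C(n, l)))%N); first by rewrite leq_mul2l IH orbT.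
by rewrite expnS; lia.
Qed.

(** The sets S - T are the sets of size l - |T| outside T, so that with n =
    |V| the probability that a uniform S contains T is a product of |T|
    factors (l - i) / (n - i), each at most l / n. *)
Lemma card_supersets T l : (l <= #|V|)%N ->
  (#|V| ^ #|T| * #|[set S : {set V} | (#|S| == l) && (T \subset S)]| <= l ^ #|T| *
    'C(#|V|, l))%N.
Proof.
move=> ln; apply: leq_trans (binom_ratio #|T| ln).
rewrite -mulnA leq_mul2l; apply/orP; right.
case: (leqP #|T| l) => [Tl|lT]; last first.
  rewrite muln0 leqn0 cards_eq0; apply/eqP/setP => S; rewrite !inE.
  apply/negbTE/negP => /andP[/eqP cS /subset_leq_card]; rewrite cS; by rewrite leqNgt lT.
have cC : (#|V| - #|T| = #|~: T|)%N by rewrite -(cardsC T) addKn.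
rewrite muln1 cC -cards_draws.
have inj : {in [set S : {set V} | (#|S| == l) && (T \subset S)] &, injective (fun S => S
  :\: T)}.
  move=> S S'; rewrite !inE => /andP[_ TS] /andP[_ TS'] E.
  by rewrite -(setID S T) -(setID S' T) E (setIidPr TS) (setIidPr TS').
rewrite -(card_in_imset inj); apply: subset_leq_card; apply/subsetP => S' /imsetP[S].
by rewrite !inE => /andP[/eqP cS TS] ->; rewrite subsetDr cardsD (setIidPr TS) cS eqxx.
Qed.

(** Union bound over the connected sets of size M + 1 through each vertex. *)
Lemma card_big_component l M : (l <= #|V|)%N ->
  (#|V| ^ M.+1)%:R * (#|[set S : {set V} | (#|S| == l) && [exists v in S, M < #|component
    S v|]%N]|)%:R
  <= #|V|%:R * (x * y ^+ M.+1) * (l ^ M.+1 * 'C(#|V|, l))%:R.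
Proof.
move=> ln.
pose A v := [set T : {set V} | (#|T| == M.+1) && anchored [set v] set0 T].
pose F T := [set S : {set V} | (#|S| == l) && (T \subset S)].
have sub : [set S : {set V} | (#|S| == l) && [exists v in S, M < #|component S v|]%N]
   \subset \bigcup_(v in V) \bigcup_(T in A v) F T.
  apply/subsetP => S; rewrite inE => /andP[cS /existsP[v /andP[vS Mc]]].
  have [T [TS cT vT Tv]] := @sub_anchored S v M.+1 vS Mc.
  apply/bigcupP; exists v => //; apply/bigcupP; exists T.
    by rewrite inE cT eqxx anchored1.
  by rewrite inE cS TS.
have cF v T : T \in A v -> (#|V| ^ M.+1 * #|F T| <= l ^ M.+1 * 'C(#|V|, l))%N.
  by rewrite inE => /andP[/eqP cT _]; have := card_supersets T ln; rewrite cT.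
apply: (@le_trans _ _ (\sum_(v : V) (#|A v| * (l ^ M.+1 * 'C(#|V|, l)))%:R)).
  rewrite -natrM -natr_sum ler_nat.
  apply: (@leq_trans (#|V| ^ M.+1 * \sum_(v : V) \sum_(T in A v) #|F T|)%N).
    rewrite leq_mul2l; apply/orP; right; apply: (leq_trans (subset_leq_card sub)).
    apply: (leq_trans (leq_card_bigcup _ _)).
    by apply: leq_sum => v _; apply: leq_card_bigcup.
  rewrite big_distrr/=; apply: leq_sum => v _; rewrite big_distrr/= -sum_nat_const.
  by apply: leq_sum => T; apply: cF.
apply: (@le_trans _ _ (\sum_(v : V) x * y ^+ M.+1 * (l ^ M.+1 * 'C(#|V|, l))%:R)).
  apply: ler_sum => v _; rewrite natrM ler_wpM2r//.
  have := @card_anchored [set v] set0 M.+1; rewrite cards1 expr1; apply.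
  by rewrite disjoints_subset setC0 subsetT.
by rewrite sumr_const -[leLHS]mulr_natl mulrA.
Qed.

End LatticeAnimals.

(** * Block factorization of entropy *)

Section BlockFactorization.
Import fintype boot.finset.
Variables (R : realType) (V Q : finType).
Notation config := {ffun V -> Q}.
Variable mu : config -> R.
Variable e : rel V.
Variables (b c : R) (r : nat).
Hypothesis mu_ge0 : forall s, 0 <= mu s.
Hypothesis exch : forall U W : {set V}, [disjoint U & W] ->
  (forall u w, u \in U -> w \in W -> ~~ e u w) -> exchangeable mu U W.
Hypotheses (b_gt0 : 0 < b) (b_le1 : b <= 1).
Hypothesis marg : marginal_bound mu b.
Hypothesis conn : flip_connected mu.
Hypothesis local : forall f, (forall s, 0 <= f s) -> forall S : {set V},
  \sum_(u in S) \sum_(v in S :\ u)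
    (gap mu f S + gap mu f (S :\ u :\ v) - gap mu f (S :\ u) - gap mu f (S :\ v))
  <= c * \sum_(u in S) (gap mu f S - gap mu f (S :\ u)).
Hypothesis c_le : c <= r%:R.

Variables (Bs : {set {set V}}) (alpha : {set V} -> R) (amin : R).
Hypothesis alpha_ge0 : forall B, B \in Bs -> 0 <= alpha B.
Hypothesis amin_ge0 : 0 <= amin.
Hypothesis amin_le : forall v, amin <= \sum_(B in Bs | v \in B) alpha B.

Implicit Types (S T U W B : {set V}) (f : config -> R).

(** The right-hand side of the block factorization, for blocks cut down to S.
    *)
Definition block_gap f S := \sum_(B in Bs) alpha B * gap mu f (B :&: S).

Lemma block_gap_ge0 f S : (forall s, 0 <= f s) -> 0 <= block_gap f S.
Proof. by move=> f0; apply: sumr_ge0 => B BB; rewrite mulr_ge0 ?alpha_ge0 ?gap_ge0. Qed.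

Lemma sum_site_gap_le f T W : (forall s, 0 <= f s) -> T \subset W ->
  amin * \sum_(v in T) gap mu f [set v] <= #|T|%:R * block_gap f W.
Proof.
move=> f0 TW; rewrite mulr_natl mulr_sumr -sumr_const; apply: ler_sum => v vT.
have g0 S := gap_ge0 mu_ge0 f0 S.
apply: (@le_trans _ _ (\sum_(B in Bs | v \in B) alpha B * gap mu f [set v])).
  by rewrite -mulr_suml ler_wpM2r.
rewrite /block_gap [leRHS](bigID (fun B : {set V} => v \in B))/=.
rewrite -[leLHS]addr0; apply: lerD; last first.
  by apply: sumr_ge0 => B /andP[BB _]; rewrite mulr_ge0 ?alpha_ge0.
apply: ler_sum => B /andP[BB vB]; rewrite ler_wpM2l ?alpha_ge0//.
apply: gap_mono => //; rewrite sub1set inE vB; exact: (subsetP TW).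
Qed.

Definition small_const := 16 * (b ^- r.+1) ^+ 4 * r.+1%:R.

Lemma small_const_gt0 : 0 < small_const.
Proof.
rewrite /small_const; apply: mulr_gt0; last by rewrite ltr0n.
by apply: mulr_gt0; rewrite ?exprn_gt0// invr_gt0 exprn_gt0.
Qed.

(** Reduce T to its sites by gap_crude; each site is covered by blocks of
    total weight at least amin, and gap is monotone. *)
Lemma gap_le_small f T W : (forall s, 0 <= f s) -> T \subset W -> (#|T| <= r.+1)%N ->
  amin * gap mu f T <= small_const * block_gap f W.
Proof.
move=> f0 TW cT; have bg0 := block_gap_ge0 W f0.
apply: (@le_trans _ _ (16 * (b ^- #|T|) ^+ 4 * (amin * \sum_(v in T) gap mu f [set v]))).
  rewrite mulrCA; apply: ler_wpM2l => //; exact: gap_crude.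
apply: (@le_trans _ _ (16 * (b ^- #|T|) ^+ 4 * (#|T|%:R * block_gap f W))).
  apply: ler_wpM2l; last exact: sum_site_gap_le.
  by rewrite mulr_ge0// exprn_ge0// invr_ge0 exprn_ge0// ltW.
rewrite mulrA; apply: ler_wpM2r => //.
have p0 n : 0 <= b ^- n by rewrite invr_ge0 exprn_ge0// ltW.
apply: ler_pM => //; rewrite ?mulr_ge0 ?exprn_ge0 ?ler_nat//.
rewrite ler_wpM2l// lerXn2r ?nnegrE// lef_pV2 ?posrE ?exprn_gt0//.
by rewrite ler_wiXn2l// ltW.
Qed.

(** The uniform factorization with l = r + 1 leaves sets small enough for
    gap_le_small. *)
Lemma gap_le_bounded f W M (Cmax : R) : (forall s, 0 <= f s) ->
  (#|W| <= M)%N -> 1 <= Cmax -> 'C(M, r.+1)%:R <= Cmax ->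
  amin * gap mu f W <= Cmax * small_const * block_gap f W.
Proof.
move=> f0 WM C1 CM; have bg0 := block_gap_ge0 W f0.
have sb0 : 0 <= small_const * block_gap f W.
  by rewrite mulr_ge0// ltW// small_const_gt0.
rewrite -mulrA; case: (leqP #|W| r) => rW.
  by apply: le_trans (gap_le_small f0 (subxx W) (leqW rW)) _; rewrite ler_peMl.
have g0 := gap_ge0 mu_ge0 f0.
have gm := gap_mono mu_ge0 f0.
have := uniform_block_factorization g0 gm (local f0) c_le (ltnSn r) rW.
rewrite binn mul1n => H.
have Cp : 0 < 'C(#|W|, r.+1)%:R :> R by rewrite ltr0n bin_gt0.
rewrite ler_pM2l// in H.
apply: (@le_trans _ _ (amin * \sum_(T : {set V} | (T \subset W) && (#|T| == r.+1)) gap mu f T)).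
  by rewrite ler_wpM2l.
rewrite mulr_sumr.
apply: (@le_trans _ _ (\sum_(T : {set V} | (T \subset W) && (#|T| == r.+1)) small_const *
  block_gap f W)).
  by apply: ler_sum => T /andP[TW /eqP cT]; apply: gap_le_small; rewrite // cT.
rewrite sumr_const -[leLHS]mulr_natl ler_wpM2r//.
apply: le_trans CM; rewrite ler_nat; apply: leq_trans (leq_bin2l _ WM).
by rewrite -cards_draws; apply: subset_leq_card; apply/subsetP => T; rewrite !inE.
Qed.

(** Remove the component W of one vertex. The chain rule splits gap f S into
    the parts of W and of the rest S1, the former for a new density g; for
    each block B, supermodularity bounds the sum of the gaps of g at B n W and
    of f at B n S1 by the gap of f at B n S. *)
Lemma gap_le_components f S M (Cmax : R) : (forall s, 0 <= f s) ->
  (forall v, v \in S -> (#|component e S v| <= M)%N) ->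
  1 <= Cmax -> 'C(M, r.+1)%:R <= Cmax ->
  amin * gap mu f S <= Cmax * small_const * block_gap f S.
Proof.
move=> f0 + C1 CM; move em : #|S| => m; elim/ltn_ind: m S em => m IH S cS good.
have [->|[v vS]] := set_0Vmem S.
  rewrite {1}/gap setC0 subrr mulr0 mulr_ge0 ?block_gap_ge0// mulr_ge0 ?(le_trans _ C1)//.
  exact/ltW/small_const_gt0.
set W := component e S v.
have vW : v \in W by rewrite inE.
have WS : W \subset S.
  by apply/subsetP => w; rewrite inE; apply: inner_connect_in.
pose S1 := S :\: W.
have S1S : S1 \subset S by apply: subsetDl.
have dWS : [disjoint W & S1].
  by rewrite disjoints_subset; apply/subsetP => w wW; rewrite in_setC in_setD wW.
have noedge u w : u \in W -> w \in S1 -> ~~ e u w.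
  move=> uW /setDP[wS wW]; apply: contra wW => uw; move: (uW); rewrite !inE => vu.
  apply: connect_trans vu _; apply: connect1.
  by rewrite /inner_edge/= uw wS (subsetP WS _ uW).
have ex U : U \subset W -> [disjoint U & S1] /\ exchangeable mu U S1.
  move=> UW; have dU : [disjoint U & S1] by apply: disjointWl dWS.
  by split=> //; apply: exch => // u w /(subsetP UW); apply: noedge.
have cS1 : (#|S1| < m)%N.
  by rewrite -cS; apply: proper_card; apply/properP; split=> //; exists v;
    rewrite // in_setD vW.
have good1 w : w \in S1 -> (#|component e S1 w| <= M)%N.
  move=> wS1; apply: leq_trans (good w (subsetP S1S _ wS1)); apply: subset_leq_card.
  by apply/subsetP => u; rewrite !inE; apply: sub_inner_connect.
have H1 := IH _ cS1 _ erefl good1.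
pose g := cexp mu (~: S1) f.
have g0 s : 0 <= g s by apply: cexp_ge0.
have H2 := gap_le_bounded g0 (good v vS) C1 CM.
have gapW U : U \subset W -> gap mu g U = gap mu f (U :|: S1) - gap mu f S1.
  by move=> /ex[dU eU]; apply: gap_cexp.
have WS1 : W :|: S1 = S by rewrite -[RHS](setID S W) (setIidPr WS).
rewrite -/W gapW// WS1 in H2.
have H3 : block_gap g W <= block_gap f S - block_gap f S1.
  rewrite /block_gap -sumrB; apply: ler_sum => B BB; rewrite -mulrBr.
  apply: ler_wpM2l; first exact: alpha_ge0.
  have UW : B :&: W \subset W by apply: subsetIr.
  have [dU eU] := ex _ UW.
  rewrite gapW//.
  have := gap_supermod mu_ge0 dU eU f0 (subsetIr B S1).
  have -> : B :&: S1 :|: B :&: W = B :&: S by rewrite -setIUr setUC WS1.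
  lra.
have K0 : 0 <= Cmax * small_const.
  by rewrite mulr_ge0 ?(le_trans _ C1)//; apply/ltW/small_const_gt0.
have := ler_wpM2l K0 H3; rewrite mulrBr mulrBr in H2 *; lra.
Qed.

(** Average the uniform factorization over the sets of size l. The sets with a
    big component are so few that their share, bounded by gap f V, is at most
    half of the left-hand side. *)
Lemma block_factorization f l M (Cmax : R) : (forall s, 0 <= f s) ->
  (r < l)%N -> (l <= #|V|)%N ->
  1 <= Cmax -> 'C(M, r.+1)%:R <= Cmax ->
  2 * 'C(#|V|, r.+1)%:R * (#|[set S : {set V} | (#|S| == l) &&
      [exists v in S, M < #|component e S v|]%N]|)%:R
    <= ('C(l, r.+1) * 'C(#|V|, l))%:R :> R ->
  'C(l, r.+1)%:R * (amin * gap mu f [set: V]) <=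
    2 * 'C(#|V|, r.+1)%:R * (Cmax * small_const) * block_gap f [set: V].
Proof.
move=> f0 rl ln C1 CM; set bad := [set S | _] => Hbad.
have g0 := gap_ge0 mu_ge0 f0; have gm := gap_mono mu_ge0 f0.
have := @uniform_block_factorization _ _ _ _ _ g0 gm (local f0) c_le [set: V] l rl.
rewrite cardsT => /(_ ln) H.
have Cn0 : 0 < 'C(#|V|, l)%:R :> R by rewrite ltr0n bin_gt0.
set K := Cmax * small_const; set G := block_gap f [set: V].
have G0 : 0 <= G by apply: block_gap_ge0.
have K0 : 0 <= K.
  by rewrite mulr_ge0 ?(le_trans _ C1)//; apply/ltW/small_const_gt0.
set D := gap mu f [set: V] in H *.
have D0 : 0 <= D by apply: g0.
have sumT : amin * \sum_(T : {set V} | (T \subset [set: V]) && (#|T| == l)) gap mu f T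
   <= #|bad|%:R * (amin * D) + 'C(#|V|, l)%:R * (K * G).
  rewrite mulr_sumr (bigID (mem bad))/=; apply: lerD.
    apply: (@le_trans _ _ (\sum_(T in bad) amin * D)).
      rewrite big_mkcond [leRHS]big_mkcond/=; apply: ler_sum => T _.
      case: (T \in bad); rewrite ?andbF// andbT.
      by case: ifP => _; rewrite ?mulr_ge0// ler_wpM2l// gm// subsetT.
    by rewrite sumr_const -[leLHS]mulr_natl.
  apply: (@le_trans _ _ (\sum_(T : {set V} | #|T| == l) K * G)); last first.
    rewrite sumr_const -[leLHS]mulr_natl; apply: ler_wpM2r; first exact: mulr_ge0 K0 G0.
    rewrite ler_nat.
    rewrite -cardsT -cards_draws; apply: subset_leq_card.
    by apply/subsetP => T; rewrite !inE subsetT.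
  rewrite big_mkcond [leRHS]big_mkcond/=; apply: ler_sum => T _.
  rewrite subsetT/= inE; case: eqP => cT //=.
  case: ifP => [nb|_]; last exact: mulr_ge0 K0 G0.
  apply: (@le_trans _ _ (K * block_gap f T)).
    apply: (@gap_le_components f T M) => //.
    move=> v vT; rewrite leqNgt; apply: contra nb => Mv.
    by apply/existsP; exists v; rewrite vT.
  apply: ler_wpM2l => //; apply: ler_sum => B BB; rewrite ler_wpM2l ?alpha_ge0//.
  by apply: gm; rewrite setIT subsetIl.
have C0 : 0 <= 'C(#|V|, r.+1)%:R :> R by [].
have H1 := ler_wpM2l amin_ge0 H.
have H2 := ler_wpM2l C0 sumT.
have H3 := ler_wpM2r (mulr_ge0 amin_ge0 D0) Hbad.
rewrite natrM in H1 H3.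
rewrite -(ler_pM2l Cn0); move: H1 H2 H3.
set x := \sum_(T | _) _.
move: ('C(l, r.+1)%:R : R) ('C(#|V|, l)%:R : R) ('C(#|V|, r.+1)%:R : R) (#|bad|%:R : R)
  => a p q w.
clearbody D G K x => H1 H2 H3.
have e1 : amin * (a * p * D) = p * (a * (amin * D)) by ring.
have e2 : amin * (q * x) = q * (amin * x) by ring.
have e3 : 2 * q * w * (amin * D) = 2 * (q * (w * (amin * D))) by ring.
have e4 : a * p * (amin * D) = p * (a * (amin * D)) by ring.
have e5 : p * (2 * q * K * G) = 2 * (q * (p * (K * G))) by ring.
rewrite e1 e2 in H1; rewrite e3 e4 in H3; rewrite e5.
move: H2; rewrite mulrDr; lra.
Qed.

End BlockFactorization.

(** * The Rayleigh quotient of a symmetric matrix *)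

Section RayleighQuotient.
Import numFieldNormedType.Exports.
Local Open Scope classical_set_scope.
Local Open Scope ring_scope.
Variable R : realType.

Lemma continuous_bilinear n (A : 'M[R]_n) :
  continuous (fun y : 'rV[R]_n => \sum_i \sum_j y 0 i * A i j * y 0 j).
Proof.
have coord i : continuous (fun y : 'rV[R]_n => (y 0 i : R)).
  exact: (@coord_continuous R 1 n 0 i).
have term i j : continuous (fun y : 'rV[R]_n => (y 0 i * A i j * y 0 j : R)).
  move=> y; apply: (@cvgM R _ (nbhs y) _ (fun y : 'rV[R]_n => y 0 i * A i j)
    (fun y : 'rV[R]_n => y 0 j)); last exact: coord.
  apply: (@cvgM R _ (nbhs y) _ (fun y : 'rV[R]_n => y 0 i) (fun=> A i j)).
    exact: coord.
  exact: cvg_cst.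
apply: (@continuous_big R _ +%R 0) => [|i _]; first exact: add_continuous.
by apply: (@continuous_big R _ +%R 0) => [|j _ //]; exact: add_continuous.
Qed.

Lemma sum_sqr_bilinear n (y : 'rV[R]_n) :
  \sum_i y 0 i ^+ 2 = \sum_i \sum_j y 0 i * (1%:M : 'M[R]_n) i j * y 0 j.
Proof.
apply: eq_bigr => i _.
rewrite (bigD1 i)//= mxE eqxx mulr1 big1 ?addr0 ?expr2// => j /negbTE ji.
by rewrite mxE eq_sym ji mulr0 mul0r.
Qed.

Lemma compact_sphere n : compact [set y : 'rV[R]_n | \sum_i y 0 i ^+ 2 = 1].
Proof.
have cube : compact [set y : 'rV[R]_n | forall i, y ord0 i \in `[(-1 : R), 1]].
  apply: (@rV_compact R _ (fun=> `[(-1 : R), 1]%classic)) => _; exact: segment_compact.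
apply: (subclosed_compact _ cube).
- rewrite (_ : [set y | _] = (fun y : 'rV[R]_n => \sum_i \sum_j y 0 i * (1%:M : 'M[R]_n)
  i j * y 0 j) @^-1` [set x | x = 1]).
    apply: preimage_closed; last exact: closed_eq.
    by move=> y _; apply: continuous_bilinear.
  by apply/seteqP; split => y /=; rewrite sum_sqr_bilinear.
- move=> y /= y1 i; rewrite in_itv/= -ler_norml -(@expr_le1 _ 2)// real_normK ?num_real//.
  rewrite -y1 (bigD1 i)//= lerDl; apply: sumr_ge0 => j _; exact: sqr_ge0.
Qed.

(** The quadratic form attains its maximum a on the compact unit sphere, and
    the first variation vanishes there, so that a maximiser is an eigenvector
    for a. *)
Lemma rayleigh_eigenvalue n (A : 'M[R]_n) : (0 < n)%N ->
  (forall i j, A i j = A j i) ->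
  exists a (y : 'rV[R]_n), [/\ y != 0, y *m A = a *: y &
    forall x : 'rV[R]_n,
      \sum_i \sum_j x 0 i * A i j * x 0 j <= a * \sum_i x 0 i ^+ 2].
Proof.
case: n A => // n A _ symA; pose q (M : 'M[R]_n.+1) (x y : 'rV[R]_n.+1) := \sum_i \sum_j
  x 0 i * M i j * y 0 j.
have nonempty : [set y : 'rV[R]_n.+1 | \sum_i y 0 i ^+ 2 = 1] !=set0.
  exists (delta_mx 0 0); rewrite /= (bigD1 0)//= mxE !eqxx expr1n big1 ?addr0// => i i0.
  by rewrite mxE eqxx (negbTE i0) expr0n.
have [|y + ymax] := EVT_max_rV nonempty (@compact_sphere _) (f := fun y => q A y y).
  exact/continuous_subspaceT/continuous_bilinear.
rewrite inE/= => y1; set a := q A y y in ymax.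
have bound (x : 'rV[R]_n.+1) : q A x x <= a * \sum_i x 0 i ^+ 2.
  have N0 : 0 <= \sum_i x 0 i ^+ 2 by apply: sumr_ge0 => i _; apply: sqr_ge0.
  have [N1|N1] := eqVneq (\sum_i x 0 i ^+ 2) 0.
    have x0 i : x 0 i = 0.
      apply/eqP; rewrite -sqrf_eq0; apply/eqP.
      by apply: (psumr_eq0P _ N1) => // k _; apply: sqr_ge0.
    by rewrite N1 mulr0 /q big1// => i _; rewrite big1// => j _; rewrite x0 !mul0r.
  set N := \sum_i _ in N0 N1 *.
  have Np : 0 < N by rewrite lt0r N1.
  pose s := (Num.sqrt N)^-1.
  have s2 : s ^+ 2 = N^-1 by rewrite exprVn sqr_sqrtr.
  have : q A (s *: x) (s *: x) <= a.
    apply: ymax; rewrite inE/=.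
    under eq_bigr do rewrite mxE exprMn.
    by rewrite -mulr_sumr s2 mulVf.
  have -> : q A (s *: x) (s *: x) = N^-1 * q A x x.
    rewrite /q -s2 mulr_sumr; apply: eq_bigr => i _; rewrite mulr_sumr.
    by apply: eq_bigr => j _; rewrite !mxE; ring.
  by rewrite ler_pdivrMl// mulrC.
exists a, y; split=> //.
  apply/eqP => y0; move: y1; rewrite y0 big1 => [/esym/eqP|i _]; first by rewrite oner_eq0.
  by rewrite mxE expr0n.
(* the first variation of a |x|^2 - q x at the maximiser vanishes *)
apply/rowP => k; pose z : 'rV[R]_n.+1 := delta_mx 0 k.
pose d := a * y 0 k - (y *m A) 0 k.
have main t : 0 <= t * (2 * d) + t ^+ 2 * (a - A k k).
  have := bound (y + t *: z).
  have -> : q A (y + t *: z) (y + t *: z) = a + 2 * t * (y *m A) 0 k + t ^+ 2 * A k k.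
    have -> : q A (y + t *: z) (y + t *: z) = q A y y + t * (q A y z + q A z y) + t ^+ 2
      * q A z z.
      rewrite /q mulrDr !mulr_sumr -!big_split/=; apply: eq_bigr => i _.
      rewrite !mulr_sumr -!big_split/=; apply: eq_bigr => j _.
      by rewrite !mxE; ring.
    have qz (x : 'rV[R]_n.+1) : q A x z = (x *m A) 0 k.
      rewrite mxE; apply: eq_bigr => i _; rewrite (bigD1 k)//= big1 ?addr0.
        by rewrite mxE !eqxx mulr1.
      by move=> j jk; rewrite mxE (negbTE jk) andbF mulr0.
    have -> : q A z y = q A y z.
      rewrite /q exchange_big/=; apply: eq_bigr => i _; apply: eq_bigr => j _.
      by rewrite symA; ring.
    rewrite !qz; have -> : (z *m A) 0 k = A k k.
      rewrite mxE (bigD1 k)//= big1 ?addr0; first by rewrite mxE !eqxx mul1r.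
      by move=> j jk; rewrite mxE (negbTE jk) andbF mul0r.
    by rewrite -/a; ring.
  have -> : \sum_i (y + t *: z) 0 i ^+ 2 = 1 + 2 * t * y 0 k + t ^+ 2.
    rewrite (eq_bigr (fun i => y 0 i ^+ 2 + (2 * t * y 0 i + t ^+ 2) * (i == k)%:R)).
      rewrite big_split/= y1 (bigD1 k)//= eqxx mulr1 big1 ?addr0 ?addrA//.
      by move=> i /negbTE ->; rewrite mulr0.
    move=> i _; rewrite !mxE eqxx/=; case: (i == k) => /=; rewrite ?mulr1n ?mulr0n; ring.
  by rewrite /d; lra.
have d0 : d = 0.
  apply/eqP; apply/negPn/negP => dN.
  pose K := 1 + `|a - A k k|.
  have K0 : 0 < K by rewrite ltr_pwDl.
  have := main (- d / K); have := ler_norm (a - A k k) => H.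
  have d2 : 0 < d ^+ 2 by rewrite exprn_even_gt0.
  have -> : - d / K * (2 * d) + (- d / K) ^+ 2 * (a - A k k) =
     d ^+ 2 / K ^+ 2 * (a - A k k - 2 * K) by field; rewrite gt_eqF.
  rewrite pmulr_rge0; last by rewrite divr_gt0// exprn_gt0.
  by move=> H3; rewrite /K in H3 K0; lra.
by apply/esym/eqP; rewrite -subr_eq0 !mxE; move/eqP: d0; rewrite /d mxE.
Qed.

End RayleighQuotient.

(** * Spectral independence as a covariance bound *)

Section SpectralCovariance.
Import fintype boot.finset.
Variables (R : realType) (V Q : finType).
Notation config := {ffun V -> Q}.
Variable mu : config -> R.
Hypothesis mu_ge0 : forall s, 0 <= mu s.
Variables (L : {set V}) (s0 : config).
Hypothesis s0_gt0 : 0 < mu s0.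

Definition pin_prob (k : V * Q) : R :=
  (\sum_(s | eqon L s0 s) mu s * (s k.1 == k.2)%:R) / mass mu L s0.

Definition pin_prob2 (k l : V * Q) : R :=
  (\sum_(s | eqon L s0 s) mu s * ((s k.1 == k.2)%:R * (s l.1 == l.2)%:R)) / mass mu L s0.

Lemma pin_prob_ge0 k : 0 <= pin_prob k.
Proof.
apply: divr_ge0; last exact: mass_ge0.
by apply: sumr_ge0 => s _; rewrite mulr_ge0.
Qed.

Lemma pin_prob2_sym k l : pin_prob2 k l = pin_prob2 l k.
Proof.
by congr (_ / _); apply: eq_bigr => s _; rewrite [X in _ * X]mulrC.
Qed.

Lemma pin_prob2_ge0 k l : 0 <= pin_prob2 k l.
Proof.
apply: divr_ge0; last exact: mass_ge0.
by apply: sumr_ge0 => s _; rewrite !mulr_ge0.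
Qed.

Lemma pin_prob2_le k l : pin_prob2 k l <= pin_prob k.
Proof.
rewrite ler_wpM2r ?invr_ge0 ?mass_ge0//; apply: ler_sum => s _.
rewrite ler_wpM2l//; case: (s k.1 == k.2); rewrite ?mul0r// mul1r.
by case: (s l.1 == l.2).
Qed.

Lemma sum_spin u (F : Q -> R) (H : config -> R) :
  \sum_a F a * ((\sum_(s | eqon L s0 s) mu s * (H s * (s u == a)%:R)) / mass mu L s0)
  = (\sum_(s | eqon L s0 s) mu s * (H s * F (s u))) / mass mu L s0.
Proof.
rewrite mulr_suml.
under eq_bigr do rewrite mulr_suml mulr_sumr.
rewrite exchange_big/=; apply: eq_bigr => s _.
rewrite (bigD1 (s u))//= eqxx mulr1 big1 ?addr0; first by ring.
by move=> a /negbTE au; rewrite eq_sym au !(mulr0, mul0r).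
Qed.

Lemma sum_pin_prob u (F : Q -> R) :
  \sum_a F a * pin_prob (u, a)
  = (\sum_(s | eqon L s0 s) mu s * F (s u)) / mass mu L s0.
Proof.
have H := sum_spin u F (fun=> 1).
transitivity (\sum_a F a * ((\sum_(s | eqon L s0 s) mu s * (1 * (s u == a)%:R)) / mass mu
  L s0)).
  by apply: eq_bigr => a _; congr (_ * (_ / _)); apply: eq_bigr => s _; rewrite mul1r.
by rewrite H; congr (_ / _); apply: eq_bigr => s _; rewrite mul1r.
Qed.

Lemma sum_pin_prob2 u v (F F' : Q -> R) :
  \sum_a F a * \sum_a' F' a' * pin_prob2 (u, a) (v, a')
  = (\sum_(s | eqon L s0 s) mu s * (F (s u) * F' (s v))) / mass mu L s0.
Proof.
rewrite /pin_prob2/=.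
transitivity (\sum_a F a * ((\sum_(s | eqon L s0 s) mu s * (F' (s v) * (s u == a)%:R)) /
  mass mu L s0)).
  apply: eq_bigr => a _; rewrite (sum_spin v F' (fun s => (s u == a)%:R)).
  by congr (_ * (_ / _)); apply: eq_bigr => s _; rewrite [F' _ * _]mulrC.
rewrite (sum_spin u F (fun s => F' (s v))).
by congr (_ / _); apply: eq_bigr => s _; rewrite [F' _ * _]mulrC.
Qed.

Variables (I : {set V * Q}) (M : 'M[R]_#|I|) (eta : R).
Hypothesis I_in : forall k, (k \in I) = (k.1 \notin L) && (0 < pin_prob k).
Hypothesis M_entry : forall i j : 'I_#|I|, M i j =
  if (enum_val i).1 == (enum_val j).1 then 0
  else pin_prob2 (enum_val i) (enum_val j) / pin_prob (enum_val i) - pin_prob (enum_val j).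
Hypothesis M_spec : forall a, eigenvalue M a -> a <= eta.

(** Conjugating the influence matrix by the square roots of the marginals
    makes it symmetric without changing its eigenvalues, so the Rayleigh
    quotient is at most eta. *)
Lemma influence_quadratic (x : V * Q -> R) :
  \sum_(k in I) \sum_(l in I | k.1 != l.1) x k * x l * (pin_prob2 k l - pin_prob k * pin_prob l)
  <= eta * \sum_(k in I) x k ^+ 2 * pin_prob k.
Proof.
have [I0|Ipos] := posnP #|I|.
  by move/eqP: I0; rewrite cards_eq0 => /eqP ->; rewrite !big_set0 mulr0.
have p0 (i : 'I_#|I|) : 0 < pin_prob (enum_val i).
  by have := enum_valP i; rewrite I_in => /andP[].
pose rt (i : 'I_#|I|) : R := Num.sqrt (pin_prob (enum_val i)).
have rt0 (i : 'I_#|I|) : 0 < rt i by rewrite sqrtr_gt0.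
have rt2 (i : 'I_#|I|) : pin_prob (enum_val i) = rt i ^+ 2 by rewrite sqr_sqrtr// ltW.
pose A : 'M[R]_#|I| := \matrix_(i, j) (rt i * M i j / rt j).
have AE i j : A i j = if (enum_val i).1 == (enum_val j).1 then 0 else
    (pin_prob2 (enum_val i) (enum_val j) - pin_prob (enum_val i) * pin_prob (enum_val j))
      / (rt i * rt j).
  rewrite mxE M_entry; case: eqP => _; first by rewrite mulr0 mul0r.
  by rewrite !rt2; field; rewrite !gt_eqF.
have symA i j : A i j = A j i.
  by rewrite !AE eq_sym pin_prob2_sym [rt i * _]mulrC [pin_prob _ * _]mulrC.
have [a [y [yN yA bound]]] := rayleigh_eigenvalue Ipos symA.
have aeta : a <= eta.
  apply: M_spec; apply/eigenvalueP; exists (\row_i (y 0 i * rt i)).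
    apply/rowP => j; rewrite !mxE.
    have := congr1 (fun z : 'rV_#|I| => z 0 j) yA; rewrite !mxE => yAj.
    rewrite mulrA -yAj mulr_suml; apply: eq_bigr => i _; rewrite !mxE.
    by field; rewrite gt_eqF.
  apply: contra_neq yN => z0; apply/rowP => i; rewrite mxE.
  have := congr1 (fun z : 'rV_#|I| => z 0 i) z0; rewrite !mxE => /eqP.
  by rewrite mulf_eq0 (gt_eqF (rt0 i)) orbF => /eqP.
have := bound (\row_i (x (enum_val i) * rt i)).
have -> : \sum_i (\row_i (x (enum_val i) * rt i)) 0 i ^+ 2 = \sum_(k in I) x k ^+ 2 *
  pin_prob k.
  rewrite [RHS]big_enum_val; apply: eq_bigr => i _.
  by rewrite mxE exprMn rt2.
have -> : \sum_i \sum_j (\row_i (x (enum_val i) * rt i)) 0 i * A i j * (\row_i (x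
  (enum_val i) * rt i)) 0 j
    = \sum_(k in I) \sum_(l in I | k.1 != l.1) x k * x l * (pin_prob2 k l - pin_prob k *
      pin_prob l).
  rewrite [RHS]big_enum_val/=.
  apply: eq_bigr => i _; rewrite big_mkcondr/=.
  rewrite [RHS]big_enum_val/=.
  apply: eq_bigr => j _; rewrite ![(\row__ _) _ _]mxE AE.
  case: ifP => _ /=; first by rewrite mulr0 mul0r.
  by field; rewrite !gt_eqF.
move/le_trans; apply; rewrite ler_wpM2r//; apply: sumr_ge0 => k _.
by rewrite mulr_ge0 ?sqr_ge0// pin_prob_ge0.
Qed.

Lemma pairs_big (F : V * Q -> R) :
  (forall k, pin_prob k = 0 -> F k = 0) ->
  \sum_(k in I) F k = \sum_(u in ~: L) \sum_a F (u, a).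
Proof.
move=> F0; rewrite pair_big/= big_mkcond [RHS]big_mkcond/=; apply: eq_bigr => -[u a] _ /=.
rewrite I_in/= inE andbT; case: (u \notin L) => //=.
case: ltP => // le0; apply/esym/F0/eqP.
by rewrite eq_le le0 pin_prob_ge0.
Qed.

Lemma covariance_of_influence (x : V -> Q -> R) :
  (forall u, u \notin L -> \sum_(s | eqon L s0 s) mu s * x u (s u) = 0) ->
  \sum_(u in ~: L) \sum_(v in ~: L :\ u)
      \sum_(s | eqon L s0 s) mu s * (x u (s u) * x v (s v))
  <= eta * \sum_(u in ~: L) \sum_(s | eqon L s0 s) mu s * x u (s u) ^+ 2.
Proof.
move=> x0; have m0 := mass_gt0 mu_ge0 L s0_gt0.
have := influence_quadratic (fun k => x k.1 k.2).
have -> : \sum_(k in I) x k.1 k.2 ^+ 2 * pin_prob k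
  = (\sum_(u in ~: L) \sum_(s | eqon L s0 s) mu s * x u (s u) ^+ 2) / mass mu L s0.
  rewrite (pairs_big (F := fun k => x k.1 k.2 ^+ 2 * pin_prob k)).
    by rewrite mulr_suml; apply: eq_bigr => u _;
      rewrite -(sum_pin_prob u (fun a => x u a ^+ 2)).
  by move=> k ->; rewrite mulr0.
have z2 k l : pin_prob k = 0 -> pin_prob2 k l = 0.
  move=> k0; apply/eqP; rewrite eq_le pin_prob2_ge0 andbT -k0; exact: pin_prob2_le.
rewrite (pairs_big (F := fun k => \sum_(l in I | k.1 != l.1) x k.1 k.2 * x l.1 l.2 *
  (pin_prob2 k l - pin_prob k * pin_prob l))); last first.
  by move=> k k0; rewrite big1// => l _; rewrite z2// k0 mul0r subrr mulr0.
rewrite mulrA -ler_pdivrMr ?invr_gt0// invrK; apply: le_trans.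
rewrite le_eqVlt; apply/orP; left; apply/eqP; rewrite mulr_suml; apply: eq_bigr.
move=> u; rewrite inE => uL; apply: (mulIf (invr_neq0 (lt0r_neq0 m0)));
  rewrite mulfK ?lt0r_neq0//.
apply/esym.
transitivity (\sum_a \sum_(v in ~: L :\ u) \sum_a' x u a * x v a' *
    (pin_prob2 (u, a) (v, a') - pin_prob (u, a) * pin_prob (v, a'))).
  apply: eq_bigr => a _; rewrite big_mkcondr/=.
  rewrite (pairs_big (F := fun l => if u != l.1 then x u a * x l.1 l.2 * (pin_prob2 (u,
    a) l - pin_prob (u, a) * pin_prob l) else 0)); last first.
    move=> l l0; case: ifP => // _; rewrite pin_prob2_sym z2// l0 mulr0 subrr mulr0//.
  rewrite [RHS]big_mkcond [LHS]big_mkcond/=; apply: eq_bigr => v _.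
  rewrite !inE eq_sym; case: (v \in L); rewrite ?andbF//= andbT.
  by case: (v == u) => //=; rewrite big1.
rewrite exchange_big/= mulr_suml; apply: eq_bigr => v; rewrite !inE => /andP[vu vL].
rewrite -(sum_pin_prob2 u v (x u) (x v)).
have -> : \sum_a \sum_a' x u a * x v a' * (pin_prob2 (u, a) (v, a') - pin_prob (u, a) *
  pin_prob (v, a'))
  = \sum_a x u a * \sum_a' x v a' * pin_prob2 (u, a) (v, a')
   - (\sum_a x u a * pin_prob (u, a)) * (\sum_a' x v a' * pin_prob (v, a')).
  rewrite mulr_suml -sumrB; apply: eq_bigr => a _; rewrite !mulr_sumr -sumrB.
  by apply: eq_bigr => a' _; ring.
by rewrite !sum_pin_prob (x0 u uL) mul0r mul0r subr0.
Qed.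

End SpectralCovariance.

(** * Gibbs measures *)

Section GibbsMeasure.
Import fintype boot.finset.
Variables (R : realType) (V : finType) (G : sgraph V) (q : nat).
Variable S : spin_system R G q.
Hypothesis Z_gt0 : 0 < partition_function S.
Implicit Types (L U W T : {set V}) (s t : conf V q).

Lemma gibbs_ge0 s : 0 <= gibbs S s.
Proof. by rewrite divr_ge0 ?(ltW Z_gt0)// fine_ge0// expeR_ge0. Qed.

Lemma sum_gibbs : \sum_s gibbs S s = 1.
Proof. by rewrite -mulr_suml -/(partition_function S) divff// gt_eqF. Qed.

Definition edge_energy s : \bar R :=
  (\sum_(u : V) \sum_(v : V | G u v && (enum_rank u < enum_rank v)%N)
        pot S (s u) (s v))%E.

Definition boundary_term (u : V) (w : outer S) (a : 'I_q) : \bar R :=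
  if bdry w is Some s then pot S a s else 0%E.

Definition boundary_energy s : \bar R :=
  (\sum_(u : V) \sum_(w : outer S | ambient S (inl u) (inr w))
     boundary_term u w (s u))%E.

Lemma edge_energy_lty s : (edge_energy s < +oo)%E.
Proof.
apply: lte_sum_pinfty => u _; apply: lte_sum_pinfty => v _; exact: pot_lty.
Qed.

Lemma boundary_energy_lty s : (boundary_energy s < +oo)%E.
Proof.
apply: lte_sum_pinfty => u _; apply: lte_sum_pinfty => w _.
rewrite /boundary_term; case: bdry => [a|]; [exact: pot_lty|exact: ltry].
Qed.

Lemma oppe_hamiltonian s : (- hamiltonian S s =
  edge_energy s + boundary_energy s + \sum_(u : V) (self_pot S (s u))%:E)%E.
Proof.
have E1 := edge_energy_lty s; have B1 := boundary_energy_lty s.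
rewrite /hamiltonian -/(edge_energy s) -/(boundary_energy s) sumEFin.
move: (edge_energy s) (boundary_energy s) E1 B1 (\sum_u _) => [x| |] [y| |] // _ _ z.
by rewrite -!EFinN -!EFinD; congr EFin; ring.
Qed.

Lemma hamiltonian_gtNy s : (- hamiltonian S s < +oo)%E.
Proof.
rewrite oppe_hamiltonian sumEFin; apply: lte_add_pinfty; last exact: ltry.
by apply: lte_add_pinfty; [apply: edge_energy_lty|apply: boundary_energy_lty].
Qed.

Lemma weightM s t : weight S s * weight S t =
  fine (expeR (- hamiltonian S s + - hamiltonian S t)).
Proof.
have fin u : expeR (- hamiltonian S u)%E \is a fin_num.
  rewrite ge0_fin_numE ?expeR_ge0// ltey expeR_eqy.
  by have := hamiltonian_gtNy u; rewrite ltey.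
by rewrite /weight expeRD fineM.
Qed.

(** An edge meeting W has no end in U, so its other end lies in W or in the
    common part of s and t. In both cases the swap permutes the two energies
    of the edge. *)
Lemma gibbs_exchangeable U W : [disjoint U & W] ->
  (forall u w, u \in U -> w \in W -> ~~ G u w) -> exchangeable (gibbs S) U W.
Proof.
move=> dUW noedge s t st; rewrite /gibbs !mulf_div; congr (_ / _).
rewrite !weightM; congr (fine (expeR _)).
set s' := swap_on W s t; set t' := swap_on W t s.
have same v : v \notin U -> v \notin W -> s v = t v.
  by move=> vU vW; apply: (eqonP _ _ _ st); rewrite !inE negb_or vU vW.
have inW v : v \in W -> s' v = t v /\ t' v = s v by move=> vW; rewrite !ffunE vW.
have outW v : v \notin W -> s' v = s v /\ t' v = t v.
  by move=> /negbTE vW; rewrite !ffunE vW.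
have edge : (edge_energy s + edge_energy t = edge_energy s' + edge_energy t')%E.
  rewrite /edge_energy -!big_split/=; apply: eq_bigr => u _.
  rewrite -!big_split/=; apply: eq_bigr => v /andP[uv _].
  have [uW|uW] := boolP (u \in W); have [vW|vW] := boolP (v \in W).
  - by have [-> ->] := inW u uW; have [-> ->] := inW v vW; rewrite addeC.
  - have vU : v \notin U by apply/negP => vU; have := noedge _ _ vU uW; rewrite adj_sym uv.
    have [-> ->] := inW u uW; have [-> ->] := outW v vW.
    by rewrite (same v vU vW) addeC.
  - have uU : u \notin U by apply/negP => uU; have := noedge _ _ uU vW; rewrite uv.
    have [-> ->] := outW u uW; have [-> ->] := inW v vW.
    by rewrite (same u uU uW) addeC.
  - by have [-> ->] := outW u uW; have [-> ->] := outW v vW.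
have bound : (boundary_energy s + boundary_energy t = boundary_energy s' +
  boundary_energy t')%E.
  rewrite /boundary_energy -!big_split/=; apply: eq_bigr => u _.
  have [uW|uW] := boolP (u \in W).
    have [-> ->] := inW u uW.
    by rewrite -!big_split/=; apply: eq_bigr => w _; rewrite addeC.
  by have [-> ->] := outW u uW.
have self : (\sum_u (self_pot S (s u))%:E + \sum_u (self_pot S (t u))%:E =
    \sum_u (self_pot S (s' u))%:E + \sum_u (self_pot S (t' u))%:E)%E.
  rewrite -!big_split/=; apply: eq_bigr => u _.
  have [uW|uW] := boolP (u \in W).
    by have [-> ->] := inW u uW; rewrite addeC.
  by have [-> ->] := outW u uW.
by rewrite !oppe_hamiltonian addeACA [X in (X + _)%E]addeACA edge bound self
  [RHS]addeACA [X in _ = (X + _)%E]addeACA.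
Qed.

Lemma restr_eq L s t : (restr_conf L t == restr_conf L s) = eqon L s t.
Proof.
apply/eqP/eqonP => [H v vL|H].
  by have := congr1 (fun f : pconf q L => f (exist _ v vL)) H; rewrite !ffunE/= => ->.
by apply/ffunP => -[v vL]; rewrite !ffunE/= H.
Qed.

Lemma prob_agree L s : prob S (agree (restr_conf L s)) = mass (gibbs S) L s.
Proof. by apply: eq_bigl => t; rewrite inE restr_eq. Qed.

Lemma restr_in_Omega L s : 0 < gibbs S s -> restr_conf L s \in Omega_pin S L.
Proof. by move=> ms; rewrite inE prob_agree mass_gt0//; apply: gibbs_ge0. Qed.

Lemma cprob_spin L s k : cprob S (spin_at k.1 k.2) (agree (restr_conf L s)) =
  pin_prob (gibbs S) L s k.
Proof.
rewrite /cprob prob_agree /pin_prob; congr (_ / _).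
rewrite /prob big_mkcond [RHS]big_mkcond/=; apply: eq_bigr => t _.
rewrite !inE restr_eq andbC; case: (eqon L s t) => //=.
by case: (t k.1 == k.2); rewrite ?mulr1 ?mulr0.
Qed.

Lemma gibbs_marginal_bound b : marginally_bounded S b -> marginal_bound (gibbs S) b.
Proof.
move=> H s ms L v vL.
have mL := mass_gt0 gibbs_ge0 L ms.
have E : \sum_(t | eqon L s t) gibbs S t * (t v == s v)%:R = mass (gibbs S) (v |: L) s.
  rewrite /mass big_mkcond [RHS]big_mkcond/=; apply: eq_bigr => t _.
  rewrite eqonU; have -> : eqon [set v] s t = (t v == s v).
    apply/eqonP/eqP => [->//|tv w]; first exact: set11.
    by rewrite inE => /eqP ->.
  by case: (t v == s v); case: (eqon L s t); rewrite ?mulr1 ?mulr0.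
have := H L _ (restr_in_Omega L ms) (v, s v).
rewrite inE vL !cprob_spin /pin_prob/= E => H'.
rewrite -ler_pdivlMr//; apply: H'; rewrite divr_gt0// mass_gt0//.
exact: gibbs_ge0.
Qed.

Lemma gibbs_covariance_bound eta : spectrally_independent S eta ->
  covariance_bound (gibbs S) eta.
Proof.
move=> spec L s0 ms x x0.
have [L0|LN] := eqVneq (~: L) finset.set0.
  by rewrite L0 !big_set0 mulr0.
apply: (@covariance_of_influence _ _ _ _ gibbs_ge0 L s0 ms
  (pairs S (restr_conf L s0)) (influence_mx S (restr_conf L s0)) eta) => //.
- by move=> k; rewrite inE cprob_spin.
- move=> i j; rewrite mxE /influence; case: eqP => // _.
  rewrite cprob_spin; congr (_ - _).
  have pN : pin_prob (gibbs S) L s0 (enum_val i) != 0.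
    by have := enum_valP i; rewrite inE cprob_spin => /andP[_ /lt0r_neq0].
  have mN : mass (gibbs S) L s0 != 0 by rewrite gt_eqF// mass_gt0//; apply: gibbs_ge0.
  have e1 : prob S (spin_at (enum_val i).1 (enum_val i).2 :&: agree (restr_conf L s0))
     = pin_prob (gibbs S) L s0 (enum_val i) * mass (gibbs S) L s0.
    by rewrite -cprob_spin /cprob prob_agree divfK.
  have e2 : prob S (spin_at (enum_val j).1 (enum_val j).2 :&: (spin_at (enum_val i).1
    (enum_val i).2 :&: agree (restr_conf L s0)))
     = pin_prob2 (gibbs S) L s0 (enum_val i) (enum_val j) * mass (gibbs S) L s0.
    rewrite /pin_prob2 divfK// /prob big_mkcond [RHS]big_mkcond/=; apply: eq_bigr => t _.
    rewrite !inE restr_eq; case: (eqon L s0 t); rewrite ?andbF//= andbT.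
    by case: (t _ == _); case: (t _ == _); rewrite ?(mulr1, mulr0, mul0r).
  by rewrite /cprob e1 e2; field; rewrite pN mN.
- by move=> a; apply: spec => //; apply: restr_in_Omega.
Qed.

Definition merge L s (xi : pconf q L) : conf V q :=
  [ffun v => if @idP (v \in L) is ReflectT vL then xi (exist _ v vL) else s v].

Lemma merge_in L s (xi : pconf q L) (v : {v : V | v \in L}) : merge s xi (val v) = xi v.
Proof.
rewrite ffunE; case: {-}_ / idP => [vL|]; last by case; apply: valP.
by congr (xi _); apply: val_inj.
Qed.

Lemma merge_out L s (xi : pconf q L) v : v \notin L -> merge s xi v = s v.
Proof. by rewrite ffunE; case: {-}_ / idP => // vL; rewrite vL. Qed.

Lemma merge_restr L s t : eqon (~: L) s t -> merge s (restr_conf L t) = t.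
Proof.
move=> st; apply/ffunP => v; have [vL|vL] := boolP (v \in L).
  by rewrite -[v]/(val (exist (fun v => v \in L) v vL)) merge_in ffunE.
by rewrite merge_out// (eqonP _ _ _ st)// inE.
Qed.

(** Completing by s maps the one-site moves under the pinning of s off T to
    one-site flips of full configurations. *)
Lemma gibbs_flip_connected : totally_connected S -> flip_connected (gibbs S).
Proof.
move=> tc T s t ms mt st.
have tau := restr_in_Omega (~: T) ms.
have in_cond (w : conf V q) : 0 < gibbs S w -> eqon (~: T) s w ->
    restr_conf (~: ~: T) w \in Omega_cond S (restr_conf (~: T) s) (~: ~: T).
  move=> mw sw; rewrite inE divr_gt0 ?prob_agree ?mass_gt0//; last exact: gibbs_ge0.
  rewrite /prob (bigD1 w)/=; last by rewrite !inE eqxx restr_eq.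
  by rewrite ltr_wpDr// sumr_ge0// => *; apply: gibbs_ge0.
have cond_in xi : xi \in Omega_cond S (restr_conf (~: T) s) (~: ~: T) ->
    0 < gibbs S (merge s xi) /\ eqon (~: T) s (merge s xi).
  rewrite inE => H.
  have : 0 < prob S (agree xi :&: agree (restr_conf (~: T) s)).
    by move: H; rewrite /cprob pmulr_lgt0// invr_gt0 prob_agree mass_gt0//; apply: gibbs_ge0.
  rewrite lt0r => /andP[+ _]; rewrite psumr_neq0; last by move=> *; apply: gibbs_ge0.
  case/hasP => w _ /andP[]; rewrite !inE restr_eq => /andP[/eqP <- sw] mw.
  by rewrite merge_restr// setCK.
have step xi zeta : one_site_adj (Omega_cond S (restr_conf (~: T) s) (~: ~: T)) xi zeta ->
    flip_rel (gibbs S) T (merge s xi) (merge s zeta).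
  case/and3P => /cond_in[m1 e1] /cond_in[m2 e2] card1.
  rewrite /flip_rel/= m1 m2 (eqon_congr _ (_ : eqon (~: T) _ s)) ?e2//;
    last by rewrite eqon_sym.
  rewrite -(eqP card1) -(card_imset _ val_inj); apply/eqP; apply: eq_card => v.
  rewrite inE; apply/idP/imsetP => [neq|[w wN ->]]; last by rewrite !merge_in;
    rewrite inE in wN.
  have vL : v \in ~: ~: T.
    by apply: contraNT neq => vL; rewrite !merge_out.
  exists (exist (fun v => v \in ~: ~: T) v vL) => //.
  by rewrite inE; move: neq; rewrite -[v]/(val (exist (fun v => v \in ~: ~: T) v vL)) !merge_in.
have := tc _ _ tau _ _ (in_cond s ms (eqon_refl _ _)) (in_cond t mt st).
case/connectP => p pp tE.
have sE : s = merge s (restr_conf (~: ~: T) s) by rewrite merge_restr// eqon_refl.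
have tE' : t = merge s (restr_conf (~: ~: T) t) by rewrite merge_restr// setCK.
suff : connect (flip_rel (gibbs S) T) (merge s (restr_conf (~: ~: T) s))
    (merge s (restr_conf (~: ~: T) t)) by rewrite -sE -tE'.
rewrite tE; move: (restr_conf (~: ~: T) s) pp.
elim: p {tE} => [|w p IH] z /=; first by rewrite connect0.
by case/andP => /step zw /IH H; apply: connect_trans (connect1 zw) H.
Qed.

End GibbsMeasure.

(** * From entropy decay to mixing *)

Section Mixing.
Import fintype boot.finset.
Variables (R : realType) (V : finType) (G : sgraph V) (q : nat).
Variable S : spin_system R G q.
Hypothesis Z_gt0 : 0 < partition_function S.
Variables (Bs : {set {set V}}) (alpha : {set V} -> R) (lambda b : R).
Hypothesis alpha_distr : is_distr Bs alpha.
Hypothesis b_gt0 : 0 < b.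
Hypothesis marg : marginal_bound (gibbs S) b.
Hypothesis lambda_le1 : lambda <= 1.
Hypothesis factor : forall f : conf V q -> R, (forall s, 0 <= f s) ->
  lambda * gap (gibbs S) f [set: V] <= block_gap (gibbs S) Bs alpha f [set: V].
Local Notation mu := (gibbs S).
Local Notation P := (block_dynamics Bs alpha : state S -> state S -> R).
Let mu_ge0 := gibbs_ge0 Z_gt0.
Let alpha_ge0 := proj1 alpha_distr.

(** The block dynamics as an operator on functions. *)
Definition block_average (f : conf V q -> R) (s : conf V q) : R :=
  \sum_(B in Bs) alpha B * cexp mu (~: B) f s.

Lemma sum_state (F : conf V q -> R) :
  \sum_(z : state S) mu (val z) * F (val z) = \sum_s mu s * F s.
Proof.
rewrite [RHS](bigID (mem (Omega S)))/= [X in _ + X]big1 ?addr0.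
  by rewrite [RHS]big_sub.
move=> s; rewrite inE -leNgt => le0.
by have -> : mu s = 0; [apply/eqP; rewrite eq_le le0 mu_ge0|rewrite mul0r].
Qed.

Lemma state_gt0 (x : state S) : 0 < mu (val x).
Proof. by have := valP x; rewrite inE. Qed.

Lemma block_dynamicsE (x y : state S) : P x y =
  \sum_(B in Bs) alpha B * ((eqon (~: B) (val x) (val y))%:R * mu (val y) / mass mu (~:
    B) (val x)).
Proof.
apply: eq_bigr => B _; rewrite /cprob prob_agree; congr (_ * (_ / _)).
rewrite /prob; case: (boolP (eqon _ _ _)) => xy.
  rewrite (eq_bigl (pred1 (val y))) ?big_pred1_eq ?mul1r// => s.
  by rewrite !inE restr_eq; case: eqP => //= ->; rewrite xy.
rewrite mul0r big1// => s; rewrite !inE restr_eq => /andP[/eqP ->].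
by rewrite (negbTE xy).
Qed.

Lemma block_dynamics_rev (x y : state S) :
  mu (val x) * P x y = mu (val y) * P y x.
Proof.
rewrite !block_dynamicsE !mulr_sumr; apply: eq_bigr => B _.
rewrite [eqon _ (val y) _]eqon_sym.
case: (boolP (eqon _ _ _)) => xy; last by rewrite !mul0r !mulr0.
by rewrite (mass_depends mu xy); ring.
Qed.

Lemma block_dynamics_average (F : conf V q -> R) (x : state S) :
  \sum_(z : state S) P x z * F (val z) = block_average F (val x).
Proof.
rewrite /block_average /cexp.
under eq_bigr do rewrite block_dynamicsE mulr_suml.
rewrite exchange_big/=; apply: eq_bigr => B _.
rewrite mulr_suml mulr_sumr.
rewrite [RHS]big_mkcond/=.
rewrite (eq_bigr (fun z : state S => mu (val z) *
  (alpha B * ((eqon (~: B) (val x) (val z))%:R * F (val z) / mass mu (~: B) (val x)))));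
    last first.
  by move=> z _; ring.
rewrite (sum_state (fun s => alpha B * ((eqon (~: B) (val x) s)%:R * F s / mass mu (~: B)
  (val x)))).
by apply: eq_bigr => s _; case: eqon; rewrite /= ?mul0r ?mulr0// mul1r; ring.
Qed.

Lemma kernel_powSr (K : state S -> state S -> R) t x y :
  kernel_pow K t.+1 x y = \sum_(z : state S) kernel_pow K t x z * K z y.
Proof.
elim: t x y => [|t IH] x y.
  rewrite /= (bigD1 y)//= eqxx mulr1 big1 ?addr0; last first.
    by move=> z /negbTE ->; rewrite mulr0.
  rewrite (bigD1 x)//= eqxx mul1r big1 ?addr0// => z /negbTE zx.
  by rewrite eq_sym zx mul0r.
rewrite -[LHS]/(\sum_(z : state S) K x z * kernel_pow K t.+1 z y).
under eq_bigr do rewrite IH mulr_sumr.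
rewrite exchange_big/=; apply: eq_bigr => z _.
by rewrite mulr_suml; apply: eq_bigr => w _; rewrite mulrA.
Qed.

(** The density of the law after t steps from x with respect to mu;
    reversibility lets the step act on densities as it acts on functions. *)
Fixpoint density (x : state S) (t : nat) : conf V q -> R :=
  if t is t'.+1 then block_average (density x t')
  else fun s => (s == val x)%:R / mu (val x).

Lemma kernel_pow_density x t y : kernel_pow P t x y = mu (val y) * density x t (val y).
Proof.
elim: t y => [|t IH] y.
  rewrite /= (inj_eq val_inj) eq_sym; case: eqP => [->|_]; last by rewrite mul0r mulr0.
  by rewrite mul1r divff// gt_eqF// state_gt0.
rewrite kernel_powSr -[density x t.+1 _]/(block_average (density x t) (val y)).
rewrite -block_dynamics_average mulr_sumr; apply: eq_bigr => z _.
by rewrite IH mulrAC block_dynamics_rev; ring.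
Qed.

Lemma density_ge0 x t s : 0 <= density x t s.
Proof.
elim: t s => [|t IH] s /=; first by rewrite divr_ge0.
by apply: sumr_ge0 => B BB; rewrite mulr_ge0 ?alpha_ge0// cexp_ge0.
Qed.

Lemma block_average_mean f : \sum_s mu s * block_average f s = \sum_s mu s * f s.
Proof.
rewrite /block_average; under eq_bigr do rewrite mulr_sumr.
rewrite exchange_big/=.
rewrite (eq_bigr (fun B => alpha B * \sum_s mu s * f s)).
  by rewrite -mulr_suml (proj2 alpha_distr) mul1r.
move=> B _; rewrite -(sum_cexp1 mu_ge0 (~: B)) mulr_sumr.
by apply: eq_bigr => s _; rewrite mulrCA.
Qed.

Lemma density_mean x t : \sum_s mu s * density x t s = 1.
Proof.
elim: t => [|t IH]; last by rewrite /= block_average_mean.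
rewrite /= (bigD1 (val x))//= eqxx mul1r divff ?gt_eqF ?state_gt0// big1 ?addr0//.
by move=> s /negbTE ->; rewrite mul0r mulr0.
Qed.

Lemma mass0 s : mass mu set0 s = 1.
Proof.
rewrite -(sum_gibbs Z_gt0) /mass; apply: eq_bigl => t; exact: eqon0.
Qed.

Lemma cexp0 f s : cexp mu set0 f s = \sum_t mu t * f t.
Proof.
by rewrite /cexp mass0 divr1; apply: eq_bigl => t; apply: eqon0.
Qed.

Lemma gap_density x t : gap mu (density x t) [set: V] = ent mu (density x t) [set: V].
Proof.
rewrite /gap setCT [X in _ - X]/ent big1 ?subr0// => s _.
by rewrite cexp0 density_mean ln1 !mulr0.
Qed.

Lemma xlnx_jensen (x : {set V} -> R) : (forall B, 0 <= x B) ->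
  (\sum_(B in Bs) alpha B * x B) * ln (\sum_(B in Bs) alpha B * x B) <= \sum_(B in Bs)
    alpha B * (x B * ln (x B)).
Proof.
move=> x0; set m := \sum_(B in Bs) alpha B * x B.
have t0 B : B \in Bs -> 0 <= alpha B * x B by move=> BB; rewrite mulr_ge0 ?alpha_ge0.
have m0 : 0 <= m by apply: sumr_ge0 => B /t0.
have : 0 <= \sum_(B in Bs) alpha B * (x B * ln (x B) - x B * ln m - x B + m).
  apply: sumr_ge0 => B BB; have := alpha_ge0 BB; rewrite le_eqVlt => /predU1P[<-|aB].
    by rewrite mul0r.
  rewrite pmulr_rge0//; have := @xlnx_tangent R (x B) m (x0 B) m0.
  suff xm : m = 0 -> x B = 0 by move=> /(_ xm); lra.
  move=> /(psumr_eq0P t0)/(_ B BB)/eqP; rewrite mulf_eq0 (gt_eqF aB)/=; exact/eqP.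
rewrite (eq_bigr (fun B => alpha B * (x B * ln (x B)) - (alpha B * x B) * ln m - alpha B
  * x B + alpha B * m)).
  by rewrite big_split/= !sumrB -!mulr_suml (proj2 alpha_distr) -/m; lra.
by move=> B _; ring.
Qed.

(** Convexity of x ln x for the mixture over blocks. *)
Lemma ent_contract f : (forall s, 0 <= f s) ->
  ent mu (block_average f) [set: V] <= ent mu f [set: V] - block_gap mu Bs alpha f [set: V].
Proof.
move=> f0; apply: (@le_trans _ _ (\sum_(B in Bs) alpha B * ent mu f (~: B))).
  rewrite /ent; under [leRHS]eq_bigr do rewrite mulr_sumr.
  rewrite exchange_big/= [leRHS](eq_bigr (fun s => mu s * \sum_(B in Bs) alpha B * (cexp
    mu (~: B) f s * ln (cexp mu (~: B) f s)))); last first.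
    by move=> s _; rewrite mulr_sumr; apply: eq_bigr => B _; rewrite mulrCA.
  apply: (ler_sum_mu mu_ge0) => s ms; rewrite cexpT//.
  by apply: xlnx_jensen => B; apply: cexp_ge0.
rewrite /block_gap le_eqVlt; apply/orP; left; apply/eqP.
rewrite -[X in _ = X - _]mul1r -(proj2 alpha_distr) mulr_suml -sumrB.
by apply: eq_bigr => B _; rewrite setIT /gap; ring.
Qed.

(** The initial entropy is ln (1 / mu(x)), and mu(x) >= b^n. *)
Lemma ent_density_le x t : ent mu (density x t) [set: V] <=
  (1 - lambda) ^+ t * (#|V|%:R * ln b^-1).
Proof.
elim: t => [|t IH].
  rewrite expr0 mul1r /ent (eq_sum_mu mu_ge0 (g := fun s => density x 0 s * ln (density x
    0 s))); last first.
    by move=> s ms; rewrite cexpT.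
  have mx := state_gt0 x.
  rewrite (bigD1 (val x))//= eqxx big1 ?addr0; last first.
    by move=> s /negbTE ->; rewrite !mul0r mulr0.
  rewrite mul1r mulrA divff ?gt_eqF// mul1r.
  have := mass_ge_pow b_gt0 marg [set: V] mx.
  rewrite setCT mass0 mulr1 cardsT => H.
  rewrite mulr_natl -lnXn ?invr_gt0// exprVn.
  by rewrite ler_ln ?posrE ?invr_gt0 ?exprn_gt0// lef_pV2 ?posrE ?exprn_gt0.
apply: le_trans (ent_contract (density_ge0 x t)) _.
have := factor (density_ge0 x t); rewrite gap_density => H.
rewrite exprS -mulrA.
apply: (@le_trans _ _ ((1 - lambda) * ent mu (density x t) [set: V])); first by lra.
by rewrite ler_wpM2l// subr_ge0.
Qed.

(** With g the square root of f, |f - 1| = |g - 1| (g + 1) <= 4 (g - 1)^2 +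
    (g^2 + 1) / 8 by the arithmetic-geometric inequality, and the mean of (g -
    1)^2 is at most the entropy. *)
Lemma tv_density_le x t : ent mu (density x t) [set: V] <= 16^-1 ->
  tv_gibbs (kernel_pow P t x) <= 4^-1.
Proof.
move=> small; set f := density x t.
have f0 : forall s, 0 <= f s := density_ge0 x t.
have -> : tv_gibbs (kernel_pow P t x) = 2^-1 * \sum_s mu s * `|f s - 1|.
  rewrite /tv_gibbs -sum_state; congr (_ * _); apply: eq_bigr => y _.
  by rewrite kernel_pow_density -[X in _ - X]mulr1 -mulrBr normrM ger0_norm.
have := gap_ge_hellinger mu_ge0 [set: V] f0.
rewrite gap_density setCT => H.
have H2 : \sum_s mu s * (Num.sqrt (f s) - 1) ^+ 2 <= 16^-1.
  apply: le_trans small; apply: le_trans H.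
  by apply: (ler_sum_mu mu_ge0) => s _; rewrite cexp0 density_mean sqrtr1.
have H3 : \sum_s mu s * `|f s - 1| <=
    \sum_s mu s * (4 * (Num.sqrt (f s) - 1) ^+ 2 + 8^-1 * (f s + 1)).
  apply: (ler_sum_mu mu_ge0) => s _.
  have key (g : R) : `|g ^+ 2 - 1| <= 4 * (g - 1) ^+ 2 + 8^-1 * (g ^+ 2 + 1).
    rewrite ler_norml; have q1 := sqr_ge0 (g - 1).
    have q2 := sqr_ge0 (8 * (g - 1) - (g + 1)).
    have q3 := sqr_ge0 (8 * (g - 1) + (g + 1)).
    by rewrite !expr2 in q1 q2 q3 *; apply/andP; split; lra.
  by have := key (Num.sqrt (f s)); rewrite sqr_sqrtr.
have E : \sum_s mu s * (4 * (Num.sqrt (f s) - 1) ^+ 2 + 8^-1 * (f s + 1))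
   = 4 * (\sum_s mu s * (Num.sqrt (f s) - 1) ^+ 2) + 4^-1.
  rewrite (eq_bigr (fun s => 4 * (mu s * (Num.sqrt (f s) - 1) ^+ 2) + 8^-1 * (mu s * f s)
    + 8^-1 * mu s)); last by move=> s _; ring.
  by rewrite !big_split/= -!mulr_sumr density_mean sum_gibbs//; field.
rewrite E in H3; lra.
Qed.

Lemma mixing_time_le t : (0 < t)%N ->
  (1 - lambda) ^+ t * (#|V|%:R * ln b^-1) <= 16^-1 ->
  (mixing_time P <= (t%:R)%:E)%E.
Proof.
move=> t0 small; apply: ereal_inf_lbound; exists t => //; split=> //.
apply: bigmax_le => [|x _]; first by rewrite invr_ge0.
apply: tv_density_le; exact: le_trans (ent_density_le x t) small.
Qed.

End Mixing.

(** * Estimates of binomial coefficients *)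

Section BinomialEstimates.
Variable R : realType.

Lemma expR1_le4 : expR 1 <= 4 :> R.
Proof.
have := expR_ge1Dx (- 2^-1 : R); rewrite expRN => H.
have h0 := expR_gt0 (2^-1 : R).
have h2 : expR (2^-1 : R) <= 2.
  rewrite -(lef_pV2 _ _) ?posrE//; lra.
have -> : (1 : R) = 2^-1 + 2^-1 by field.
rewrite expRD; nra.
Qed.

Lemma onePV_exp_le4 t : (0 < t)%N -> (1 + t%:R^-1) ^+ t <= 4 :> R.
Proof.
move=> t0; have tp : 0 < t%:R :> R by rewrite ltr0n.
apply: le_trans expR1_le4.
rewrite -[in leRHS](mulfV (lt0r_neq0 tp)) expRM_natl.
apply: lerXn2r; rewrite ?nnegrE ?expR_ge0 ?addr_ge0 ?invr_ge0//.
exact: expR_ge1Dx.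
Qed.

Lemma binom_le_exp N k (x : R) : 0 < x -> 'C(N, k)%:R * x ^+ k <= (1 + x) ^+ N.
Proof.
move=> x0; have xk n : 0 <= x ^+ n by rewrite exprn_ge0// ltW.
case: (ltnP N k) => kN; first by rewrite bin_small// mul0r exprn_ge0// addr_ge0// ltW.
rewrite exprDn (bigD1 (Ordinal (kN : (k < N.+1)%N)))//= expr1n mul1r mulr_natl lerDl.
by apply: sumr_ge0 => i _; rewrite expr1n mul1r mulrn_wge0.
Qed.

(** One term of the binomial expansion of (1 + 1/t)^(k t), which is at most
    4^k. *)
Lemma binom_mul_le k t : (0 < t)%N -> 'C(k * t, k)%:R <= (4 * t%:R) ^+ k :> R.
Proof.
move=> t0; have tp : 0 < t%:R :> R by rewrite ltr0n.
have tV : 0 < t%:R^-1 :> R by rewrite invr_gt0.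
have H := binom_le_exp (k * t) k tV.
rewrite exprMn -ler_pdivrMr ?exprn_gt0// -exprVn; apply: le_trans H _.
rewrite mulnC exprM; apply: lerXn2r; last exact: onePV_exp_le4.
  by rewrite nnegrE exprn_ge0// addr_ge0// ltW.
by rewrite nnegrE.
Qed.

Lemma binom_scale n l c k : (forall i, (i < k)%N -> (n - i <= c * (l - i))%N) ->
  ('C(n, k) <= c ^ k * 'C(l, k))%N.
Proof.
elim: k => [|k IH] H; first by rewrite !bin0.
have IH' := IH (fun i ik => H i (ltnW ik)).
have k0 : (0 < k.+1)%N by [].
rewrite -(leq_pmul2l k0).
have E m : (k.+1 * 'C(m, k.+1) = (m - k) * 'C(m, k))%N by rewrite mul_bin_left.
rewrite E mulnCA E expnS.
apply: leq_trans (leq_mul (H k (ltnSn k)) IH') _.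
by rewrite leq_eqVlt; apply/orP; left; apply/eqP; lia.
Qed.

End BinomialEstimates.

(** * Block factorization for spin systems *)

Section GibbsFactorization.
Import fintype boot.finset.
Variables (R : realType) (V : finType) (G : sgraph V) (q : nat).
Variable S : spin_system R G q.
Variables (b eta : R) (Delta r : nat) (Bs : {set {set V}}) (alpha : {set V} -> R).
Hypothesis Z_gt0 : 0 < partition_function S.
Hypotheses (b_gt0 : 0 < b) (b_le1 : b <= 1) (eta_ge0 : 0 <= eta).
Hypothesis Delta_gt0 : (0 < Delta)%N.
Hypothesis deg : forall v, (#|[set w | G v w]| <= Delta)%N.
Hypothesis Delta_le : (Delta <= #|V|)%N.
Hypothesis tc : totally_connected S.
Hypothesis spec : spectrally_independent S eta.
Hypothesis mb : marginally_bounded S b.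
Hypothesis r_ge : 2 * eta / b <= r%:R.
Hypothesis r_gt0 : (0 < r)%N.
Hypothesis alpha_ge0 : forall B, B \in Bs -> 0 <= alpha B.
Variable amin : R.
Hypothesis amin_ge0 : 0 <= amin.
Hypothesis amin_le : forall v, amin <= \sum_(B in Bs | v \in B) alpha B.

(** A component of size (r+1) t or more has probability at most 2 n 4^(-(r+1)
    t) when l <= n / (16 Delta), and t is chosen with 4^t >= 256 n^2, so that
    this beats the ratio (64 Delta)^(r+1) of the uniform factorization. *)
Lemma few_big_components l t : (16 * Delta * l <= #|V|)%N -> (0 < t)%N ->
  (256 * #|V| ^ 2 <= 4 ^ t)%N ->
  4 * (64 * Delta%:R) ^+ r.+1 *
    (#|[set T : {set V} | (#|T| == l) &&
      [exists v in T, (r.+1 * t).-1 < #|component G T v|]%N]|)%:R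
  <= 2 * 'C(#|V|, l)%:R :> R.
Proof.
move=> dl t0 tn; set N := #|[set T : {set V} | _]|.
have n0 : (0 < #|V|)%N by apply: leq_trans Delta_le.
have D0 : 0 < Delta%:R :> R by rewrite ltr0n.
have ln : (l <= #|V|)%N by apply: leq_trans dl; rewrite leq_pmull// muln_gt0.
(* the condition of card_big_component is (1 + 1/Delta)^Delta <= 4 here *)
pose x : R := 1 + Delta%:R^-1; pose y : R := 4 * Delta%:R.
have x1 : 1 <= x by rewrite lerDl invr_ge0.
have y0 : 0 < y by rewrite mulr_gt0.
have xy : 1 + x ^+ Delta / y <= x.
  rewrite lerD2l ler_pdivrMr// /y mulrCA mulVf ?gt_eqF// mulr1.
  exact: (onePV_exp_le4 R Delta_gt0).
have x2 : x <= 2 by rewrite /x -[2]/(1 + 1) lerD2l invf_le1// ler1n.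
have k0 : (0 < r.+1 * t)%N by rewrite muln_gt0.
have := @card_big_component V G R Delta x y deg x1 y0 xy l (r.+1 * t).-1 ln.
rewrite -/N prednK//; set k := (r.+1 * t)%N => H.
have nk : 0 < (#|V| ^ k)%:R :> R by rewrite ltr0n expn_gt0 n0.
have H1 : (4 ^ k)%:R * N%:R <= 2 * #|V|%:R * 'C(#|V|, l)%:R :> R.
  rewrite -(ler_pM2l nk) mulrCA.
  apply: (@le_trans _ _ ((4 ^ k)%:R * (#|V|%:R * (x * y ^+ k) * (l ^ k * 'C(#|V|, l))%:R))).
    by rewrite ler_wpM2l.
  have -> : (4 ^ k)%:R * (#|V|%:R * (x * y ^+ k) * (l ^ k * 'C(#|V|, l))%:R)
    = ((4 * y * l%:R) ^+ k) * (x * #|V|%:R * 'C(#|V|, l)%:R) :> R.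
    by rewrite natrM !natrX !exprMn; ring.
  have c0 : 0 <= 'C(#|V|, l)%:R :> R by [].
  apply: ler_pM.
  - by rewrite exprn_ge0// !mulr_ge0// ltW.
  - by rewrite !mulr_ge0// (le_trans _ x1).
  - rewrite natrX lerXn2r ?nnegrE ?mulr_ge0 ?(ltW y0)//.
    have -> : 4 * y * l%:R = (16 * Delta * l)%:R :> R by rewrite /y !natrM; ring.
    by rewrite ler_nat.
  - by rewrite ler_wpM2r// ler_wpM2r.
have n0' : 0 < #|V|%:R :> R by rewrite ltr0n.
rewrite -(ler_pM2l n0').
apply: (@le_trans _ _ ((4 ^ k)%:R * N%:R)); last by apply: le_trans H1 _;
  rewrite le_eqVlt; apply/orP; left; apply/eqP; ring.
rewrite !mulrA ler_wpM2r//.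
have -> : #|V|%:R * 4 * (64 * Delta%:R) ^+ r.+1 = (#|V| * 4 * (64 * Delta) ^ r.+1)%:R :> R.
  by rewrite !natrM natrX natrM.
rewrite ler_nat /k [(r.+1 * t)%N]mulnC expnM.
apply: (@leq_trans ((256 * #|V| ^ 2) ^ r.+1)%N); last by rewrite leq_exp2r.
apply: (@leq_trans ((#|V| * 4) ^ r.+1 * (64 * Delta) ^ r.+1)%N).
  by rewrite leq_mul2r; apply/orP; right; rewrite -[leqLHS]expn1 leq_pexp2l// muln_gt0 n0.
rewrite -expnMn leq_exp2r// expnS expn1.
rewrite -mulnA [(4 * _)%N]mulnA mulnCA (_ : 4 * 64 = 256)%N// leq_mul2l/=.
by rewrite leq_mul2l Delta_le orbT.
Qed.

(** For n >= 32 r Delta take sets of size n / (16 Delta), whose ratio of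
    binomial coefficients is at most (64 Delta)^(r+1) because l >= 2 r.
    Otherwise n itself is at most 32 (r+1) Delta and plays the role of a
    component. *)
Lemma gibbs_block_factorization t (f : conf V q -> R) :
  (forall s, 0 <= f s) -> (0 < t)%N -> (256 * #|V| ^ 2 <= 4 ^ t)%N ->
  amin * gap (gibbs S) f [set: V] <=
  2 * (256 * Delta%:R * t%:R) ^+ r.+1 * small_const b r *
    block_gap (gibbs S) Bs alpha f [set: V].
Proof.
move=> f0 t0 tn.
have mu0 := gibbs_ge0 Z_gt0.
have marg := gibbs_marginal_bound Z_gt0 mb.
have conn := gibbs_flip_connected Z_gt0 tc.
have loc g (g0 : forall s, 0 <= g s) := gap_local mu0 eta_ge0 b_gt0 b_le1
  (gibbs_covariance_bound Z_gt0 spec) marg g0.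
have exch := @gibbs_exchangeable R V G q S.
have G0 := block_gap_ge0 mu0 alpha_ge0 [set: V] f0.
have sc0 := small_const_gt0 r b_gt0.
have D0 : 0 < Delta%:R :> R by rewrite ltr0n.
have t1 : 1 <= t%:R :> R by rewrite ler1n.
have D1 : 1 <= Delta%:R :> R by rewrite ler1n.
case: (leqP (2 * r * (16 * Delta)) #|V|) => [big|small].
  pose l := (#|V| %/ (16 * Delta))%N.
  have d0 : (0 < 16 * Delta)%N by rewrite muln_gt0.
  have l2r : (2 * r <= l)%N by rewrite /l leq_divRL.
  have rl : (r < l)%N.
    by apply: leq_trans l2r; move: r_gt0; clear; lia.
  have dl : (16 * Delta * l <= #|V|)%N by rewrite mulnC leq_divM.
  have ln : (l <= #|V|)%N by apply: leq_trans dl; rewrite leq_pmull.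
  have CnCl : ('C(#|V|, r.+1) <= (64 * Delta) ^ r.+1 * 'C(l, r.+1))%N.
    apply: binom_scale => i ir.
    have nl : (#|V| < l.+1 * (16 * Delta))%N by apply: ltn_ceil.
    apply: (leq_trans (leq_subr _ _)); apply: (leq_trans (ltnW nl)).
    have -> : (64 * Delta = 16 * Delta * 4)%N by rewrite mulnAC.
    rewrite [leqLHS]mulnC -[leqRHS]mulnA leq_mul2l; apply/orP; right.
    by move: l2r ir r_gt0; clear; lia.
  have CnCl' : 'C(#|V|, r.+1)%:R <= (64 * Delta%:R) ^+ r.+1 * 'C(l, r.+1)%:R :> R.
    by rewrite -natrM -natrX -natrM ler_nat.
  pose Cmax : R := (4 * t%:R) ^+ r.+1.
  have C1 : 1 <= Cmax by rewrite exprn_ege1//; lra.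
  have CM : 'C((r.+1 * t).-1, r.+1)%:R <= Cmax.
    apply: le_trans (binom_mul_le R r.+1 t0).
    by rewrite ler_nat leq_bin2l// leq_pred.
  have few := few_big_components dl t0 tn.
  have Cl0 : 0 < 'C(l, r.+1)%:R :> R by rewrite ltr0n bin_gt0.
  have := block_factorization mu0 exch b_gt0 b_le1 marg conn loc r_ge
    alpha_ge0 amin_ge0 amin_le f0 rl ln C1 CM.
  set N := #|[set T : {set V} | _]| in few *.
  have -> : 2 * 'C(#|V|, r.+1)%:R * N%:R <= ('C(l, r.+1) * 'C(#|V|, l))%:R :> R.
    rewrite natrM.
    apply: (@le_trans _ _ (2 * ((64 * Delta%:R) ^+ r.+1 * 'C(l, r.+1)%:R) * N%:R)).
      by rewrite ler_wpM2r// ler_wpM2l.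
    have := ler_wpM2l (ltW Cl0) few; lra.
  move=> /(_ isT) H.
  rewrite -(ler_pM2l Cl0); apply: le_trans H _.
  set Gp := block_gap _ _ _ _ _ in G0 *.
  have K0 : 0 <= Cmax * small_const b r * Gp.
    by apply: mulr_ge0 => //; apply: mulr_ge0; [apply: le_trans C1|apply: ltW].
  have H2 := ler_wpM2r K0 CnCl'.
  have -> : 256 * Delta%:R * t%:R = (64 * Delta%:R) * (4 * t%:R) :> R by ring.
  rewrite [(64 * _ * _) ^+ _]exprMn -/Cmax; lra.
pose Cmax : R := (4 * (32 * Delta)%:R) ^+ r.+1.
have C1 : 1 <= Cmax by rewrite exprn_ege1// -natrM ler1n !muln_gt0 Delta_gt0.
have CM : 'C(#|V|, r.+1)%:R <= Cmax.
  have d0 : (0 < 32 * Delta)%N by rewrite muln_gt0.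
  apply: le_trans (binom_mul_le R r.+1 d0).
  rewrite ler_nat leq_bin2l//; move: small r_gt0; clear; lia.
have := gap_le_bounded mu0 b_gt0 b_le1 marg conn loc r_ge alpha_ge0 amin_ge0 amin_le
  (W := [set: V]) f0 (eq_leq (cardsT V)) C1 CM.
move/le_trans; apply; apply: ler_wpM2r => //; apply: ler_wpM2r; first exact: ltW.
have P0 : 0 <= 256 * Delta%:R * t%:R :> R.
  exact: mulr_ge0 (mulr_ge0 (ler0n _ _) (ler0n _ _)) (ler0n _ _).
apply: (@le_trans _ _ ((256 * Delta%:R * t%:R) ^+ r.+1)).
  apply: lerXn2r; [|by rewrite nnegrE|].
    by rewrite nnegrE; apply: mulr_ge0; apply: ler0n.
  rewrite natrM; have : Delta%:R * 1 <= Delta%:R * t%:R :> R by rewrite ler_wpM2l.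
  by rewrite -[256 * _ * _]mulrA; lra.
move: (exprn_ge0 r.+1 P0); move: (_ ^+ _) => Y Y0; lra.
Qed.

End GibbsFactorization.

(** * The constants of the theorem *)

Section Constants.
Variable R : realType.

Lemma ln2_ge : 2^-1 <= ln 2 :> R.
Proof.
have h : 0 < 2 :> R by [].
have := ln_ge_1BV h; lra.
Qed.

Lemma ln4_ge1 n : (4 <= n)%N -> 1 <= ln n%:R :> R.
Proof.
move=> n4; apply: (@le_trans _ _ (2^-1 *+ 2)); first by rewrite mulr2n; lra.
apply: (@le_trans _ _ (ln (2 ^+ 2))); first by rewrite lnXn// lerMn2r ln2_ge orbT.
have n0 : 0 < n%:R :> R by rewrite ltr0n (leq_trans _ n4).
rewrite ler_ln ?posrE ?exprn_gt0//.
have -> : 2 ^+ 2 = 4%:R :> R by ring.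
by rewrite ler_nat.
Qed.

(** The first bound on t is what few_big_components asks for. Since |W| <
    (r+1) t for the components W, the second makes C(|W|, r+1) a power of ln
    n. *)
Lemma exponent_choice n : (4 <= n)%N ->
  exists2 t, (0 < t)%N && (256 * n ^ 2 <= 4 ^ t)%N & t%:R <= 7 * ln n%:R :> R.
Proof.
move=> n4; have n0 : (0 < n)%N by apply: leq_trans n4.
pose k := trunc_log 2 n; exists (k + 5)%N.
  rewrite addnS /= (_ : (k + 4).+1 = 4 + k.+1)%N; last by rewrite addnC addnS addSn.
  rewrite expnD (_ : 4 ^ 4 = 256)%N// leq_mul2l/=.
  rewrite (_ : 4 = 2 ^ 2)%N// -expnM mulnC expnM leq_exp2r//.
  exact/ltnW/trunc_log_ltn.
have ln1 := ln4_ge1 n4.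
have H : k%:R * 2^-1 <= ln n%:R :> R.
  apply: (@le_trans _ _ (ln ((2 ^ k)%:R))).
    by rewrite natrX lnXn// -[leRHS]mulr_natl; apply: ler_wpM2l => //; apply: ln2_ge.
  rewrite ler_ln ?posrE ?ltr0n ?expn_gt0// ler_nat.
  exact: trunc_logP.
rewrite natrD; lra.
Qed.

(** The entropy n ln (1/b) is at most exp (ln n + 1/b), and 4 ln n / b is at
    least ln (16 n) + 1/b because ln n >= 1 and ln 16 <= 2 ln n. *)
Lemma contraction_small n (b lambda : R) t : (4 <= n)%N -> 0 < b -> b <= 1 ->
  0 <= lambda -> lambda <= 1 -> 4 * ln n%:R / b <= lambda * t%:R ->
  (1 - lambda) ^+ t * (n%:R * ln b^-1) <= 16^-1.
Proof.
move=> n4 b0 b1 l0 l1 lt; have ln1 := ln4_ge1 n4.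
have n0 : 0 < n%:R :> R by rewrite ltr0n (leq_trans _ n4).
have bV : 1 <= b^-1 by rewrite invf_ge1.
have H1 : (1 - lambda) ^+ t <= expR (- (4 * ln n%:R / b)).
  apply: (@le_trans _ _ (expR (- lambda) ^+ t)).
    by apply: lerXn2r; rewrite ?nnegrE ?subr_ge0 ?expR_ge0//; apply: expR_ge1Dx.
  by rewrite -expRM_natl ler_expR mulrC mulNr lerN2.
have H2 : ln b^-1 <= b^-1.
  by apply/ltW/ln_sublinear; rewrite invr_gt0.
have lb0 : 0 <= ln b^-1 by apply: ln_ge0.
apply: (@le_trans _ _ (expR (- (4 * ln n%:R / b)) * (n%:R * b^-1))).
  apply: ler_pM => //; first by rewrite exprn_ge0// subr_ge0.
    by rewrite mulr_ge0// ltW.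
  by rewrite ler_wpM2l// ltW.
have L16 : expR (2 * ln n%:R) >= 16 :> R.
  rewrite expRM_natl lnK ?posrE//.
  by rewrite -natrX ler_nat (leq_trans (_ : 16 <= 4 ^ 2)%N)// leq_exp2r.
have bexp : b^-1 <= expR b^-1.
  by apply: le_trans (expR_ge1Dx _); lra.
have e16 : 16^-1 = expR (- (2 * ln n%:R)) * (expR (2 * ln n%:R) / 16) :> R.
  by rewrite expRN; field; rewrite gt_eqF ?expR_gt0.
apply: (@le_trans _ _ (expR (- (4 * ln n%:R / b)) * (expR (ln n%:R) * expR b^-1))).
  apply: ler_wpM2l; first exact: expR_ge0.
  by rewrite lnK ?posrE// ler_wpM2l// ltW.
rewrite -!expRD.
apply: (@le_trans _ _ (expR (- (2 * ln n%:R)))).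
  rewrite ler_expR.
  have h : 4 * ln n%:R / b = 4 * (ln n%:R * b^-1) by ring.
  have h1 : ln n%:R <= ln n%:R * b^-1 by rewrite ler_peMr//; lra.
  have h2 : b^-1 <= ln n%:R * b^-1 by rewrite ler_peMl//; lra.
  rewrite h; lra.
rewrite expRN lef_pV2 ?posrE ?expR_gt0//.
Qed.

(** The constant 256 collects 2, 2, 16 and 4. The factor r + 1 is at most
    2^(r+1), and each of the r + 1 factors 2 c Delta t / b^4 is absorbed in
    one power of the base, where 14 c is 2 * 7 * c; the two remaining powers
    pay for ln n / b. *)
Lemma final_bound (a c b eta : R) (Delta n r t : nat) : a = 256 -> 1 <= c ->
  (4 <= n)%N -> (0 < Delta)%N ->
  0 < b -> b <= 1 -> 0 < eta -> t%:R <= 7 * ln n%:R :> R ->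
  2 * (2 * (c * Delta%:R * t%:R) ^+ r.+1 * small_const b r) * (4 * ln n%:R / b)
  <= a * (14 * c * (eta + 1) ^+ 5 * Delta%:R * ln n%:R / b ^+ 6) ^+ (3 + r).
Proof.
move=> aE c1 n4 D0 b0 b1 e0 tn; have ln1 := ln4_ge1 n4.
have a0 : 0 <= a by rewrite aE; apply: ler0n.
have D1 : 1 <= Delta%:R :> R by rewrite ler1n.
move: (ln n%:R) (Delta%:R : R) (t%:R : R) (ler0n R t) ln1 tn D1 => L D T T0 L1 TL D1.
have bV : 1 <= b^-1 by rewrite invf_ge1.
have bVn k : 1 <= b^-1 ^+ k by rewrite exprn_ege1.
have e5 : 1 <= (eta + 1) ^+ 5 by rewrite exprn_ege1//; lra.
have one_mul (u v : R) : 1 <= u -> 1 <= v -> 1 <= u * v.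
  by move=> u1 v1; rewrite -[1]mulr1; apply: ler_pM.
have K1 : 1 <= 14 * c by lra.
have DL1 : 1 <= D * L by apply: (one_mul).
set X := _ / b ^+ 6.
have XE : X = 14 * c * ((eta + 1) ^+ 5 * (D * L * b^-1 ^+ 6)).
  by rewrite /X exprVn; ring.
have [K KE] : exists K, K = 14 * c by exists (14 * c).
rewrite -KE in K1 XE.
have XY : K * (D * L * b^-1 ^+ 6) <= X.
  rewrite XE; apply: ler_wpM2l; first by lra.
  by apply: ler_peMl => //; apply: le_trans (one_mul _ _ DL1 (bVn 6%N)).
have X4 : K * (D * L * b^-1 ^+ 4) <= X.
  apply: le_trans XY; apply: ler_wpM2l; first by lra.
  by apply: ler_wpM2l; [lra|apply: ler_weXn2l].
have X1 : L / b <= X.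
  apply: le_trans X4; apply: (@le_trans _ _ (D * L * b^-1 ^+ 4)).
    apply: ler_pM; [lra|by rewrite invr_ge0 ltW| |].
      by apply: ler_peMl => //; lra.
    by rewrite -[leLHS]expr1; apply: ler_weXn2l.
  by apply: ler_peMl => //; apply: le_trans (one_mul _ _ DL1 (bVn 4%N)).
have Xge1 : 1 <= X by apply: le_trans X1; apply: (one_mul).
have X0 : 0 <= X by lra.
rewrite /small_const.
have rr : r.+1%:R <= 2 ^+ r.+1 :> R by rewrite -natrX ler_nat ltnW// ltn_expl.
have cD0 : 0 <= c * D by apply: mulr_ge0; lra.
have cDT0 : 0 <= c * D * T by apply: mulr_ge0.
have b40 : 0 <= b^-1 ^+ 4 by apply: le_trans (bVn 4%N).
have pw : 2 ^+ r.+1 * (c * D * T) ^+ r.+1 * (b^-1 ^+ 4) ^+ r.+1 <= X ^+ r.+1.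
  rewrite -!exprMn; apply: lerXn2r.
  - by rewrite nnegrE; apply: mulr_ge0 => //; apply: mulr_ge0.
  - by rewrite nnegrE.
  apply: le_trans X4; rewrite KE.
  have -> : 2 * (c * D * T) * b^-1 ^+ 4 = 2 * (c * D * b^-1 ^+ 4) * T by ring.
  have -> : 14 * c * (D * L * b^-1 ^+ 4) = 2 * (c * D * b^-1 ^+ 4) * (7 * L) by ring.
  by apply: ler_wpM2l => //; apply: mulr_ge0 => //; apply: mulr_ge0.
have P0 : 0 <= (c * D * T) ^+ r.+1 by apply: exprn_ge0.
have B0 : 0 <= (b^-1 ^+ 4) ^+ r.+1 by apply: exprn_ge0.
have -> : (b ^- r.+1) ^+ 4 = (b^-1 ^+ 4) ^+ r.+1 by rewrite -exprVn -!exprM mulnC.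
move: ((c * D * T) ^+ r.+1) ((b^-1 ^+ 4) ^+ r.+1) P0 B0 pw => P B P0 B0 pw.
have LB0 : 0 <= L / b by apply: mulr_ge0; [lra|rewrite invr_ge0 ltW].
have -> : 2 * (2 * P * (16 * B * r.+1%:R)) * (4 * L / b) = a * (r.+1%:R * P * B * (L / b)).
  by rewrite aE; ring.
apply: ler_wpM2l => //.
have -> : X ^+ (3 + r) = X ^+ r.+1 * X ^+ 2.
  by rewrite -exprD; congr (X ^+ _); rewrite addnC addn3 addn2.
have rPB0 : 0 <= r.+1%:R * P * B by apply: mulr_ge0 => //; apply: mulr_ge0.
apply: ler_pM => //.
  apply: le_trans pw.
  by apply: ler_wpM2r => //; apply: ler_wpM2r.
by apply: le_trans X1 _; rewrite expr2; apply: ler_peMl.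
Qed.

End Constants.

Theorem theorem1p10 (R : realType) :
  exists C A : R, 0 < C /\ 0 < A /\
  forall (b eta : R) (Delta n q : nat) (V : finType) (G : sgraph V)
    (S : spin_system R G q) (Bs : {set {set V}}) (alpha : {set V} -> R),
    0 < b -> 0 < eta -> (3 <= Delta)%N ->
    #|V| = n -> max_degree G = Delta ->
    0 < partition_function S ->
    totally_connected S ->
    finset.cover Bs = [set: V]%SET ->
    is_distr Bs alpha ->
    spectrally_independent S eta ->
    marginally_bounded S b ->
    (mixing_time (block_dynamics Bs alpha : state S -> state S -> R)
     <= ((alpha_min Bs alpha)%:E)^-1 *
        (A * (C * (eta + 1) ^+ 5 * Delta%:R * ln n%:R / b ^+ 6)
             ^ (3 + Num.ceil (2 * eta / b)))%:E)%E.
Proof.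
exists 3584, 256; do 2![split; first by rewrite ltr0n].
move=> b eta Delta n q V G S Bs alpha b0 eta0 D3 nE GE Z0 tc _ ad spec mb.
have mu0 := gibbs_ge0 Z0.
have marg := gibbs_marginal_bound Z0 mb.
have deg v : (#|[set w | G v w]%SET| <= Delta)%N.
  by rewrite -GE /max_degree (leq_bigmax (F := fun v => #|[set w | G v w]%SET|)).
have Dn : (Delta < n)%N.
  have n0 : (0 < n)%N.
    rewrite lt0n -nE; apply: contraTneq D3 => V0.
    by rewrite -GE /max_degree big1// => v; have := fintype0 v V0.
  rewrite -GE -(prednK n0) ltnS; apply/bigmax_leqP => v _.
  rewrite -nE -(cardsC1 v); apply: subset_leq_card; apply/fintype.subsetP => w.
  by rewrite !inE; apply: contraTneq => ->; rewrite adj_irr.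
have n4 : (4 <= n)%N by apply: leq_trans Dn.
have [v0 _] : exists v0 : V, true.
  have : (0 < #|V|)%N by rewrite nE (leq_trans _ n4).
  by case/card_gt0P => v _; exists v.
have [s0 ms0] : exists s, 0 < gibbs S s.
  have [/existsP//|/existsPn none] := boolP [exists s, 0 < gibbs S s].
  have := sum_gibbs Z0; rewrite big1 => [/eqP|s _]; first by rewrite eq_sym oner_eq0.
  by apply/eqP; rewrite eq_le mu0 andbT leNgt none.
have b1 : b <= 1.
  have vN : v0 \notin (finset.set0 : {set V}) by rewrite inE.
  have := marg s0 ms0 _ _ vN; rewrite mass0// mulr1 => /le_trans; apply.
  rewrite -(sum_gibbs Z0) /mass [leLHS]big_mkcond; apply: ler_sum => s _.
  by case: ifP.
set amin := alpha_min Bs alpha.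
have a0 : 0 <= amin.
  apply: le_bigmin => // v _; apply: sumr_ge0 => B /andP[BB _]; exact: (proj1 ad).
have aB v : amin <= \sum_(B in Bs | v \in B) alpha B by apply: bigmin_le.
have a1 : amin <= 1.
  apply: le_trans (aB v0) _; rewrite -(proj2 ad) [leRHS](bigID (fun B : {set V} => v0 \in B))/=.
  by rewrite lerDl; apply: sumr_ge0 => B /andP[BB _]; apply: (proj1 ad).
have [r [rE r_ge r0]] : exists r : nat, [/\ Num.ceil (2 * eta / b) = r%:Z,
    2 * eta / b <= r%:R & (0 < r)%N].
  have p0 : 0 < 2 * eta / b by rewrite divr_gt0// mulr_gt0.
  have := ceil_ge (2 * eta / b); have := ceil_gt0 (2 * eta / b); rewrite p0.
  case: (Num.ceil _) => // k k0 kb; by exists k.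
rewrite rE -PoszD -exprnP.
have [t /andP[t0 tn] tL] := exponent_choice R n4.
have ln1 := ln4_ge1 R n4.
have Lb1 : 1 <= 4 * ln n%:R / b.
  by rewrite ler_pdivlMr// mul1r; lra.
have one_mul (u v : R) : 1 <= u -> 1 <= v -> 1 <= u * v.
  by move=> u1 v1; rewrite -[1]mulr1; apply: ler_pM.
have nat1 k : (0 < k)%N -> 1 <= k%:R :> R by move=> k0; rewrite ler1n.
set X := 256 * _.
have [Gam [G1 fin fact0]] : exists Gam, [/\ 1 <= Gam, 2 * Gam * (4 * ln n%:R / b) <= X &
    forall f, (forall s, 0 <= f s) -> amin * gap (gibbs S) f [set: V]%SET
      <= Gam * block_gap (gibbs S) Bs alpha f [set: V]%SET].
  exists (2 * (256 * Delta%:R * t%:R) ^+ r.+1 * small_const b r); split.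
  - apply: (one_mul); [apply: (one_mul); first exact: nat1|].
      apply: exprn_ege1; apply: (one_mul); last exact: nat1.
      by apply: (one_mul); apply: nat1 => //; apply: leq_trans D3.
    apply: (one_mul); last exact: nat1.
    apply: (one_mul); first exact: nat1.
    by apply: exprn_ege1; rewrite -exprVn; apply: exprn_ege1; rewrite invf_ge1.
  - have c1 : 1 <= 256 :> R by rewrite ler1n.
    have := final_bound r (erefl (256 : R)) c1 n4 (leq_trans (ltn0Sn 2) D3) b0 b1 eta0 tL.
    by have -> : 14 * 256 = 3584 :> R by ring.
  - move=> f f0; apply: (gibbs_block_factorization Z0 b0 b1 (ltW eta0) _ deg _ tc spec mb
    r_ge r0 (proj1 ad) a0 aB f0 t0).
    + by apply: leq_trans D3.
    + by rewrite nE ltnW.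
    + by rewrite nE.
move: X fin => X fin.
have Gp : 0 < Gam by apply: lt_le_trans G1.
have Gp2 : 1 <= Gam * (4 * ln n%:R / b) by apply: (one_mul).
have [aE|aN] := eqVneq amin 0.
  rewrite aE inve0 gt0_mulye ?leey//.
  by rewrite lte_fin; apply: lt_le_trans fin; lra.
have ap : 0 < amin by rewrite lt0r aN.
rewrite inver (negbTE aN) -EFinM.
pose lambda := amin / Gam.
have l0 : 0 < lambda by rewrite divr_gt0.
have l1 : lambda <= 1 by rewrite ler_pdivrMr// mul1r (le_trans a1).
have fact f : (forall s, 0 <= f s) ->
    lambda * gap (gibbs S) f [set: V]%SET <= block_gap (gibbs S) Bs alpha f [set: V]%SET.
  by move=> f0; rewrite /lambda mulrAC ler_pdivrMr// [leRHS]mulrC; apply: fact0.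
pose w := 4 * ln n%:R / b / lambda.
pose T := (Num.truncn w).+1.
have w0 : 0 <= w by rewrite divr_ge0 ?(ltW l0)//; lra.
have wT : w <= T%:R by apply/ltW/truncnS_gt.
have small : (1 - lambda) ^+ T * (#|V|%:R * ln b^-1) <= 16^-1.
  rewrite nE; apply: contraction_small => //; first exact: ltW.
  by rewrite [leRHS]mulrC -ler_pdivrMr.
apply: le_trans (mixing_time_le Z0 ad b0 marg l1 fact (ltn0Sn _) small) _.
rewrite lee_fin; apply: (@le_trans _ _ (w + 1)).
  by rewrite -natr1 lerD2r truncn_le.
rewrite -[leRHS]mulrC ler_pdivlMr//.
apply: le_trans fin.
have -> : w = 4 * ln n%:R / b * Gam / amin by rewrite /w /lambda; field; rewrite !gt_eqF.
rewrite mulrDl mul1r (divfK aN).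
have -> : 2 * Gam * (4 * ln n%:R / b) = 4 * ln n%:R / b * Gam + Gam * (4 * ln n%:R / b).
  by ring.
by rewrite lerD2l (le_trans a1).
Qed.
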